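(* Let $0\le\alpha<1$ and suppose $f=h+\overline{g}\in \mathcal{W}^{0}_{H}(\alpha)$, with $h(z)=z+\sum_{n=2}^{\infty}a_nz^n$ and $g(z)=\sum_{n=2}^{\infty}b_nz^n$. Let $S_r$ denote the area of the image of the subdisk $|z|<r$ under the mapping $f$. Then $$|z|+\sum_{n=2}^{\infty}(|a_n|+|b_n|)|z|^n+\frac{S_r}{\pi}\le d(f(0),\partial f(\mathbb{D}))$$ for $|z|=r\le r_4$, where $r_4$ is the unique root of the equation $$r+r^{2}+2\sum_{n=2}^{\infty}\frac{(n\alpha+1-\alpha)r^{n}+2r^{2n}}{n(n\alpha+1-\alpha)^{2}}-1-2\sum_{n=2}^{\infty}\frac{(-1)^{n-1}}{n(n\alpha+1-\alpha)}=0$$ in the interval $(0,1)$. Furthermore, the radius $r_4$ is best possible, i.e. it cannot be replaced by a larger number for which the inequality still holds for all $f\in\mathcal{W}^{0}_{H}(\alpha)$.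
   Context: $\mathbb{D}=\{z\in\mathbb{C}:|z|<1\}$. $\mathcal{H}$ is the class of complex-valued harmonic functions $f=h+\overline{g}$ on $\mathbb{D}$ with $h,g$ analytic in $\mathbb{D}$, $h(0)=h'(0)-1=0$ and $g(0)=0$. $\mathcal{H}_0=\{f=h+\overline{g}\in\mathcal{H}: g'(0)=0\}$; each $f\in\mathcal{H}_0$ has $h(z)=z+\sum_{n\ge2}a_nz^n$, $g(z)=\sum_{n\ge2}b_nz^n$. For $0\le\alpha<1$, $$\mathcal{W}^{0}_{H}(\alpha)=\left\{f=h+\overline{g}\in\mathcal{H}_0:\ \mathrm{Re}\left(h'(z)+\alpha zh''(z)\right)>\left|g'(z)+\alpha zg''(z)\right|,\ z\in\mathbb{D}\right\}.$$ $d(f(0),\partial f(\mathbb{D}))$ denotes the Euclidean distance between $f(0)$ and the boundary of $f(\mathbb{D})$. *)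

(* Defs.v *)
From HB Require Import structures.
From mathcomp Require Import all_boot all_order all_algebra.
From mathcomp Require Import all_classical all_reals all_analysis.
From mathcomp Require Import complex.

Set Implicit Arguments.
Unset Strict Implicit.
Unset Printing Implicit Defensive.

Import Order.TTheory GRing.Theory Num.Theory.
Import numFieldNormedType.Exports.

Local Open Scope ring_scope.
Local Open Scope classical_set_scope.

(* R[i] as a normed space over itself, so that [derive1] of a map
   R[i] -> R[i] is the complex derivative. *)
HB.instance Definition _ (R : rcfType) := NormedModule.copy R[i] (R[i]^o).

(* The R-valued modulus; `|z| is valued in R[i]. *)
Notation cmod := ComplexField.Normc.normc.

Section PlaneGeometry.
Variable R : realType.
Implicit Types (A : set R[i]) (z : R[i]) (r : R).

Definition disk r : set R[i] := [set z | cmod z < r].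

Definition boundary A : set R[i] := closure A `\` interior A.

(* Extended-real valued, with the convention that the distance to the empty
   set is +oo. *)
Definition edist_set z A : \bar R :=
  ereal_inf [set (cmod (z - w))%:E | w in A].

Definition area A : \bar R :=
  (@lebesgue_measure R \x @lebesgue_measure R)%E
    [set p : R * R | A (p.1 +i* p.2)%C].

End PlaneGeometry.

Section HarmonicClass.
Variable R : realType.
Implicit Types (h g : R[i] -> R[i]) (a b : nat -> R[i]) (alpha r : R).

Definition analytic_on (D : set R[i]) h : Prop :=
  forall z, D z -> derivable h z 1.

Definition harm h g : R[i] -> R[i] := fun z => h z + (g z)^*%C.

(* The class H is carried by the pair (h, g), which harm h g determines on the
   unit disk because of the normalisation g 0 = 0. *)
Definition classH h g : Prop :=
  [/\ analytic_on (disk 1) h, analytic_on (disk 1) g,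
      h 0 = 0, derive1 h 0 = 1 & g 0 = 0].

Definition classH0 h g : Prop := classH h g /\ derive1 g 0 = 0.

Definition classW0 alpha h g : Prop :=
  classH0 h g /\
  forall z, disk 1 z ->
    cmod (derive1 g z + alpha%:C%C * z * derive1n 2 g z) <
      complex.Re (derive1 h z + alpha%:C%C * z * derive1n 2 h z).

(* h(z) = z + sum_(n >= 2) a_n z^n and g(z) = sum_(n >= 2) b_n z^n on the unit
   disk; a 0, a 1, b 0 and b 1 are never used. *)
Definition coefs_h h a : Prop :=
  forall z, disk 1 z ->
    (z + \sum_(2 <= n < N) a n * z ^+ n) @[N --> \oo] --> h z.

Definition coefs_g g b : Prop :=
  forall z, disk 1 z ->
    (\sum_(2 <= n < N) b n * z ^+ n) @[N --> \oo] --> g z.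

Definition bohr_ineq h g a b (z : R[i]) : Prop :=
  ((cmod z)%:E
   + \sum_(2 <= n <oo) ((cmod (a n) + cmod (b n)) * cmod z ^+ n)%R%:E
   + area (harm h g @` disk (cmod z)) * (pi^-1)%R%:E
   <= edist_set (harm h g 0%R) (boundary (harm h g @` disk 1)))%E.

Definition bohr_fun alpha r : R :=
  let c (n : nat) := n%:R * alpha + 1 - alpha in
  r + r ^+ 2
  + 2 * limn (fun N => \sum_(2 <= n < N)
          ((c n * r ^+ n + 2 * r ^+ (2 * n)) / (n%:R * c n ^+ 2)))
  - 1
  - 2 * limn (fun N => \sum_(2 <= n < N) ((-1) ^+ n.-1 / (n%:R * c n))).

End HarmonicClass.

(* Main.v *)
Require Import Defs.
From HB Require Import structures.
From mathcomp Require Import all_boot all_order all_algebra.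
From mathcomp Require Import all_classical all_reals all_analysis.
From mathcomp Require Import measurable_realfun complex ring lra zify.

(* Write f = h + conj g, c_n = n alpha + 1 - alpha.  For every unimodular e the
   function h' + alpha z h'' + e (g' + alpha z g'') is 1 at the origin and has
   nonnegative real part.  Caratheodory's inequality then gives
   |a_n| + |b_n| <= 2 / (n c_n), while Harnack's inequality, integrated twice along
   rays, gives |f(z)| >= |F(-|z|)| for F(z) = z + 2 \sum_(n >= 2) z^n / (n c_n).
   Letting |z| tend to 1 bounds the distance from 0 to the boundary of the image
   from below by 1 + 2 \sum_(n >= 2) (-1)^(n-1) / (n c_n).  Since f is injective with
   Jacobian |h'|^2 - |g'|^2, the area S_r is at most
   pi (r^2 + 4 \sum_(n >= 2) r^(2n) / (n c_n^2)).  All these estimates are equalities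
   for f = F, so the Bohr inequality holds up to the zero of the resulting
   increasing function of r, and F shows that no larger radius works.

   No change of variables formula is used for the area: the disk is cut into polar
   cells on which f is nearly affine, and the areas of the resulting
   parallelograms are summed by Parseval's identity on roots of unity. *)

Set Implicit Arguments.
Unset Strict Implicit.
Unset Printing Implicit Defensive.

Import Order.TTheory GRing.Theory Num.Theory.
Import numFieldNormedType.Exports.

Local Open Scope ring_scope.
Local Open Scope classical_set_scope.

(** Every function is handled through its coefficient sequence. The passage from h' + alpha z h'' to
    h' is a sign argument for f + alpha t f' ([euler_ode_ge0]), which covers alpha = 0 as well. It
    is used twice: against a constant, giving Re h' - |g'| >= (1 - s) / (1 + s) on |z| = s, the
    source of injectivity and of a uniformly invertible differential; and against the extremal
    function, giving the sharp growth bound. The growth bound only controls |f(z)| for |z| near 1.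
    To control the boundary of the image it needs a quantitative open mapping property, uniform on
    closed subdisks. This property comes from the same contraction argument that, in the area
    estimate, compares the image of a small square with a parallelogram. In the upper area estimate
    |h'|^2 - |g'|^2 is replaced by |h'|^2 + |g'|^2. Nothing is lost in the end, because the
    coefficient bound is on |a_n| + |b_n| and the extremal function has g = 0. *)

Local Notation Re := complex.Re.
Local Notation Im := complex.Im.

(** * The real-valued modulus; limits and derivatives in R[i] with real tolerances *)

Section Modulus.
Variable R : realType.
Implicit Types (z w : R[i]) (x y : R).

Lemma cmodE z : `|z| = (cmod z)%:C%C.
Proof. by []. Qed.

Lemma cmod_ge0 z : 0 <= cmod z.
Proof. by case: z => a b; exact: sqrtr_ge0. Qed.

Lemma cmod0 : cmod (0 : R[i]) = 0.
Proof. exact: ComplexField.Normc.normc0. Qed.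

Lemma cmod_eq0 z : (cmod z == 0) = (z == 0).
Proof.
by apply/eqP/eqP => [/ComplexField.Normc.eq0_normc//|->]; exact: cmod0.
Qed.

Lemma cmodM z w : cmod (z * w) = cmod z * cmod w.
Proof. exact: ComplexField.Normc.normcM. Qed.

Lemma cmod1 : cmod (1 : R[i]) = 1.
Proof. exact: ComplexField.Normc.normc1. Qed.

Lemma cmodX z n : cmod (z ^+ n) = cmod z ^+ n.
Proof. by elim: n => [|n IH]; rewrite ?expr0 ?cmod1// !exprS cmodM IH. Qed.

Lemma cmodV z : cmod z^-1 = (cmod z)^-1.
Proof. exact: ComplexField.Normc.normcV. Qed.

Lemma cmodN z : cmod (- z) = cmod z.
Proof. by case: z => a b /=; rewrite !sqrrN. Qed.

Lemma cmodD z w : cmod (z + w) <= cmod z + cmod w.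
Proof. by rewrite -lecR rmorphD/=; exact: (@ler_normD _ R[i]). Qed.

Lemma cmodB z w : cmod (z - w) <= cmod z + cmod w.
Proof. by rewrite -(cmodN w) cmodD. Qed.

Lemma cmodC z w : cmod (z - w) = cmod (w - z).
Proof. by rewrite -cmodN opprB. Qed.

Lemma cmodR x : cmod (x%:C%C) = `|x|.
Proof. by rewrite /= expr0n addr0 sqrtr_sqr. Qed.

Lemma cmod_sqr z : cmod z ^+ 2 = Re z ^+ 2 + Im z ^+ 2.
Proof. by case: z => a b /=; rewrite sqr_sqrtr// addr_ge0// sqr_ge0. Qed.

Lemma cmod_conj z : cmod z^*%C = cmod z.
Proof. by case: z => a b /=; rewrite sqrrN. Qed.

Lemma ler_Re_cmod z : `|Re z| <= cmod z.
Proof.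
rewrite -(@ler_pXn2r _ 2)// ?nnegrE ?normr_ge0 ?cmod_ge0//.
by rewrite cmod_sqr real_normK ?num_real// lerDl sqr_ge0.
Qed.

Lemma ler_Im_cmod z : `|Im z| <= cmod z.
Proof.
rewrite -(@ler_pXn2r _ 2)// ?nnegrE ?normr_ge0 ?cmod_ge0//.
by rewrite cmod_sqr real_normK ?num_real// lerDr sqr_ge0.
Qed.

Lemma ler_cmod_ReIm z : cmod z <= `|Re z| + `|Im z|.
Proof.
rewrite -(@ler_pXn2r _ 2)// ?nnegrE ?addr_ge0 ?normr_ge0 ?cmod_ge0//.
rewrite cmod_sqr sqrrD !real_normK ?num_real//.
by have := mulr_ge0 (normr_ge0 (Re z)) (normr_ge0 (Im z)); lra.
Qed.

Lemma cmod_sum (I : Type) (s : seq I) (P : pred I) (F : I -> R[i]) :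
  cmod (\sum_(i <- s | P i) F i) <= \sum_(i <- s | P i) cmod (F i).
Proof.
elim/big_rec2 : _ => [|i x z _ h]; first by rewrite cmod0.
by rewrite (le_trans (cmodD _ _))// lerD2l.
Qed.

Lemma cReD z w : Re (z + w) = Re z + Re w.
Proof. by case: z w => [a b] [c d]. Qed.
Lemma cImD z w : Im (z + w) = Im z + Im w.
Proof. by case: z w => [a b] [c d]. Qed.
Lemma cReN z : Re (- z) = - Re z.
Proof. by case: z => [a b]. Qed.
Lemma cImN z : Im (- z) = - Im z.
Proof. by case: z => [a b]. Qed.
Lemma cReM z w : Re (z * w) =
  Re z * Re w - Im z * Im w.
Proof. by case: z w => [a b] [c d]. Qed.
Lemma cImM z w : Im (z * w) =
  Re z * Im w + Im z * Re w.
Proof. by case: z w => [a b] [c d]. Qed.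
Lemma cReJ z : Re z^*%C = Re z.
Proof. by case: z. Qed.
Lemma cImJ z : Im z^*%C = - Im z.
Proof. by case: z. Qed.
Definition ReImE := (cReD, cImD, cReN, cImN, cReM, cImM, cReJ, cImJ).
Lemma cRe_sum (I : Type) (s : seq I) (P : pred I) (F : I -> R[i]) :
  Re (\sum_(i <- s | P i) F i) = \sum_(i <- s | P i) Re (F i).
Proof. by elim/big_rec2 : _ => [//|i x z _ <-]; rewrite cReD. Qed.
Lemma cIm_sum (I : Type) (s : seq I) (P : pred I) (F : I -> R[i]) :
  Im (\sum_(i <- s | P i) F i) = \sum_(i <- s | P i) Im (F i).
Proof. by elim/big_rec2 : _ => [//|i x z _ <-]; rewrite cImD. Qed.

Lemma complexP z w :
  Re z = Re w -> Im z = Im w -> z = w.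
Proof. by case: z w => [a b] [c d] /= -> ->. Qed.

Lemma mulCconj z : z * z^*%C = (cmod z ^+ 2)%:C%C.
Proof. by apply: complexP; rewrite ?cmod_sqr !ReImE /=; ring. Qed.

Lemma normCP (z : R[i]) (e : R[i]) : 0 < e -> (`|z| < e) = (cmod z < Re e).
Proof.
by case: e => a b; rewrite cmodE ltcE/= => /andP[/eqP -> _]; rewrite ltcR.
Qed.

Lemma real_e (e : R[i]) : 0 < e -> 0 < Re e.
Proof. by rewrite ltcE => /andP[]. Qed.

Lemma cvgCP (u : nat -> R[i]) l : u @ \oo --> l <->
  (forall e : R, 0 < e -> exists N, forall n, (N <= n)%N -> cmod (u n - l) < e).
Proof.
split=> [/cvgrPdist_lt ul e e0|ul].
  have /ul : 0 < e%:C%C by rewrite ltcR.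
  by move=> [N _ h]; exists N => n /h /=; rewrite normCP ?ltcR// cmodC.
apply/cvgrPdist_lt => e e0; have [N h] := ul _ (real_e e0).
by exists N => // n /= /h; rewrite normCP// cmodC.
Qed.

(** Differentiability without quotients and with real tolerances: w = z is allowed, and second-order
    estimates such as [psum_quad] give it at once. [cderivP] transfers it to the derivative of the
    statement. *)
Definition cderiv (F : R[i] -> R[i]) z (G : R[i]) :=
  forall e : R, 0 < e -> exists2 d : R, 0 < d &
    forall w, cmod (w - z) < d ->
      cmod (F w - F z - (w - z) * G) <= e * cmod (w - z).

Lemma cderivP F z G : cderiv F z G -> derivable F z 1 /\ derive1 F z = G.
Proof.
move=> FG.
have H : (fun h : R[i] => h^-1 *: (F (h + z) - F z)) @ 0^' --> G.
  apply/cvgrPdist_lt => e e0.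
  have e2 : 0 < Re e / 2 by rewrite divr_gt0 ?real_e.
  have [d d0 h] := FG _ e2.
  exists d%:C%C; first by rewrite /= ltcR.
  move=> x /=; rewrite sub0r normrN normCP ?ltcR//= => xd x0.
  rewrite normCP// cmodC.
  have -> : x^-1 *: (F (x + z) - F z) - G =
            x^-1 * (F (x + z) - F z - (x + z - z) * G).
    by rewrite /GRing.scale/= addrK [RHS]mulrBr mulKf.
  rewrite cmodM cmodV ltr_pdivrMl; last first.
    by rewrite lt_neqAle cmod_ge0 andbT eq_sym cmod_eq0.
  apply: (le_lt_trans (h _ _)); rewrite addrK//.
  rewrite mulrC ltr_pM2l ?ltr_pdivrMr ?ltr_pMr ?real_e//; first by lra.
  by rewrite lt_neqAle cmod_ge0 andbT eq_sym cmod_eq0.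
have H1 : (fun h : R[i] => h^-1 *: ((F \o shift z) (h *: 1) - F z)) @ 0^' --> G.
  by under eq_fun do rewrite /= /GRing.scale /= mulr1.
split; first by apply/cvg_ex; exists G.
rewrite derive1E; exact: cvg_lim H1.
Qed.

End Modulus.

(** * Power series on the unit disk and their termwise derivatives *)

Section PowerSeries.
Variable R : realType.
Implicit Types (u v A B : nat -> R[i]) (z w l : R[i]) (q r : R).

Lemma cmod_cvg_le u l K : u @ \oo --> l ->
  (exists N0, forall n, (N0 <= n)%N -> cmod (u n) <= K) -> cmod l <= K.
Proof.
move=> /cvgCP ul [N0 uK]; rewrite leNgt; apply/negP => Kl.
have [N h] := ul _ (eqbRL (subr_gt0 _ _) Kl).
have := h _ (leq_maxl N N0); have := uK _ (leq_maxr N N0).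
rewrite cmodC; have := cmodD (l - u (maxn N N0)) (u (maxn N N0)).
by rewrite subrK; lra.
Qed.

Lemma Re_cvg_ge u l K : u @ \oo --> l ->
  (exists N0, forall n, (N0 <= n)%N -> K <= Re (u n)) ->
  K <= Re l.
Proof.
move=> /cvgCP ul [N0 uK]; rewrite leNgt; apply/negP => Kl.
have [N h] := ul _ (eqbRL (subr_gt0 _ _) Kl).
have := h _ (leq_maxl N N0); have := uK _ (leq_maxr N N0).
have := ler_Re_cmod (u (maxn N N0) - l); rewrite !ReImE ler_norml => /andP[].
by lra.
Qed.

Lemma cvgC_eq u v l : u =1 v -> u @ \oo --> l -> v @ \oo --> l.
Proof. by move=> /funext ->. Qed.

Lemma cvgCD u v l m : u @ \oo --> l -> v @ \oo --> m ->
  (fun n => u n + v n) @ \oo --> l + m.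
Proof. exact: cvgD. Qed.

Lemma cvgCZ u c l : u @ \oo --> l -> (fun n => c * u n) @ \oo --> c * l.
Proof. by apply: cvgM; exact: cvg_cst. Qed.

Lemma cvgC_cst c : (fun=> c) @ \oo --> (c : R[i]).
Proof. exact: cvg_cst. Qed.

Lemma cvgC_unique u l l' : u @ \oo --> l -> u @ \oo --> l' -> l = l'.
Proof. exact: (@cvg_unique _ (@norm_hausdorff _ R[i]^o)). Qed.

(** The sum is taken coordinatewise so that only completeness of R is used; it is the actual sum for
    [abs_summable] sequences ([csum_cvg]). *)
Definition csum u : R[i] :=
  (limn (fun N => \sum_(n < N) Re (u n)) +i*
   limn (fun N => \sum_(n < N) Im (u n)))%C.

Definition abs_summable u := exists K : R, forall N, \sum_(n < N) cmod (u n) <= K.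

Lemma real_summ (x : nat -> R) (K : R) : (forall N, \sum_(n < N) `|x n| <= K) ->
  cvgn (fun N => \sum_(n < N) x n).
Proof.
move=> xK.
have E (y : nat -> R) : (fun N => \sum_(n < N) y n) = series y.
  by apply/funext => N; rewrite seriesEord.
rewrite E; apply: normed_cvg; rewrite /normed_series_of -E.
apply: nondecreasing_is_cvgn.
  apply/nondecreasing_seqP => n; rewrite big_ord_recr/= lerDl; exact: normr_ge0.
by exists K => _ [N _ <-]; exact: xK.
Qed.

Lemma csum_cvg u : abs_summable u -> (fun N => \sum_(n < N) u n) @ \oo --> csum u.
Proof.
move=> [K uK].
have cR : cvgn (fun N => \sum_(n < N) Re (u n)).
  by apply: (@real_summ (fun n => Re (u n)) K) => N; apply: le_trans (uK N); apply: ler_sum => i _;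
     exact: ler_Re_cmod.
have cI : cvgn (fun N => \sum_(n < N) Im (u n)).
  by apply: (@real_summ (fun n => Im (u n)) K) => N; apply: le_trans (uK N); apply: ler_sum => i _;
     exact: ler_Im_cmod.
apply/cvgCP => e e0; have e2 : 0 < e / 2 by rewrite divr_gt0.
move/cvgrPdist_lt : cR => /(_ _ e2)[N1 _ h1].
move/cvgrPdist_lt : cI => /(_ _ e2)[N2 _ h2].
exists (maxn N1 N2) => n; rewrite geq_max => /andP[/h1 /= {}h1 /h2 /= {}h2].
apply: le_lt_trans (ler_cmod_ReIm _) _; rewrite !ReImE cRe_sum cIm_sum /=.
by rewrite distrC (distrC _ (limn _)) (splitr e) ltrD.
Qed.

Definition psum A z := locked csum (fun n => A n * z ^+ n).

(* The power series [\sum_n A n z^n] has radius of convergence at least 1. *)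
Definition tame A :=
  forall r, 0 < r < 1 -> exists C : R, forall n, cmod (A n) * r ^+ n <= C.

Lemma geom_le q N : 0 <= q < 1 -> \sum_(n < N) q ^+ n <= (1 - q)^-1.
Proof.
move=> /andP[q0 q1]; have q1' : 0 < 1 - q by rewrite subr_gt0.
rewrite -[leRHS]mul1r ler_pdivlMr// mulrC.
have -> : (1 - q) * \sum_(n < N) q ^+ n = 1 - q ^+ N.
  by rewrite -[RHS]opprB subrX1; ring.
by rewrite lerBlDr lerDl exprn_ge0.
Qed.

(** Each of the n terms q^i of the geometric sum is at least q^n. *)
Lemma natr_geom_le q n : 0 <= q < 1 -> n%:R * q ^+ n <= (1 - q)^-1.
Proof.
move=> qq; apply: le_trans (geom_le n qq); move: qq => /andP[q0 q1].
rewrite -[leLHS]mulrC mulr_natr -[X in _ *+ X]card_ord -sumr_const.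
by apply: ler_sum => i _; apply: ler_wiXn2l; rewrite ?q0 ?(ltW q1)// ltnW.
Qed.

Lemma tame_natM A : tame A -> tame (fun n => n%:R * A n).
Proof.
(* The gap between r and s absorbs the factor n, since n (r / s)^n is bounded. *)
move=> tA r /andP[r0 r1]; pose s := (1 + r) / 2.
have [s0 s1 rs] : [/\ 0 < s, s < 1 & r < s] by rewrite /s; split; lra.
clearbody s.
have [|C hC] := tA s; first by rewrite s0.
have C0 : 0 <= C by apply: le_trans (hC 0%N); rewrite mulr_ge0 ?cmod_ge0.
have q01 : 0 <= r / s < 1.
  by rewrite divr_ge0 ?ltW//= ltr_pdivrMr// mul1r.
exists (C * (1 - r / s)^-1) => n.
rewrite cmodM.
have -> : cmod (n%:R : R[i]) = n%:R by rewrite -(rmorph_nat (real_complex R)) cmodR ger0_norm.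
have -> : n%:R * cmod (A n) * r ^+ n =
    (cmod (A n) * s ^+ n) * (n%:R * (r / s) ^+ n).
  rewrite expr_div_n; field; exact/expf_neq0/lt0r_neq0.
apply: ler_pM; rewrite ?hC ?natr_geom_le//.
  by rewrite mulr_ge0 ?cmod_ge0 ?exprn_ge0 ?ltW.
by rewrite mulr_ge0// exprn_ge0//; case/andP: q01.
Qed.

Lemma tame_shift A : tame A -> tame (fun n => A n.+1).
Proof.
move=> tA r r01; have [C hC] := tA _ r01; case/andP: r01 => r0 r1.
exists (C / r) => n; rewrite ler_pdivlMr// -mulrA -exprSr; exact: hC.
Qed.

Lemma tame_le A B (K : R) : tame A -> (forall n, cmod (B n) <= K * cmod (A n)) -> tame B.
Proof.
move=> tA BA r r01; have [C hC] := tA _ r01; case/andP: r01 => r0 r1.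
exists (`|K| * C) => n; apply: (@le_trans _ _ (`|K| * (cmod (A n) * r ^+ n))).
  rewrite mulrA; apply: ler_wpM2r; first by rewrite exprn_ge0 ?ltW.
  apply: le_trans (BA n) _; apply: ler_wpM2r; first exact: cmod_ge0.
  exact: ler_norm.
by apply: ler_wpM2l => //; exact: hC.
Qed.

Lemma tameD A B : tame A -> tame B -> tame (fun n => A n + B n).
Proof.
move=> tA tB r r01; have [C hC] := tA _ r01; have [D hD] := tB _ r01.
case/andP: r01 => r0 r1; exists (C + D) => n.
apply: le_trans (lerD (hC n) (hD n)); rewrite -mulrDl.
by apply: ler_wpM2r; [rewrite exprn_ge0 ?ltW|exact: cmodD].
Qed.

Lemma tameZ A (c : R[i]) : tame A -> tame (fun n => c * A n).
Proof. by move=> tA; apply: (tame_le (K := cmod c) tA) => n; rewrite cmodM. Qed.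

(** Coefficients of the derived power series. *)
Definition dps A n : R[i] := n.+1%:R * A n.+1.

Lemma tame_dps A : tame A -> tame (dps A).
Proof. by move=> /tame_natM /tame_shift. Qed.

Lemma tame_abs A r : 0 <= r < 1 -> tame A ->
  exists2 K, 0 <= K & forall N, \sum_(n < N) cmod (A n) * r ^+ n <= K.
Proof.
move=> /andP[r0 r1] tA; pose s := (1 + r) / 2.
have [s0 s1 rs] : [/\ 0 < s, s < 1 & r < s] by rewrite /s; split; lra.
clearbody s.
have [|C hC] := tA s; first by rewrite s0.
have C0 : 0 <= C by apply: le_trans (hC 0%N); rewrite mulr_ge0 ?cmod_ge0.
have q01 : 0 <= r / s < 1.
  by rewrite divr_ge0 ?(ltW s0)//= ltr_pdivrMr// mul1r.
exists (C * (1 - r / s)^-1).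
  by rewrite mulr_ge0// invr_ge0; lra.
move=> N; apply: le_trans (ler_wpM2l C0 (geom_le N q01)).
rewrite mulr_sumr; apply: ler_sum => n _.
have -> : cmod (A n) * r ^+ n = (cmod (A n) * s ^+ n) * (r / s) ^+ n.
  by rewrite expr_div_n; field; exact/expf_neq0/lt0r_neq0.
by apply: ler_wpM2r; rewrite ?hC// exprn_ge0//; case/andP: q01.
Qed.

Lemma tame_summ A z : cmod z < 1 -> tame A -> abs_summable (fun n => A n * z ^+ n).
Proof.
move=> z1 tA; have [|K K0 hK] := @tame_abs _ (cmod z) _ tA.
  by rewrite cmod_ge0.
exists K => N; apply: le_trans (hK N); apply: ler_sum => n _.
by rewrite cmodM cmodX.
Qed.

Lemma psum_cvg A z : cmod z < 1 -> tame A ->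
  (fun N => \sum_(n < N) A n * z ^+ n) @ \oo --> psum A z.
Proof. by move=> z1 tA; rewrite /psum -lock; apply: csum_cvg; exact: tame_summ. Qed.

Lemma psum_cvgS A z : cmod z < 1 -> tame A ->
  (fun N => \sum_(n < N.+1) A n * z ^+ n) @ \oo --> psum A z.
Proof. by move=> z1 tA; have := psum_cvg z1 tA; rewrite -(@cvg_shiftS R[i]). Qed.

Lemma psum_uniq A z l : cmod z < 1 -> tame A ->
  (fun N => \sum_(n < N) A n * z ^+ n) @ \oo --> l -> psum A z = l.
Proof. by move=> z1 tA; apply: cvgC_unique; exact: psum_cvg. Qed.

Lemma psumD A B z : cmod z < 1 -> tame A -> tame B ->
  psum (fun n => A n + B n) z = psum A z + psum B z.
Proof.
move=> z1 tA tB; apply: psum_uniq => //; first exact: tameD.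
have := cvgCD (psum_cvg z1 tA) (psum_cvg z1 tB).
move=> H; apply: cvgC_eq H => N /=.
by rewrite -big_split; apply: eq_bigr => n _; rewrite mulrDl.
Qed.

Lemma psumZ A c z : cmod z < 1 -> tame A ->
  psum (fun n => c * A n) z = c * psum A z.
Proof.
move=> z1 tA; apply: psum_uniq => //; first exact: tameZ.
have := cvgCZ (c := c) (psum_cvg z1 tA).
move=> H; apply: cvgC_eq H => N /=.
by rewrite mulr_sumr; apply: eq_bigr => n _; rewrite mulrA.
Qed.

Lemma psum_shift A z : cmod z < 1 -> tame A ->
  psum A z = A 0%N + z * psum (fun n => A n.+1) z.
Proof.
move=> z1 tA; apply: psum_uniq => //; rewrite -(@cvg_shiftS R[i]).
have := cvgCD (cvgC_cst (c := A 0%N)) (cvgCZ (c := z) (psum_cvg z1 (tame_shift tA))).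
move=> H; apply: cvgC_eq H => N /=.
rewrite big_ord_recl expr0 mulr1; congr (_ + _).
by rewrite mulr_sumr; apply: eq_bigr => n _; rewrite exprS mulrCA.
Qed.

Lemma psum_rot A (u : R[i]) z : cmod (u * z) < 1 -> cmod z < 1 -> tame A -> cmod u = 1 ->
  psum A (u * z) = psum (fun n => A n * u ^+ n) z.
Proof.
move=> z1 z1' tA u1; apply/esym/psum_uniq => //.
  apply: (tame_le (K := 1) tA) => n.
  by rewrite cmodM cmodX u1 expr1n mulr1 mul1r.
under eq_fun do under eq_bigr do rewrite -mulrA -exprMn.
exact: psum_cvg.
Qed.

Lemma psum_bound A r : 0 <= r < 1 -> tame A ->
  exists2 K, 0 <= K & forall z, cmod z <= r -> cmod (psum A z) <= K.
Proof.
move=> r01 tA; have [K K0 hK] := tame_abs r01 tA; exists K => // z zr.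
have z1 : cmod z < 1 by case/andP: r01 => _; exact: le_lt_trans.
apply: (cmod_cvg_le (psum_cvg z1 tA)); exists 0%N => N _.
apply: le_trans (cmod_sum _ _ _) _; apply: le_trans (hK N).
apply: ler_sum => n _; rewrite cmodM cmodX.
by apply: ler_wpM2l; [exact: cmod_ge0|apply: lerXn2r; rewrite ?nnegrE ?cmod_ge0//; case/andP: r01].
Qed.

Lemma cmod_nat n : cmod (n%:R : R[i]) = n%:R.
Proof. by rewrite -(rmorph_nat (real_complex R)) cmodR ger0_norm. Qed.

(** The factor r^2 on the left avoids the exponent n - 2. If D_n denotes the Taylor remainder, then
    D_(n+1) = w D_n + n z^(n-1) (w - z)^2, and n^2 + n <= (n + 1)^2 closes the induction. *)
Lemma pow_quad z w r n : 0 <= r -> cmod z <= r -> cmod w <= r ->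
  r ^+ 2 * cmod (w ^+ n - z ^+ n - (w - z) * (n%:R * z ^+ n.-1)) <=
  n%:R ^+ 2 * r ^+ n * cmod (w - z) ^+ 2.
Proof.
move=> r0 zr wr; have cwz := cmod_ge0 (w - z).
elim: n => [|n IH].
  by rewrite !expr0 subrr !mul0r mulr0 subr0 cmod0 mulr0 expr0n /= !mul0r.
set D := _ - _ in IH.
have -> : w ^+ n.+1 - z ^+ n.+1 - (w - z) * (n.+1%:R * z ^+ n.+1.-1) =
  w * D + n%:R * z ^+ n.-1 * (w - z) ^+ 2.
  rewrite /D /=; case: (n) => [|m] /=; first by rewrite !expr0 !expr1; ring.
  by rewrite !exprS -[m.+2%:R]natr1 -[m.+1%:R]natr1; ring.
apply: (@le_trans _ _ (r * (n%:R ^+ 2 * r ^+ n * cmod (w - z) ^+ 2) +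
    n%:R * r ^+ n.+1 * cmod (w - z) ^+ 2)).
  apply: le_trans (ler_wpM2l (sqr_ge0 r) (cmodD _ _)) _.
  rewrite mulrDr; apply: lerD.
    rewrite cmodM mulrCA; apply: ler_pM => //; rewrite ?cmod_ge0//.
    by rewrite mulr_ge0 ?cmod_ge0 ?sqr_ge0.
  rewrite cmodM [cmod ((w - z) ^+ _)]cmodX cmodM [cmod (z ^+ _)]cmodX cmod_nat mulrA; apply: ler_wpM2r; first exact: sqr_ge0.
  case: (n) => [|m] /=; first by rewrite !mul0r mulr0.
  rewrite mulrCA; apply: ler_wpM2l => //.
  rewrite -[m.+2]addn2 addnC exprD; apply: ler_wpM2l; first exact: sqr_ge0.
  by apply: lerXn2r; rewrite ?nnegrE ?cmod_ge0.
have -> : r * (n%:R ^+ 2 * r ^+ n * cmod (w - z) ^+ 2) +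
    n%:R * r ^+ n.+1 * cmod (w - z) ^+ 2 =
   (n%:R ^+ 2 + n%:R) * (r ^+ n.+1 * cmod (w - z) ^+ 2) by rewrite [r ^+ n.+1]exprS; ring.
rewrite -mulrA; apply: ler_wpM2r.
  by rewrite mulr_ge0 ?exprn_ge0.
by rewrite -natr1; have : (0:R) <= n%:R by []; nra.
Qed.

(** The constant is a bound for the sums of n^2 |A n| r^n, divided by r^2. Uniformity in both points
    is what the open mapping and cell estimates rely on. *)
Lemma psum_quad A r : 0 < r < 1 -> tame A ->
  exists2 K, 0 <= K & forall z w, cmod z <= r -> cmod w <= r ->
   cmod (psum A w - psum A z - (w - z) * psum (dps A) z) <= K * cmod (w - z) ^+ 2.
Proof.
move=> /andP[r0 r1] tA.
have [|K K0 hK] := @tame_abs _ r _ (tame_natM (tame_natM tA)).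
  by rewrite ltW.
exists (K / r ^+ 2) => [|z w zr wr]; first by rewrite divr_ge0// sqr_ge0.
have z1 := le_lt_trans zr r1; have w1 := le_lt_trans wr r1.
(* N + 1 terms of the series are paired with N terms of its derivative, so that both stop at degree
   N and the remainders can be taken term by term. *)
have H := cvgCD (cvgCD (psum_cvgS w1 tA) (cvgCZ (c := -1) (psum_cvgS z1 tA)))
   (cvgCZ (c := z - w) (psum_cvg z1 (tame_dps tA))).
rewrite mulrAC ler_pdivlMr ?exprn_gt0// mulrC -[r ^+ 2]ger0_norm ?sqr_ge0//.
rewrite -cmodR -cmodM.
have {}H := cvgCZ (c := (r ^+ 2)%:C%C) H.
have -> : psum A w - psum A z - (w - z) * psum (dps A) z =
  psum A w + -1 * psum A z + (z - w) * psum (dps A) z by ring.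
apply: (cmod_cvg_le H); exists 0%N => N _ /=.
have -> : \sum_(n < N) dps A n * z ^+ n =
    \sum_(n < N.+1) n%:R * A n * z ^+ n.-1.
  by rewrite [RHS]big_ord_recl !mul0r add0r; apply: eq_bigr.
rewrite !mulr_sumr -!big_split mulr_sumr /=.
apply: le_trans (cmod_sum _ _ _) _.
apply: le_trans (ler_wpM2r (sqr_ge0 _) (hK N.+1)).
rewrite mulr_suml; apply: ler_sum => n _.
have -> : (r ^+ 2)%:C%C * (A n * w ^+ n + -1 * (A n * z ^+ n) +
       (z - w) * (n%:R * A n * z ^+ n.-1)) =
   A n * ((r ^+ 2)%:C%C * (w ^+ n - z ^+ n - (w - z) * (n%:R * z ^+ n.-1))) by ring.
rewrite 2!cmodM cmodR ger0_norm ?sqr_ge0// !cmodM !cmod_nat.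
apply: le_trans (ler_wpM2l (cmod_ge0 _) (pow_quad _ (ltW r0) zr wr)) _.
by rewrite le_eqVlt; apply/orP; left; apply/eqP; ring.
Qed.

Lemma psum_lip A r : 0 < r < 1 -> tame A ->
  exists2 K, 0 <= K & forall z w, cmod z <= r -> cmod w <= r ->
   cmod (psum A w - psum A z) <= K * cmod (w - z).
Proof.
move=> r01 tA; have [K K0 hK] := psum_quad r01 tA.
have [|L L0 hL] := @psum_bound (dps A) r _ (tame_dps tA).
  by case/andP: r01 => /ltW -> ->.
exists (K * 2 + L); first by rewrite addr_ge0 ?mulr_ge0.
move=> z w zr wr; have h := hK _ _ zr wr; have hz := hL _ zr.
have r1 : r < 1 by case/andP: r01.
have wz2 : cmod (w - z) <= 2 by have := cmodB w z; lra.
have -> : psum A w - psum A z = (psum A w - psum A z - (w - z) * psum (dps A) z)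
  + (w - z) * psum (dps A) z by ring.
apply: le_trans (cmodD _ _) _; rewrite [leRHS]mulrDl; apply: lerD.
  apply: le_trans h _; rewrite -mulrA; apply: ler_wpM2l => //.
  by rewrite expr2; apply: ler_wpM2r => //; exact: cmod_ge0.
by rewrite cmodM mulrC; apply: ler_wpM2r => //; exact: cmod_ge0.
Qed.

Lemma psum_cderiv A z : cmod z < 1 -> tame A ->
  cderiv (psum A) z (psum (dps A) z).
Proof.
move=> z1 tA e e0; pose r := (1 + cmod z) / 2.
have z0 := cmod_ge0 z.
have [|K K0 hK] := @psum_quad A r _ tA; first by rewrite /r; lra.
exists (Num.min (r - cmod z) (e / (K + 1))).
  by rewrite lt_min; apply/andP; split; [rewrite /r; lra|rewrite divr_gt0// ltr_wpDl].
move=> w; rewrite lt_min => /andP[wz we].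
have wr : cmod w <= r by have := cmodD (w - z) z; rewrite subrK; lra.
apply: le_trans (hK z w _ wr) _; first by rewrite /r; lra.
rewrite expr2 mulrA; apply: ler_wpM2r; first exact: cmod_ge0.
move: we; rewrite ltr_pdivlMr ?ltr_wpDl// => we.
by have := cmod_ge0 (w - z); lra.
Qed.

Lemma cderiv_eq F G z l : (exists2 d : R, 0 < d & forall w, cmod (w - z) < d -> F w = G w) ->
  cderiv F z l -> cderiv G z l.
Proof.
move=> [d d0 FG] Fl e e0; have [d' d'0 h] := Fl e e0.
exists (Num.min d d'); first by rewrite lt_min d0.
move=> w; rewrite lt_min => /andP[wd wd']; rewrite -!FG ?subrr ?cmod0//.
exact: h.
Qed.

Lemma disk_nbhd (P : R[i] -> Prop) z : cmod z < 1 -> (forall w, cmod w < 1 -> P w) ->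
  exists2 d : R, 0 < d & forall w, cmod (w - z) < d -> P w.
Proof.
move=> z1 hP; exists (1 - cmod z); first by rewrite subr_gt0.
by move=> w wz; apply: hP; have := cmodD (w - z) z; rewrite subrK; lra.
Qed.

Lemma psum_deriv F A z : tame A -> (forall w, cmod w < 1 -> F w = psum A w) ->
  cmod z < 1 -> derivable F z 1 /\ derive1 F z = psum (dps A) z.
Proof.
move=> tA FA z1; apply: cderivP; apply: cderiv_eq (psum_cderiv z1 tA).
by apply: disk_nbhd => // w /FA.
Qed.

Lemma psum0 A : tame A -> psum A 0 = A 0%N.
Proof. by move=> tA; rewrite psum_shift ?cmod0// mul0r addr0. Qed.

(** Convergence at the real point r bounds the terms A n r^n, each being a difference of consecutive
    partial sums. This is how the mere convergence assumed in the statement becomes absolute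
    convergence on smaller disks. *)
Lemma tame_cvg A F : (forall z, cmod z < 1 ->
   (fun N => \sum_(n < N) A n * z ^+ n) @ \oo --> F z) ->
  tame A /\ (forall z, cmod z < 1 -> F z = psum A z).
Proof.
move=> AF; have tA : tame A.
  move=> r /andP[r0 r1].
  have r1' : cmod (r%:C%C) < 1 by rewrite cmodR ger0_norm ?ltW.
  have /cvgCP /(_ 1 ltr01) [N hN] := AF _ r1'.
  have [C hC] : exists C, forall n, (n < N)%N -> cmod (A n) * r ^+ n <= C.
    elim: (N) => [|M [C hC]]; first by exists 0.
    exists (Num.max C (cmod (A M) * r ^+ M)) => n.
    by rewrite ltnS leq_eqVlt le_max => /orP[/eqP->|/hC ->//]; rewrite lexx orbT.
  (* From N on, two consecutive partial sums lie within 1 of the limit, hence the 2. *)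
  exists (Num.max C 2) => n; rewrite le_max.
  have [/hC -> //|Nn] := ltnP n N; apply/orP; right.
  have := hN _ Nn; have := hN _ (leq_trans Nn (leqnSn n)).
  rewrite big_ord_recr /=; set S := \sum_(_ < _) _; set l := F _ => h1 h2.
  have := cmodB (S + A n * r%:C%C ^+ n - l) (S - l).
  have -> : S + A n * r%:C%C ^+ n - l - (S - l) = A n * r%:C%C ^+ n by ring.
  by rewrite cmodM cmodX cmodR ger0_norm ?(ltW r0)//; lra.
by split=> // z z1; apply/esym/psum_uniq => //; exact: AF.
Qed.

End PowerSeries.

(** * Roots of unity: orthogonality, Parseval's identity and kernel averages *)

Section Roots.
Variable R : realType.
Implicit Types (z w x : R[i]) (t : R) (N M : nat).

Definition eit t : R[i] := (cos t +i* sin t)%C.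

Lemma eit0 : eit 0 = 1.
Proof. by rewrite /eit cos0 sin0. Qed.

Lemma eitD s t : eit (s + t) = eit s * eit t.
Proof. by apply: complexP; rewrite ?cReM ?cImM /= ?cosD ?sinD //; ring. Qed.

Lemma cmod_eit t : cmod (eit t) = 1.
Proof. by rewrite /= cos2Dsin2 sqrtr1. Qed.

Lemma eitX t n : eit t ^+ n = eit (n%:R * t).
Proof.
elim: n => [|n IH]; first by rewrite mul0r eit0.
by rewrite exprS IH -eitD -natr1; congr eit; ring.
Qed.

Lemma eit_2pi : eit (2 * pi) = 1.
Proof. by rewrite /eit mulr_natl cos2pi sin2pi. Qed.

Lemma eit_neq1 t : 0 < t < 2 * pi -> eit t != 1.
Proof.
move=> /andP[t0 t2]; apply/eqP => t1.
have : eit (t / 2) ^+ 2 = 1 by rewrite eitX -t1; congr eit; field.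
have s0 : 0 < sin (t / 2) by apply: sin_gt0_pi; rewrite divr_gt0//= ltr_pdivrMr// mulrC.
move/eqP; rewrite sqrf_eq1 => /orP[] /eqP /(congr1 (@Im R)) /=.
  by move=> h; rewrite h ltxx in s0.
by move=> h; rewrite h oppr0 ltxx in s0.
Qed.

Definition root1 N : R[i] := eit (2 * pi / N%:R).

Lemma root1X N k : root1 N ^+ k = eit (2 * pi * k%:R / N%:R).
Proof. by rewrite eitX; congr eit; ring. Qed.

Lemma root1XN N : (0 < N)%N -> root1 N ^+ N = 1.
Proof.
by move=> N0; rewrite root1X -eit_2pi; congr eit; field; rewrite pnatr_eq0 -lt0n.
Qed.

Lemma cmod_rt N : cmod (root1 N) = 1.
Proof. exact: cmod_eit. Qed.

Lemma root1_sum N j : (0 < j < N)%N -> \sum_(k < N) (root1 N ^+ k) ^+ j = 0.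
Proof.
move=> /andP[j0 jN]; have N0 : (0 < N)%N by exact: leq_ltn_trans jN.
have NR : 0 < N%:R :> R by rewrite ltr0n.
have x1 : root1 N ^+ j != 1.
  rewrite root1X; apply: eit_neq1; rewrite divr_gt0 ?mulr_gt0 ?pi_gt0 ?ltr0n//=.
  by rewrite ltr_pdivrMr// ltr_pM2l ?mulr_gt0 ?pi_gt0// ltr_nat.
under eq_bigr do rewrite exprAC.
have /eqP := subrX1 (root1 N ^+ j) N.
by rewrite exprAC root1XN// expr1n subrr eq_sym mulf_eq0 subr_eq0 (negPf x1) => /eqP.
Qed.

Lemma conjX z n : (z ^+ n)^*%C = z^*%C ^+ n.
Proof. exact: rmorphXn. Qed.

Lemma conj_sum (I : Type) (s : seq I) (F : I -> R[i]) :
  (\sum_(i <- s) F i)^*%C = \sum_(i <- s) (F i)^*%C.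
Proof. exact: rmorph_sum. Qed.

Lemma unit_conj z : cmod z = 1 -> z * z^*%C = 1.
Proof. by rewrite mulCconj => ->; rewrite expr1n. Qed.

Lemma root1_orth N n m : (n < N)%N -> (m < N)%N ->
  \sum_(k < N) (root1 N ^+ k) ^+ n * ((root1 N ^+ k) ^+ m)^*%C = (N * (n == m))%:R.
Proof.
move=> nN mN.
have U k j : (root1 N ^+ k) ^+ j * ((root1 N ^+ k) ^+ j)^*%C = 1.
  by rewrite unit_conj// !cmodX cmod_rt !expr1n.
have [nm|nm|->] := ltngtP n m.
- transitivity ((\sum_(k < N) (root1 N ^+ k) ^+ (m - n))^*%C); last first.
    by rewrite muln0 root1_sum ?conjc0// subn_gt0 nm (leq_ltn_trans (leq_subr _ _)).
  rewrite conj_sum; apply: eq_bigr => k _.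
  by rewrite -{1}(subnK (ltnW nm)) exprD /= rmorphM mulrCA U mulr1.
- transitivity (\sum_(k < N) (root1 N ^+ k) ^+ (n - m)); last first.
    by rewrite muln0 root1_sum// subn_gt0 nm (leq_ltn_trans (leq_subr _ _)).
  apply: eq_bigr => k _.
  by rewrite -{1}(subnK (ltnW nm)) exprD -mulrA U mulr1.
- by under eq_bigr do rewrite U; rewrite sumr_const card_ord muln1.
Qed.

Lemma root1_bilin N (p q : nat -> R[i]) :
  \sum_(k < N) (\sum_(n < N) p n * (root1 N ^+ k) ^+ n) *
     (\sum_(n < N) q n * (root1 N ^+ k) ^+ n)^*%C =
  N%:R * \sum_(n < N) p n * (q n)^*%C.
Proof.
transitivity (\sum_(n < N) \sum_(m < N) p n * (q m)^*%C *
    \sum_(k < N) (root1 N ^+ k) ^+ n * ((root1 N ^+ k) ^+ m)^*%C).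
  under eq_bigr => k _.
    rewrite conj_sum mulr_suml.
    under eq_bigr do rewrite mulr_sumr.
    over.
  rewrite exchange_big; apply: eq_bigr => n _; rewrite exchange_big.
  apply: eq_bigr => m _; rewrite mulr_sumr; apply: eq_bigr => k _ /=.
  by rewrite rmorphM /=; ring.
rewrite mulr_sumr; apply: eq_bigr => n _.
rewrite (bigD1 n)//= root1_orth// eqxx muln1 big1 ?addr0; first by ring.
by move=> m mn; rewrite root1_orth// val_eqE eq_sym (negPf mn) muln0 mulr0.
Qed.

(* Means over roots of unity replace integrals over circles. *)
Lemma parseval N (p : nat -> R[i]) :
  \sum_(k < N) cmod (\sum_(n < N) p n * (root1 N ^+ k) ^+ n) ^+ 2 =
  N%:R * \sum_(n < N) cmod (p n) ^+ 2.
Proof.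
have realC_sum (F : 'I_N -> R) : (\sum_i F i)%:C%C = \sum_i (F i)%:C%C :> R[i].
  exact: rmorph_sum.
apply: (@complexI R); rewrite rmorphM rmorph_nat !realC_sum.
under eq_bigr do rewrite -mulCconj.
rewrite root1_bilin; congr (_ * _); under eq_bigr do rewrite mulCconj.
exact/esym/(realC_sum (fun n => cmod (p n) ^+ 2)).
Qed.

(** Discrete version of integrating a polynomial against the real kernel 1 + 2 Re t. Doubling the
    number of nodes prevents aliasing: products of two polynomials of degree below M have degree
    below 2M. *)
Lemma kernel_avg M (p t : nat -> R[i]) : t 0%N = 0 -> (0 < M)%N ->
  \sum_(k < M.*2) (\sum_(n < M) p n * (root1 M.*2 ^+ k) ^+ n) *
     (1 + 2 * Re (\sum_(n < M) t n * ((root1 M.*2 ^+ k) ^+ n)^*%C))%:C%C =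
  (M.*2)%:R * (p 0%N + \sum_(n < M) t n * p n).
Proof.
move=> t0 M0; set N := M.*2.
have MN : (M <= N)%N by rewrite /N -addnn leq_addr.
pose cut (u : nat -> R[i]) n := if (n < M)%N then u n else 0.
have cutE (u : nat -> R[i]) (k : 'I_N) : \sum_(n < M) u n * (root1 N ^+ k) ^+ n =
    \sum_(n < N) cut u n * (root1 N ^+ k) ^+ n.
  rewrite (big_ord_widen _ (fun n => u n * (root1 N ^+ k) ^+ n) MN) big_mkcond.
  by apply: eq_bigr => n _; rewrite /cut; case: ifP; rewrite ?mul0r.
have cutS (u v : nat -> R[i]) : \sum_(n < N) cut u n * v n = \sum_(n < M) u n * v n.
  rewrite (big_ord_widen _ (fun n => u n * v n) MN) [RHS]big_mkcond.
  by apply: eq_bigr => n _; rewrite /cut; case: ifP; rewrite ?mul0r.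
pose q (u : nat -> R[i]) n := (u n)^*%C.
pose d n : R[i] := (n == 0)%N%:R.
have E (k : 'I_N) : (1 + 2 * Re (\sum_(n < M) t n * ((root1 N ^+ k) ^+ n)^*%C))%:C%C
  = (\sum_(n < N) d n * (root1 N ^+ k) ^+ n)^*%C +
    (\sum_(n < N) cut (q t) n * (root1 N ^+ k) ^+ n)^*%C +
    \sum_(n < M) q t n * (root1 N ^+ k) ^+ n.
  have -> : \sum_(n < N) d n * (root1 N ^+ k) ^+ n = 1.
    have N0 : (0 < N)%N by apply: leq_trans MN.
    rewrite (bigD1 (Ordinal N0))//= /d mul1r expr0 big1 ?addr0//.
    by case=> [[|n] hn] //= _; rewrite mul0r.
  rewrite -cutE; set X := \sum_(n < M) q t n * _.
  have -> : \sum_(n < M) t n * ((root1 N ^+ k) ^+ n)^*%C = X^*%C.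
    rewrite /X conj_sum.
    by apply: eq_bigr => n _ /=; rewrite rmorphM /= /q conjcK.
  by apply: complexP; rewrite !ReImE /=; ring.
under eq_bigr => k _ do rewrite E !mulrDr.
rewrite !big_split /=.
(* As t 0 = 0, the product of the two analytic factors only has frequencies strictly between 0 and
   N, whose means vanish. *)
have -> : \sum_(k < N) (\sum_(n < M) p n * (root1 N ^+ k) ^+ n) *
    (\sum_(n < M) q t n * (root1 N ^+ k) ^+ n) = 0.
  under eq_bigr => k _.
    rewrite mulr_suml.
    under eq_bigr do rewrite mulr_sumr.
    over.
  rewrite exchange_big big1// => n _; rewrite exchange_big big1// => m _.
  have [->|m0] := posnP m; first by rewrite big1// => k _; rewrite /q t0 conjc0 mul0r mulr0.
  under eq_bigr => k _.
    have -> : p n * (root1 N ^+ k) ^+ n * (q t m * (root1 N ^+ k) ^+ m) =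
      p n * q t m * (root1 N ^+ k) ^+ (n + m) by rewrite exprD; ring.
    over.
  rewrite -mulr_sumr root1_sum ?mulr0// addn_gt0 m0 orbT /= /N -addnn.
  by rewrite -addnS leq_add// ltnW.
rewrite addr0.
under eq_bigr => k _ do rewrite cutE.
under [X in _ + X]eq_bigr => k _ do rewrite cutE.
rewrite !root1_bilin -mulrDr; congr (_ * (_ + _)).
  rewrite (cutS p (fun n => (d n)^*%C)) (bigD1 (Ordinal M0)) //=.
  have -> : (1 -i* 0)%C = 1 :> R[i] by rewrite oppr0.
  rewrite mulr1 big1 ?addr0//.
  case=> [[|n] hn] //= _; have -> : (0 -i* 0)%C = 0 :> R[i] by rewrite oppr0.
  by rewrite mulr0.
rewrite (cutS p (fun n => (cut (q t) n)^*%C)); apply: eq_bigr => n _; rewrite /cut ltn_ord /q conjcK mulrC//.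
Qed.

End Roots.

(** * The inequalities of Caratheodory and Harnack for functions of nonnegative real part *)

Section PositiveRealPart.
Variable R : realType.
Implicit Types (A p t : nat -> R[i]) (z w x : R[i]) (N M : nat) (r rho c e : R).

(** The remainder is dominated, for every such z, by that of the convergent majorant with terms |A
    n| rho^n. *)
Lemma psum_tail A rho e : 0 <= rho < 1 -> tame A -> 0 < e ->
  exists M0, forall M, (M0 <= M)%N -> forall z, cmod z <= rho ->
    cmod (psum A z - \sum_(n < M) A n * z ^+ n) <= e.
Proof.
move=> r01 tA e0; have [K K0 hK] := tame_abs r01 tA.
pose S N := \sum_(n < N) cmod (A n) * rho ^+ n.
have [rho0 rho1] := andP r01.
have Sle n m : (n <= m)%N -> forall z, cmod z <= rho ->
    cmod (\sum_(i < m) A i * z ^+ i - \sum_(i < n) A i * z ^+ i) <= S m - S n.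
  move=> nm z zr; elim: m nm => [|m IH].
    by rewrite leqn0 => /eqP ->; rewrite !subrr cmod0.
  rewrite leq_eqVlt => /orP[/eqP <-|]; first by rewrite !subrr cmod0.
  rewrite ltnS => /IH {}IH; rewrite /S !big_ord_recr /= -/(S _) -/(S _).
  rewrite addrAC [leRHS]addrAC; apply: le_trans (cmodD _ _) _.
  apply: lerD => //; rewrite cmodM cmodX; apply: ler_wpM2l; first exact: cmod_ge0.
  by apply: lerXn2r; rewrite ?nnegrE ?cmod_ge0.
have Sc : cvgn S.
  apply: (@real_summ _ (fun n => cmod (A n) * rho ^+ n) K) => N.
  apply: le_trans (hK N); apply: ler_sum => n _.
  by rewrite ger0_norm// mulr_ge0 ?cmod_ge0 ?exprn_ge0.
have Sle_lim m : S m <= limn S.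
  apply: nondecreasing_cvgn_le => //; apply/nondecreasing_seqP => n.
  by rewrite /S big_ord_recr /= lerDl mulr_ge0 ?cmod_ge0 ?exprn_ge0.
move/cvgrPdist_lt : (Sc) => /(_ _ e0)[M0 _ hM0].
exists M0 => M /hM0 /= hM z zr.
have z1 : cmod z < 1 by exact: le_lt_trans zr _.
have H := cvgCD (psum_cvg z1 tA) (cvgC_cst (c := - \sum_(n < M) A n * z ^+ n)).
apply: (cmod_cvg_le H); exists M => N MN.
apply: le_trans (Sle _ _ MN _ zr) _; have := Sle_lim N.
by move: hM; rewrite ltr_norml => /andP[_]; lra.
Qed.

(** At each node P, the real part of the truncated series, is at least - e, and the kernel T is at
    least c. Averaging (P + e)(T - c) >= 0, where P and T both have mean 1, bounds the mean of P T,
    which [kernel_avg] computes. *)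
Lemma kernel_ge A M t c rho e : tame A -> A 0%N = 1 -> (0 < M)%N ->
  (forall z, cmod z < 1 -> 0 <= Re (psum A z)) -> 0 <= rho < 1 ->
  (forall z, cmod z <= rho -> cmod (psum A z - \sum_(n < M) A n * z ^+ n) <= e) ->
  t 0%N = 0 ->
  (forall x, cmod x = 1 ->
     c <= 1 + 2 * Re (\sum_(n < M) t n * (x ^+ n)^*%C)) ->
  c - e * (1 - c) <= Re (1 + \sum_(n < M) t n * (A n * rho%:C%C ^+ n)).
Proof.
move=> tA A0 M0 PA r01 tail t0 Tc; have [rho0 rho1] := andP r01.
pose p n := A n * rho%:C%C ^+ n.
pose x k := root1 R M.*2 ^+ k.
pose P k := Re (\sum_(n < M) p n * x k ^+ n).
pose T k := 1 + 2 * Re (\sum_(n < M) t n * (x k ^+ n)^*%C).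
have x1 k : cmod (x k) = 1 by rewrite cmodX cmod_rt expr1n.
have N0 : 0 < (M.*2)%:R :> R by rewrite ltr0n double_gt0.
have one (u : nat -> R[i]) : \sum_(n < M) (n == 0 :> nat)%:R * u n = u 0%N.
  rewrite (bigD1 (Ordinal M0))//= mul1r big1 ?addr0//.
  by case=> [[|n] hn] //= _; rewrite mul0r.
have ReMr z (a : R) : Re (z * a%:C%C) = Re z * a.
  by rewrite cReM /= mulr0 subr0.
have ReNat n z : Re (n%:R * z) = n%:R * Re z.
  have -> : n%:R = (n%:R)%:C%C :> R[i] by rewrite (rmorph_nat (real_complex R)).
  by rewrite cReM /= mul0r subr0.
have t00 : \sum_(n < M) 0 * p n = 0 by rewrite big1// => n _; rewrite mul0r.
have KT := congr1 (@Re R) (kernel_avg (M := M) p t0 M0).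
have KP := congr1 (@Re R) (kernel_avg (M := M) (t := fun=> 0) p erefl M0).
have K1 := congr1 (@Re R)
  (kernel_avg (M := M) (fun n => (n == 0)%N%:R) t0 M0).
have KT' : \sum_(k < M.*2) P k * T k =
    (M.*2)%:R * Re (1 + \sum_(n < M) t n * (A n * rho%:C%C ^+ n)).
  transitivity (Re ((M.*2)%:R * (p 0%N + \sum_(n < M) t n * p n))).
    by rewrite -KT cRe_sum; apply: eq_bigr => k _; rewrite ReMr.
  by rewrite ReNat {1}/p A0 expr0 mulr1.
have KP' : \sum_(k < M.*2) P k = (M.*2)%:R.
  transitivity (Re ((M.*2)%:R * (p 0%N + \sum_(n < M) 0 * p n))).
    rewrite -KP cRe_sum; apply: eq_bigr => k _; rewrite ReMr.
    rewrite (big1 _ _ (fun n => 0 * _)) /= ?mulr0 ?addr0 ?mulr1// => n _.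
    by rewrite mul0r.
  by rewrite t00 addr0 ReNat /p A0 expr0 mulr1 /= mulr1.
have K1' : \sum_(k < M.*2) T k = (M.*2)%:R.
  transitivity (Re ((M.*2)%:R * (1 + \sum_(n < M) t n * (n == 0 :> nat)%:R) : R[i])).
    rewrite -K1 cRe_sum; apply: eq_bigr => k _.
    by rewrite (one (fun n => x k ^+ n)) expr0 mul1r.
  under eq_bigr do rewrite mulrC.
  by rewrite one t0 addr0 ReNat /= mulr1.
have : 0 <= \sum_(k < M.*2) (P k + e) * (T k - c).
  apply: sumr_ge0 => k _; apply: mulr_ge0; last by rewrite subr_ge0 Tc.
  have zr : cmod (rho%:C%C * x k) <= rho by rewrite cmodM cmodR x1 mulr1 ger0_norm.
  have z1 : cmod (rho%:C%C * x k) < 1 by exact: le_lt_trans zr _.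
  have := PA _ z1; have := tail _ zr.
  have -> : \sum_(n < M) A n * (rho%:C%C * x k) ^+ n = \sum_(n < M) p n * x k ^+ n.
    by apply: eq_bigr => n _; rewrite /p exprMn mulrA.
  move=> h; have := le_trans (ler_Re_cmod _) h.
  by rewrite !ReImE -/(P k) ler_norml => /andP[] *; lra.
have -> : \sum_(k < M.*2) (P k + e) * (T k - c) =
   \sum_(k < M.*2) P k * T k - c * \sum_(k < M.*2) P k + e * \sum_(k < M.*2) T k
     - (M.*2)%:R * (e * c).
  rewrite !mulr_sumr -sumrB -big_split /= mulr_natl -[X in _ *+ X]card_ord -sumr_const -sumrB.
  by apply: eq_bigr => k _; ring.
rewrite KT' KP' K1' => h.
by rewrite -subr_ge0 -(pmulr_rge0 _ N0); lra.
Qed.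

(** The passage rho -> 1, made explicit with Bernoulli's inequality. *)
Lemma le_of_powers (a d : R) n : (forall rho, 0 < rho < 1 -> a * rho ^+ n <= d) -> a <= d.
Proof.
move=> h; apply/ler_addgt0Pr => e e0.
have Bern (x : R) : 0 <= x <= 1 -> 1 - n%:R * (1 - x) <= x ^+ n.
  move=> /andP[x0 x1]; elim: n {h} => [|n IH]; first by rewrite mul0r subr0.
  rewrite exprS -natr1; have := ler_wpM2l x0 IH.
  have : 0 <= n%:R * (1 - x) ^+ 2 by apply: mulr_ge0; [exact: ler0n|exact: sqr_ge0].
  lra.
have [a0|a0] := leP a 0.
  have h12 : 0 < 1 / 2 :> R by rewrite divr_gt0.
  have h2 : a * (1 / 2) ^+ n <= d by apply: h; lra.
  have : (1 / 2 : R) ^+ n <= 1 by rewrite exprn_ile1//; lra.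
  have : 0 <= (1 / 2 : R) ^+ n by rewrite exprn_ge0//; lra.
  nra.
pose m := (n.+1%:R : R); have m0 : 0 < m by rewrite ltr0n.
have nm : n%:R <= m by rewrite ler_nat.
pose dl := Num.min (1 / 2) (e / (a * m)).
have am : 0 < a * m by rewrite mulr_gt0.
have d0 : 0 < dl by rewrite lt_min divr_gt0//= divr_gt0.
have d2 : dl <= 1 / 2 by rewrite ge_min lexx.
have d3 : dl * (a * m) <= e by rewrite -ler_pdivlMr// ge_min lexx orbT.
have h1 := h (1 - dl) ltac:(lra); have := Bern (1 - dl) ltac:(lra).
have -> : 1 - (1 - dl) = dl by ring.
move=> B.
have : a * (1 - n%:R * dl) <= a * (1 - dl) ^+ n by rewrite ler_pM2l.
have : a * n%:R * dl <= dl * (a * m) by rewrite mulrC ler_pM2l// ler_pM2l.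
lra.
Qed.

(* Caratheodory's and Harnack's inequalities both come from averaging [Re F >= 0]
   against a nonnegative trigonometric kernel. *)
Lemma caratheodory A n : tame A -> A 0%N = 1 -> (0 < n)%N ->
  (forall z, cmod z < 1 -> 0 <= Re (psum A z)) -> cmod (A n) <= 2.
Proof.
move=> tA A0 n0 PA; apply: (@le_of_powers _ _ n) => rho /andP[r0 r1].
apply/ler_addgt0Pr => e e0; have e2 : 0 < e / 2 by rewrite divr_gt0.
have r01 : 0 <= rho < 1 by rewrite ltW.
have [M0 tail] := psum_tail r01 tA e2.
pose M := (maxn M0 n).+1.
have M0M : (M0 <= M)%N by rewrite leqW// leq_maxl.
have nM : (n < M)%N by rewrite ltnS leq_maxr.
have [An0|An0] := eqVneq (A n) 0; first by rewrite An0 cmod0 mul0r addr_ge0// ltW.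
have cA : 0 < cmod (A n) by rewrite lt_neqAle cmod_ge0 eq_sym cmod_eq0 An0.
(* l rotates A n onto the negative real axis, and the kernel is 1 + Re (l conj(x)^n) >= 0. The
   factor 1/2 in t compensates the 2 in [kernel_ge]. *)
pose l := - (A n)^*%C / (cmod (A n))%:C%C.
have cl : cmod l = 1.
  by rewrite cmodM cmodN cmod_conj cmodV cmodR gtr0_norm// divff// gt_eqF.
have lA : l * A n = - (cmod (A n))%:C%C.
  rewrite /l mulrAC mulNr mulrC mulrN (mulrC _ (A n)) mulCconj.
  by rewrite expr2 rmorphM mulrA mulVf ?mul1r// (fmorph_eq0 (real_complex R)) gt_eqF.
pose t m : R[i] := if m == n then (1 / 2)%:C%C * l else 0.
have sumt (u : nat -> R[i]) : \sum_(m < M) t m * u m = (1 / 2)%:C%C * l * u n.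
  rewrite (bigD1 (Ordinal nM))//= /t eqxx big1 ?addr0// => i ni.
  by rewrite ifF ?mul0r//; apply: contraNF ni => /eqP ni; apply/eqP/val_inj.
have := @kernel_ge A M t 0 rho (e / 2) tA A0 isT PA r01 (tail _ M0M).
rewrite (sumt (fun m => A m * rho%:C%C ^+ m)) {1}/t.
rewrite ifF; last by case: (n) n0.
have -> : (1 / 2)%:C%C * l * (A n * rho%:C%C ^+ n) =
    (- (cmod (A n) * rho ^+ n / 2))%:C%C.
  transitivity ((1 / 2)%:C%C * (l * A n) * rho%:C%C ^+ n); first by ring.
  by rewrite lA -rmorphN -rmorphXn -!rmorphM; congr (_%:C)%C; field.
move=> /(_ erefl) h.
suff /h : forall x, cmod x = 1 ->
    0 <= 1 + 2 * Re (\sum_(n < M) t n * (x ^+ n)^*%C).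
  by rewrite cReD /=; lra.
move=> x x1; rewrite (sumt (fun m => (x ^+ m)^*%C)).
have := ler_Re_cmod (l * (x ^+ n)^*%C).
rewrite cmodM cl cmod_conj cmodX x1 expr1n mulr1 ler_norml => /andP[h1 h2].
rewrite -mulrA.
by rewrite cReM /= mul0r subr0; lra.
Qed.

(** The complete Poisson kernel is (1 - r^2) / |1 - y|^2 with y = r conj(x), which is at least (1 -
    r) / (1 + r). Truncating it at degree M costs at most 2 r^M / (1 - r). *)
Lemma poisson_ge r M x : 0 < r < 1 -> (0 < M)%N -> cmod x = 1 ->
  (1 - r) / (1 + r) - 2 * r ^+ M / (1 - r) <=
  1 + 2 * Re (\sum_(n < M) (if n == 0 :> nat then 0 else r%:C%C ^+ n) *
     (x ^+ n)^*%C).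
Proof.
move=> /andP[r0 r1] M0 x1; pose y : R[i] := r%:C%C * x^*%C.
have cy : cmod y = r by rewrite cmodM cmodR cmod_conj x1 mulr1 ger0_norm// ltW.
pose S : R[i] := \sum_(n < M) y ^+ n; pose D := 1 - y.
have -> : \sum_(n < M) (if n == 0 :> nat then 0 else r%:C%C ^+ n) * (x ^+ n)^*%C
    = S - 1.
  rewrite /S; case: (M) M0 => // m _; rewrite !big_ord_recl /= mul0r add0r expr0.
  by rewrite addrC addKr; apply: eq_bigr => i _; rewrite /y exprMn conjX.
have DS : D * S = 1 - y ^+ M.
  by rewrite -[RHS]opprB subrX1 /D /S; ring.
have D2 : 1 - r <= cmod D.
  by have := cmodD D y; rewrite subrK cmod1 cy; lra.
have D3 : cmod D <= 1 + r by have := cmodB 1 y; rewrite cmod1 cy; lra.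
have cD0 : 0 < cmod D by lra.
have DD : cmod D ^+ 2 = 1 - 2 * Re y + r ^+ 2.
  by rewrite -cy !cmod_sqr /D !ReImE /=; ring.
have SD : cmod D ^+ 2 * Re S = Re (D^*%C * (1 - y ^+ M)).
  rewrite -DS mulrA (mulrC _ D) mulCconj.
  by rewrite [in RHS]cReM /= mul0r subr0.
have P1 : cmod D ^+ 2 * Re S >= 1 - Re y - cmod D * r ^+ M.
  rewrite SD mulrBr mulr1 !cReD cReN cReJ.
  have : Re (D^*%C * y ^+ M) <= cmod D * r ^+ M.
    by apply: le_trans (ler_norm _) _; apply: le_trans (ler_Re_cmod _) _;
       rewrite cmodM cmod_conj cmodX cy.
  by rewrite /D cReD cReN /=; lra.
rewrite cReD cReN /=; set s := Re S in P1 *.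
set d := cmod D in D2 D3 cD0 DD P1.
have q0 : 0 <= r ^+ M by rewrite exprn_ge0// ltW.
set q := r ^+ M in P1 q0 *.
have P2 : 1 - r ^+ 2 - 2 * d * q <= d ^+ 2 * (2 * s - 1) by lra.
have d20 : 0 < d ^+ 2 by rewrite exprn_gt0.
have P3 : (1 - r ^+ 2) / d ^+ 2 - 2 * q / d <= 2 * s - 1.
  have -> : (1 - r ^+ 2) / d ^+ 2 - 2 * q / d = (1 - r ^+ 2 - 2 * d * q) / d ^+ 2.
    by field; rewrite gt_eqF.
  by rewrite ler_pdivrMr// [leRHS]mulrC.
have P4 : (1 - r) / (1 + r) <= (1 - r ^+ 2) / d ^+ 2.
  have -> : (1 - r) / (1 + r) = (1 - r ^+ 2) / (1 + r) ^+ 2.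
    by field; rewrite gt_eqF//; lra.
  apply: ler_wpM2l; first by rewrite subr_ge0 exprn_ile1// ltW.
  rewrite lef_pV2 ?posrE// ?exprn_gt0//; last by lra.
  by apply: lerXn2r; rewrite ?nnegrE//; lra.
have P5 : 2 * q / d <= 2 * q / (1 - r).
  apply: ler_wpM2l; first by rewrite mulr_ge0.
  by rewrite lef_pV2 ?posrE//; lra.
lra.
Qed.

Lemma harnack_real A r : tame A -> A 0%N = 1 ->
  (forall z, cmod z < 1 -> 0 <= Re (psum A z)) -> 0 < r < 1 ->
  (1 - r) / (1 + r) <= Re (psum A r%:C%C).
Proof.
move=> tA A0 PA /andP[r0 r1]; set X := Re _.
suff H rho : r < rho < 1 -> (rho - r) <= X * (rho + r).
  rewrite ler_pdivrMr; last by lra.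
  apply/ler_addgt0Pr => e e0.
  have X0 : 0 < `|1 - X| + 1 by rewrite ltr_wpDl.
  pose h := Num.min ((1 - r) / 2) (e / (`|1 - X| + 1)).
  have h0 : 0 < h by rewrite lt_min !divr_gt0// subr_gt0.
  have h2 : h <= (1 - r) / 2 by rewrite ge_min lexx.
  have h3 : h * (`|1 - X| + 1) <= e by rewrite -ler_pdivlMr// ge_min lexx orbT.
  have := H (1 - h) ltac:(lra).
  have : h * (1 - X) <= h * `|1 - X| by rewrite ler_pM2l// ler_norm.
  by rewrite mulrDr mulr1 in h3; lra.
move=> /andP[rrho rho1]; have rho0 : 0 < rho by lra.
(* The value at r is reached from the circle of radius rho < 1, where partial sums converge
   uniformly, by the Poisson kernel of ratio q. *)
pose q := r / rho.
have q01 : 0 < q < 1 by rewrite divr_gt0//= ltr_pdivrMr// mul1r.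
have [q0 q1] := andP q01.
have qE : (rho - r) / (rho + r) = (1 - q) / (1 + q).
  by rewrite /q; field; rewrite !gt_eqF//; lra.
rewrite -ler_pdivrMr; last by lra.
rewrite qE; set c := _ / _.
have c01 : 0 <= c <= 1.
  rewrite divr_ge0 ?ler_pdivrMr/=; lra.
(* The truncated kernel costs e, [kernel_ge] at most e (1 + e), and the tail at r another e: at most
   4 e in all, as e <= 1. *)
apply/ler_addgt0Pr => e' e'0; pose e := Num.min 1 (e' / 4).
have e0 : 0 < e by rewrite lt_min ltr01 divr_gt0.
have e1 : e <= 1 by rewrite ge_min lexx.
have e4 : 4 * e <= e' by rewrite mulrC -ler_pdivlMr// ge_min lexx orbT.
have rho01 : 0 <= rho < 1 by rewrite ltW.
have [M0 tail] := psum_tail rho01 tA e0.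
(* By [natr_geom_le], M q^M <= 1 / (1 - q), so this size of M makes the truncation error 2 q^M / (1
   - q) at most e. *)
have [M1 hM1] : exists M1, 2 / (1 - q) ^+ 2 / e <= M1%:R.
  by exists (Num.trunc (2 / (1 - q) ^+ 2 / e)).+1; apply/ltW/truncnS_gt.
pose M := (maxn M0 M1).+1.
have M0M : (M0 <= M)%N by rewrite leqW// leq_maxl.
have MR : M1%:R <= M%:R :> R by rewrite ler_nat leqW// leq_maxr.
have Me : 2 * q ^+ M / (1 - q) <= e.
  have Mp : 0 < M%:R :> R by rewrite ltr0n.
  have := @natr_geom_le _ q M; rewrite (ltW q0) q1 => /(_ isT) h.
  rewrite -(ler_pM2l Mp).
  apply: (@le_trans _ _ (2 / (1 - q) ^+ 2)).
    have -> : M%:R * (2 * q ^+ M / (1 - q)) = 2 / (1 - q) * (M%:R * q ^+ M).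
      by field; rewrite gt_eqF//; lra.
    have -> : 2 / (1 - q) ^+ 2 = 2 / (1 - q) * (1 - q)^-1.
      by field; rewrite gt_eqF//; lra.
    by apply: ler_wpM2l => //; rewrite divr_ge0//; lra.
  by rewrite -ler_pdivrMr//; apply: le_trans hM1 MR.
pose t n : R[i] := if n == 0 :> nat then 0 else q%:C%C ^+ n.
have := @kernel_ge A M t (c - e) rho e tA A0 isT PA rho01 (tail _ M0M) erefl.
have -> : 1 + \sum_(n < M) t n * (A n * rho%:C%C ^+ n) =
   \sum_(n < M) A n * r%:C%C ^+ n.
  rewrite /M !big_ord_recl /= mul0r add0r A0 mul1r expr0; congr (_ + _).
  apply: eq_bigr => i _; rewrite /t /= mulrCA -exprMn -rmorphM.
  by rewrite /q mulfVK// gt_eqF.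
move=> K.
have zr : cmod (r%:C%C) <= rho by rewrite cmodR ger0_norm ltW.
have := le_trans (ler_Re_cmod _) (tail _ M0M _ zr); rewrite !ReImE -/X.
rewrite ler_norml => /andP[T1 T2].
suff : c - e - e * (1 - (c - e)) <= Re (\sum_(n < M) A n * r%:C%C ^+ n).
  by case/andP: c01 => c0 c1; nra.
apply: K => x x1; apply: le_trans (poisson_ge (M := M) q01 isT x1).
by rewrite -/c; lra.
Qed.

Lemma harnack A z : tame A -> A 0%N = 1 ->
  (forall z, cmod z < 1 -> 0 <= Re (psum A z)) -> cmod z < 1 ->
  (1 - cmod z) / (1 + cmod z) <= Re (psum A z).
Proof.
move=> tA A0 PA z1; have [->|z0] := eqVneq z 0.
  by rewrite cmod0 psum0// A0 /= subr0 addr0 divr1.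
have cz : 0 < cmod z by rewrite lt_neqAle cmod_ge0 eq_sym cmod_eq0 z0.
pose u : R[i] := z / (cmod z)%:C%C.
have cu : cmod u = 1 by rewrite cmodM cmodV cmodR gtr0_norm// divff// gt_eqF.
have zE : z = u * (cmod z)%:C%C.
  by rewrite /u mulfVK// (fmorph_eq0 (real_complex R)) gt_eqF.
have tAu : tame (fun n => A n * u ^+ n).
  by apply: (tame_le (K := 1) tA) => n; rewrite cmodM cmodX cu expr1n mulr1 mul1r.
have rot w : cmod w < 1 -> psum A (u * w) = psum (fun n => A n * u ^+ n) w.
  by move=> w1; rewrite psum_rot// cmodM cu mul1r.
rewrite [in leRHS]zE rot; last by rewrite cmodR gtr0_norm.
apply: harnack_real => //; first by rewrite A0 mul1r expr0.
  by move=> w w1; rewrite -rot//; apply: PA; rewrite cmodM cu mul1r.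
by rewrite cz.
Qed.

End PositiveRealPart.

(** * Real derivatives, monotonicity and a differential inequality *)

Section RealDerivative.
Variable R : realType.
Implicit Types (f g : R -> R) (x y l : R).

Definition rderiv f x l := forall e : R, 0 < e -> exists2 d : R, 0 < d &
  forall y, `|y - x| < d -> `|f y - f x - (y - x) * l| <= e * `|y - x|.

Lemma rderivD f g x l m : rderiv f x l -> rderiv g x m ->
  rderiv (fun t => f t + g t) x (l + m).
Proof.
move=> fl gm e e0; have e2 : 0 < e / 2 by rewrite divr_gt0.
have [d d0 hd] := fl _ e2; have [d' d'0 hd'] := gm _ e2.
exists (Num.min d d'); first by rewrite lt_min d0.
move=> y; rewrite lt_min => /andP[/hd h1 /hd' h2].
have -> : f y + g y - (f x + g x) - (y - x) * (l + m) =
  (f y - f x - (y - x) * l) + (g y - g x - (y - x) * m) by ring.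
by apply: le_trans (ler_normD _ _) _; lra.
Qed.

Lemma rderivN f x l : rderiv f x l -> rderiv (fun t => - f t) x (- l).
Proof.
move=> fl e e0; have [d d0 hd] := fl _ e0; exists d => // y /hd.
by rewrite -normrN; congr (`|_| <= _); ring.
Qed.

Lemma rderiv_cst c x : rderiv (fun=> c) x 0.
Proof.
move=> e e0; exists 1 => // y _; rewrite subrr mulr0 subr0 normr0.
by rewrite mulr_ge0// ltW.
Qed.

Lemma rderiv_is_derive f x l : rderiv f x l -> is_derive x 1 f l.
Proof.
move=> fl.
have H : (fun h : R => h^-1 *: ((f \o shift x) (h *: 1) - f x)) @ 0^' --> l.
  apply/cvgrPdist_le => e e0.
  have [d d0 h] := fl _ e0.
  exists d => //= y; rewrite /= sub0r normrN => yd y0.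
  rewrite /GRing.scale/= mulr1 distrC.
  have := h (y + x); rewrite addrK => /(_ yd) {}h.
  have -> : y^-1 * (f (y + x) - f x) - l = y^-1 * (f (y + x) - f x - y * l).
    by rewrite [RHS]mulrBr mulKf.
  by rewrite normrM normfV ler_pdivrMl ?normr_gt0// [leRHS]mulrC.
by apply: DeriveDef; [apply/cvg_ex; exists l|exact: cvg_lim H].
Qed.

Lemma rderiv_continuous f x l : rderiv f x l -> {for x, continuous f}.
Proof.
move=> /rderiv_is_derive[fl _].
exact/differentiable_continuous/derivable1_diffP.
Qed.

Lemma rderiv_within f df a b : (forall x, a <= x <= b -> rderiv f x (df x)) ->
  {within `[a, b], continuous f}.
Proof.
move=> fd; apply: continuous_in_subspaceT => x; rewrite inE/= in_itv/= => xab.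
exact: rderiv_continuous (fd _ xab).
Qed.

Lemma rderiv_mvt f df a b : a < b -> (forall x, a <= x <= b -> rderiv f x (df x)) ->
  exists2 c, a < c < b & f b - f a = df c * (b - a).
Proof.
move=> ab fd; have [||c cab ->] := @MVT R f df a b ab.
- by move=> x; rewrite in_itv/= => /andP[? ?]; apply: rderiv_is_derive; apply: fd; rewrite !ltW.
- exact: rderiv_within fd.
- by exists c => //; move: cab; rewrite in_itv.
Qed.

Lemma rderiv_le f df a b : a <= b -> (forall x, a <= x <= b -> rderiv f x (df x)) ->
  (forall x, a < x < b -> 0 <= df x) -> f a <= f b.
Proof.
rewrite le_eqVlt => /orP[/eqP-> //|ab] fd df0.
have [c /df0 c0 h] := rderiv_mvt ab fd.
by rewrite -subr_ge0 h mulr_ge0// subr_ge0 ltW.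
Qed.

Lemma rderiv_lt f df a b : a < b -> (forall x, a <= x <= b -> rderiv f x (df x)) ->
  (forall x, a < x < b -> 0 < df x) -> f a < f b.
Proof.
move=> ab fd df0; have [c /df0 c0 h] := rderiv_mvt ab fd.
by rewrite -subr_gt0 h mulr_gt0// subr_gt0.
Qed.

(* At an interior or right-end minimum of [f] the derivative is nonpositive, so
   the hypothesis forces the minimum to be nonnegative. *)
Lemma euler_ode_ge0 f df (alpha S : R) : 0 <= alpha -> 0 <= S ->
  (forall x, 0 <= x <= S -> rderiv f x (df x)) -> 0 <= f 0 ->
  (forall x, 0 < x <= S -> 0 <= f x + alpha * x * df x) -> 0 <= f S.
Proof.
move=> al0 S0 fd f0 H.
have [s sS smin] := EVT_min S0 (rderiv_within fd).
move: sS; rewrite in_itv/= => /andP[s0 sS].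
apply: (@le_trans _ _ (f s)); last by apply: smin; rewrite in_itv/= S0 lexx.
move: s0; rewrite le_eqVlt => /orP[/eqP <-//|s0].
have hs := H s; rewrite s0 sS in hs; have {}hs := hs isT.
suff d0 : df s <= 0.
  have : alpha * s * df s <= 0 by rewrite mulr_ge0_le0// mulr_ge0// ltW.
  lra.
rewrite leNgt; apply/negP => d0.
have [d dp hd] := fd s ltac:(lra) (df s / 2) ltac:(lra).
pose h := Num.min (d / 2) s.
have h0 : 0 < h by rewrite lt_min divr_gt0.
have hdd : h <= d / 2 by rewrite ge_min lexx.
have hss : h <= s by rewrite ge_min lexx orbT.
have := smin (s - h); rewrite in_itv/= => /(_ ltac:(lra)) m.
have := hd (s - h); have -> : s - h - s = - h by ring.
rewrite normrN gtr0_norm// => /(_ ltac:(lra)).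
rewrite ler_norml => /andP[_]; nra.
Qed.

(** The factor k serves both summands of Re (conj(v) (h + conj(g))), which equals Re (conj(v) h) +
    Re (v g). *)
Lemma rderiv_line (F : R[i] -> R[i]) (z0 v k G : R[i]) t :
  cderiv F (z0 + t%:C%C * v) G ->
  rderiv (fun s => Re (k * F (z0 + s%:C%C * v))) t (Re (k * (v * G))).
Proof.
move=> FG e e0.
pose K := cmod k * cmod v + 1.
have kv0 : 0 <= cmod k * cmod v by rewrite mulr_ge0 ?cmod_ge0.
have K0 : 0 < K by rewrite ltr_wpDl.
have V0 : 0 < cmod v + 1 by rewrite ltr_wpDl ?cmod_ge0.
have eK : 0 < e / K by rewrite divr_gt0.
have [d d0 h] := FG _ eK.
exists (d / (cmod v + 1)); first by rewrite divr_gt0.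
move=> s; rewrite ltr_pdivlMr// => sd.
have E : z0 + s%:C%C * v - (z0 + t%:C%C * v) = (s - t)%:C%C * v by rewrite rmorphB; ring.
have := h (z0 + s%:C%C * v); rewrite E cmodM cmodR => /(_ _)/=.
have sv : `|s - t| * cmod v < d.
  by apply: le_lt_trans sd; apply: ler_wpM2l => //; lra.
move=> /(_ sv) {}h.
have -> : Re (k * F (z0 + s%:C%C * v)) - Re (k * F (z0 + t%:C%C * v))
   - (s - t) * Re (k * (v * G)) =
   Re (k * (F (z0 + s%:C%C * v) - F (z0 + t%:C%C * v) - (s - t)%:C%C * v * G)).
  by rewrite !ReImE /=; ring.
apply: le_trans (ler_Re_cmod _) _; rewrite cmodM.
apply: le_trans (ler_wpM2l (cmod_ge0 k) h) _.
have -> : cmod k * (e / K * (`|s - t| * cmod v)) =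
   e * `|s - t| * ((cmod k * cmod v) / K) by ring.
rewrite -[leRHS]mulr1; apply: ler_wpM2l; first by rewrite mulr_ge0// ltW.
by rewrite ler_pdivrMr// mul1r /K; lra.
Qed.

End RealDerivative.

(** * Lower bounds for Re h' for a single analytic function, and the extremal function *)

Section Growth.
Variable R : realType.
Variable alpha : R.
Hypothesis alpha_ge0 : 0 <= alpha.
Implicit Types (A B : nat -> R[i]) (z w u l : R[i]).

(* Coefficients of [h' + alpha z h''] when [A] are those of [h]. *)
Definition pps A n : R[i] := (1 + n%:R * alpha)%:C%C * dps A n.

Lemma natC n : n%:R = (n%:R : R)%:C%C :> R[i].
Proof. by rewrite (rmorph_nat (real_complex R)). Qed.

Lemma cReC (x : R) : Re (x%:C%C) = x.
Proof. by []. Qed.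

Lemma tame_natdps A : tame A -> tame (fun n => n%:R * dps A n).
Proof. by move=> tA; apply/tame_natM/tame_dps. Qed.

Lemma ppsE A : pps A = fun n => dps A n + alpha%:C%C * (n%:R * dps A n).
Proof.
apply/funext => n; rewrite /pps rmorphD rmorph1 rmorphM /= -natC.
by rewrite mulrDl mul1r mulrA (mulrC n%:R).
Qed.

Lemma tame_pps A : tame A -> tame (pps A).
Proof.
move=> tA; rewrite ppsE; apply: tameD; first exact: tame_dps.
exact/tameZ/tame_natdps.
Qed.

Lemma psum_pps A z : cmod z < 1 -> tame A ->
  psum (pps A) z = psum (dps A) z + alpha%:C%C * z * psum (dps (dps A)) z.
Proof.
move=> z1 tA; have tdA := tame_dps tA; have tn := tame_natdps tA.
rewrite ppsE psumD//; last exact: tameZ.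
by rewrite psumZ// (psum_shift z1 tn) mul0r add0r mulrA.
Qed.

Lemma tame_bounded A (K : R) : (forall n, cmod (A n) <= K) -> tame A.
Proof.
move=> AK r /andP[r0 r1]; exists K => n.
rewrite -[leRHS]mulr1; apply: ler_pM => //; [exact: cmod_ge0|exact/exprn_ge0/ltW|].
by apply: exprn_ile1; exact: ltW.
Qed.

(* Coefficients of the extremal function: [h' + alpha z h''] is then the
   half-plane map [(1 + z) / (1 - z)]. *)
Definition ext n : R[i] :=
  if n is m.+1 then (if m is 0%N then 1 else (2 / (n%:R * (1 + m%:R * alpha)))%:C%C)
  else 0.

Definition cden n : R := n%:R * alpha + 1 - alpha.

Lemma cdenS n : cden n.+1 = 1 + n%:R * alpha.
Proof. by rewrite /cden -natr1; ring. Qed.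

Lemma cdenS_ge1 n : 1 <= 1 + n%:R * alpha.
Proof. by rewrite lerDl mulr_ge0. Qed.

Lemma extSS n : ext n.+2 = (2 / (n.+2%:R * (1 + n.+1%:R * alpha)))%:C%C.
Proof. by []. Qed.

Lemma tame_ext : tame ext.
Proof.
apply: (@tame_bounded _ 2) => -[|[|n]].
- by rewrite cmod0.
- by rewrite cmod1 ler1n.
have c1 := cdenS_ge1 n.+1; have n1 : (1:R) <= n.+2%:R by rewrite ler1n.
have c2 : 1 <= n.+2%:R * (1 + n.+1%:R * alpha) by rewrite -[leLHS]mulr1 ler_pM.
have c0 : 0 < n.+2%:R * (1 + n.+1%:R * alpha) by apply: lt_le_trans c2.
by rewrite extSS cmodR ger0_norm ?divr_ge0 ?(ltW c0)// ler_pdivrMr//; lra.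
Qed.

Lemma pps_ext n : pps ext n = if n is 0%N then 1 else 2.
Proof.
rewrite /pps /dps /ext; case: n => [|n].
  by rewrite mul0r addr0 rmorph1 !mul1r.
rewrite natC -!rmorphM (natC 2); congr (_%:C)%C.
have a0 : n.+2%:R != 0 :> R by rewrite pnatr_eq0.
have b0 : 1 + n.+1%:R * alpha != 0 by rewrite gt_eqF//; have := cdenS_ge1 n.+1; lra.
move: a0 b0; move: (1 + _) => b; move: n.+2%:R => a a0 b0.
by field; rewrite a0 b0.
Qed.

(** The geometric series s is summed by its shift relation s = 1 + z s; the product form avoids
    dividing by 1 - z. *)
Lemma psum_pps_ext z : cmod z < 1 -> (1 - z) * psum (pps ext) z = 1 + z.
Proof.
move=> z1; have t1 : tame (fun=> 1 : R[i]).
  by apply: (@tame_bounded _ 1) => n; rewrite cmod1.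
have t2 : tame (fun=> 2 : R[i]) by apply: (@tame_bounded _ 2) => n; rewrite cmod_nat.
rewrite (psum_shift z1 (tame_pps tame_ext)) pps_ext.
have -> : (fun n => pps ext n.+1) = fun n => 2 * 1 :> R[i].
  by apply/funext => n; rewrite pps_ext mulr1.
have := psum_shift z1 t1; rewrite psumZ//.
set s := psum _ z => hs.
have h : (1 - z) * s = 1 by rewrite mulrBl mul1r {1}hs addrK.
transitivity (1 - z + 2 * z * ((1 - z) * s)); first by ring.
by rewrite h; ring.
Qed.

Lemma psum_pps_ext_real (t : R) : 0 <= t < 1 ->
  psum (pps ext) (- t%:C%C) = ((1 - t) / (1 + t))%:C%C.
Proof.
move=> /andP[t0 t1].
have z1 : cmod (- t%:C%C) < 1 by rewrite cmodN cmodR ger0_norm.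
have := psum_pps_ext z1; rewrite opprK -[1]/(1%:C%C) -rmorphN -!rmorphD => h.
have n0 : (1 + t)%:C%C != 0 :> R[i] by rewrite (fmorph_eq0 (real_complex R)) gt_eqF//; lra.
by apply: (mulfI n0); rewrite h -rmorphM; congr (_%:C)%C; field; rewrite gt_eqF//; lra.
Qed.

Lemma Re_psum_pps_ext z : cmod z < 1 -> 0 < Re (psum (pps ext) z).
Proof.
move=> z1; have := psum_pps_ext z1; set P := psum _ z => h.
have z0 : 0 < cmod (1 - z).
  by have := cmodD (1 - z) z; rewrite subrK cmod1; lra.
have : 0 < cmod (1 - z) ^+ 2 * Re P.
  have -> : cmod (1 - z) ^+ 2 * Re P = Re ((1 - z)^*%C * ((1 - z) * P)).
    by rewrite mulrA (mulrC _ (1 - z)) mulCconj [RHS]cReM /= mul0r subr0.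
  rewrite h.
  have -> : Re ((1 - z)^*%C * (1 + z)) = 1 - cmod z ^+ 2.
    by rewrite cmod_sqr !ReImE /=; ring.
  by rewrite subr_gt0 exprn_ilt1 ?cmod_ge0.
by rewrite pmulr_rgt0// exprn_gt0.
Qed.

(** The analytic class to which a harmonic pair reduces: it contains h + l g for every unimodular l
    ([posreal_comb]). *)
Definition posreal A := [/\ tame A, A 1%N = 1 &
  forall z, cmod z < 1 -> 0 <= Re (psum (pps A) z)].

Lemma pps0 A : A 1%N = 1 -> pps A 0%N = 1.
Proof. by move=> A1; rewrite /pps /dps mul0r addr0 rmorph1 !mul1r. Qed.

Lemma posreal_ext : posreal ext.
Proof. by split=> // [|z z1]; [exact: tame_ext|exact/ltW/Re_psum_pps_ext]. Qed.

Lemma line_lt1 (t s : R) u : cmod u = 1 -> 0 <= t <= s -> s < 1 -> cmod (0 + t%:C%C * u) < 1.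
Proof.
move=> u1 /andP[t0 ts] s1; rewrite add0r cmodM u1 mulr1 cmodR ger0_norm//.
exact: le_lt_trans s1.
Qed.

(** With f(t) = Re h'(t u) - (1 - s) / (1 + s), the combination f + alpha t f' is Re (h' + alpha z
    h'') minus the same constant. It is nonnegative for t <= s by Harnack's inequality, since (1 -
    t) / (1 + t) decreases. *)
Lemma Re_dps_ge A (s : R) u : posreal A -> 0 <= s < 1 -> cmod u = 1 ->
  (1 - s) / (1 + s) <= Re (psum (dps A) (s%:C%C * u)).
Proof.
move=> [tA A1 PA] /andP[s0 s1] u1.
pose f t := Re (1 * psum (dps A) (0 + t%:C%C * u)) + - ((1 - s) / (1 + s)).
pose df t := Re (1 * (u * psum (dps (dps A)) (0 + t%:C%C * u))) + 0.
rewrite -subr_ge0; suff : 0 <= f s by rewrite /f mul1r add0r.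
have c1 : (1 - s) / (1 + s) <= 1 by rewrite ler_pdivrMr; lra.
apply: (@euler_ode_ge0 _ f df alpha s) => //.
- move=> t ts; apply: rderivD; last exact: rderiv_cst.
  by apply: rderiv_line; apply: psum_cderiv; [exact: line_lt1 ts s1|exact: tame_dps].
- by rewrite /f mul0r addr0 psum0 ?mul1r ?/dps ?A1 ?mulr1/= ?subr_ge0//; exact: tame_dps.
- move=> t /andP[t0 ts]; have ts' : 0 <= t <= s by rewrite ltW.
  have t1 := line_lt1 u1 ts' s1; rewrite /f /df !mul1r addr0.
  have := harnack (tame_pps tA) (pps0 A1) PA t1; rewrite (psum_pps t1 tA).
  rewrite !add0r cReD cmodM cmodR u1 mulr1 ger0_norm ?(ltW t0)//.
  have -> : Re (alpha%:C%C * (t%:C%C * u) * psum (dps (dps A)) (t%:C%C * u)) =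
     alpha * t * Re (u * psum (dps (dps A)) (t%:C%C * u)).
    by rewrite !ReImE /=; ring.
  have : (1 - s) / (1 + s) <= (1 - t) / (1 + t).
    by rewrite ler_pdivrMr ?ler_pdivlMr; [rewrite mulrAC ler_pdivlMr|..]; nra.
  lra.
Qed.

(** The sharp form: at - t the extremal function gives exactly Harnack's bound (1 - t) / (1 + t), so
    the difference of the two real parts satisfies the hypothesis of [euler_ode_ge0]. *)
Lemma Re_dps_ge_ext A (s : R) u : posreal A -> 0 <= s < 1 -> cmod u = 1 ->
  Re (psum (dps ext) (- s%:C%C)) <= Re (psum (dps A) (s%:C%C * u)).
Proof.
move=> [tA A1 PA] /andP[s0 s1] u1.
pose f t := Re (1 * psum (dps A) (0 + t%:C%C * u)) +
   - Re (1 * psum (dps ext) (0 + t%:C%C * -1)).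
pose df t := Re (1 * (u * psum (dps (dps A)) (0 + t%:C%C * u))) +
   - Re (1 * (-1 * psum (dps (dps ext)) (0 + t%:C%C * -1))).
have tE := tame_ext; have cN1 : cmod (-1 : R[i]) = 1 by rewrite cmodN cmod1.
rewrite -subr_ge0; suff : 0 <= f s by rewrite /f !mul1r !add0r mulrN1.
apply: (@euler_ode_ge0 _ f df alpha s) => //.
- move=> t ts; apply: rderivD; [|apply: rderivN];
  by apply: rderiv_line; apply: psum_cderiv; [exact: line_lt1 ts s1|exact: tame_dps].
- by rewrite /f !mul0r !addr0 !psum0 ?mul1r ?/dps ?A1 ?subrr//; exact: tame_dps.
- move=> t /andP[t0 ts]; have ts' : 0 <= t <= s by rewrite ltW.
  have t1 := line_lt1 u1 ts' s1; rewrite /f /df !mul1r.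
  have t1' := line_lt1 cN1 ts' s1.
  have tt : 0 <= t < 1 by rewrite ltW//=; exact: le_lt_trans s1.
  have := harnack (tame_pps tA) (pps0 A1) PA t1; rewrite (psum_pps t1 tA).
  have : Re (psum (pps ext) (- t%:C%C)) = (1 - t) / (1 + t).
    by rewrite psum_pps_ext_real.
  move: t1'; rewrite !add0r mulrN1 => t1'; rewrite psum_pps// !cReD cmodM cmodR u1 mulr1.
  rewrite ger0_norm ?(ltW t0)//.
  have -> : Re (alpha%:C%C * (t%:C%C * u) * psum (dps (dps A)) (t%:C%C * u)) =
     alpha * t * Re (u * psum (dps (dps A)) (t%:C%C * u)).
    by rewrite !ReImE /=; ring.
  have -> : Re (alpha%:C%C * - t%:C%C * psum (dps (dps ext)) (- t%:C%C)) =
     alpha * t * Re (-1 * psum (dps (dps ext)) (- t%:C%C)).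
    by rewrite !ReImE /=; ring.
  move=> h1 h2; lra.
Qed.

End Growth.

(** * Coefficient bound, growth and injectivity of the harmonic mapping *)

Section HarmonicGrowth.
Variable R : realType.
Variable alpha : R.
Hypothesis alpha_ge0 : 0 <= alpha.
Implicit Types (z w u l : R[i]).
Local Notation pps := (pps alpha).
Local Notation ext := (ext alpha).
Local Notation posreal := (posreal alpha).

Lemma phase w : exists2 l : R[i], cmod l = 1 & l * w = (cmod w)%:C%C.
Proof.
have [->|w0] := eqVneq w 0.
  by exists 1; rewrite ?cmod1// mulr0 cmod0.
have c0 : cmod w != 0 by rewrite cmod_eq0.
exists (w^*%C / (cmod w)%:C%C).
  by rewrite cmodM cmodV cmod_conj cmodR ger0_norm ?cmod_ge0// divff.
rewrite mulrAC mulrC (mulrC _ w) mulCconj expr2 rmorphM mulrA mulVf ?mul1r//.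
by rewrite (fmorph_eq0 (real_complex R)).
Qed.

Lemma polar z : exists2 u : R[i], cmod u = 1 & z = (cmod z)%:C%C * u.
Proof.
have [l l1 lz] := phase z; exists l^*%C; first by rewrite cmod_conj.
by rewrite -lz mulrAC unit_conj// mul1r.
Qed.

(** The class of the statement in terms of coefficient sequences; [classW0_hpair] makes the
    translation. *)
Record hpair (A B : nat -> R[i]) : Prop := HPair {
  tameA : tame A; tameB : tame B;
  hA0 : A 0%N = 0; hA1 : A 1%N = 1; hB0 : B 0%N = 0; hB1 : B 1%N = 0;
  hdom : forall z, cmod z < 1 ->
    cmod (psum (pps B) z) <= Re (psum (pps A) z) }.

Variables A B : nat -> R[i].
Hypothesis hAB : hpair A B.
Let tA := tameA hAB.
Let tB := tameB hAB.

Lemma dps_comb l : dps (fun n => A n + l * B n) = fun n => dps A n + l * dps B n.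
Proof. by apply/funext => n; rewrite /dps; ring. Qed.

Lemma pps_comb l : pps (fun n => A n + l * B n) = fun n => pps A n + l * pps B n.
Proof. by apply/funext => n; rewrite /pps dps_comb; ring. Qed.

Lemma posreal_comb l : cmod l = 1 -> posreal (fun n => A n + l * B n).
Proof.
move=> l1; split.
- by apply: tameD => //; exact: tameZ.
- by rewrite (hA1 hAB) (hB1 hAB) mulr0 addr0.
move=> z z1; have tpA := tame_pps alpha tA; have tpB := tame_pps alpha tB.
rewrite pps_comb psumD//; last exact: tameZ.
rewrite psumZ// cReD; have := hdom hAB z1.
have := ler_Re_cmod (l * psum (pps B) z); rewrite cmodM l1 mul1r ler_norml.
by move=> /andP[h1 h2] h3; lra.
Qed.

(** A unimodular factor that gives l B the argument of A turns |A + l B| into |A| + |B|, and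
    Caratheodory's inequality applies to h + l g. The alternative exempts degree 1, which
    corresponds to the constant term there. *)
Lemma coef_bound n : cmod (A n.+1) + cmod (B n.+1) <= 2 / (n.+1%:R * cden alpha n.+1) \/ n = 0%N.
Proof.
have [->|n0] := posnP n; [by right|left].
have [k k1 kA] := phase (A n.+1); have [l l1 lB] := phase (B n.+1).
have kl : cmod (k^*%C * l) = 1 by rewrite cmodM cmod_conj k1 l1 mulr1.
have [tC C1 PC] := posreal_comb kl.
have := caratheodory (tame_pps alpha tC) (pps0 alpha C1) n0 PC.
have c1 := cdenS_ge1 alpha_ge0 n; rewrite -cdenS in c1.
have c0 : 0 < cden alpha n.+1 by exact: lt_le_trans c1.
have n10 : 0 < n.+1%:R :> R by rewrite ltr0n.
rewrite /pps /dps -cdenS !cmodM cmodR cmod_nat ger0_norm ?(ltW c0)// => h.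
rewrite ler_pdivlMr ?mulr_gt0//.
suff -> : cmod (A n.+1) + cmod (B n.+1) = cmod (A n.+1 + k^*%C * l * B n.+1).
  by move: h; set X := cmod _; lra.
have <- : cmod (k * (A n.+1 + k^*%C * l * B n.+1)) = cmod (A n.+1 + k^*%C * l * B n.+1).
  by rewrite cmodM k1 mul1r.
rewrite mulrDr !mulrA unit_conj// mul1r kA lB -rmorphD cmodR ger0_norm//.
by rewrite addr_ge0 ?cmod_ge0.
Qed.

(** If l g'(z) = |g'(z)|, then the derivative of h - l g at z has real part Re h'(z) - |g'(z)|, so
    bounds valid on [posreal] transfer. *)
Lemma jac_ge (c : R) z : cmod z < 1 ->
  (forall C u, posreal C -> cmod u = 1 ->
     c <= Re (psum (dps C) ((cmod z)%:C%C * u))) ->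
  c <= Re (psum (dps A) z) - cmod (psum (dps B) z).
Proof.
move=> z1 H; have [l l1 lB] := phase (psum (dps B) z).
have Nl : cmod (- l) = 1 by rewrite cmodN.
have [u u1 zu] := polar z.
have := H _ _ (posreal_comb Nl) u1; rewrite -zu dps_comb psumD//.
- rewrite psumZ//; last exact: tame_dps.
  by rewrite cReD mulNr lB cReN.
- exact: tame_dps.
- exact/tameZ/tame_dps.
Qed.

Lemma jac_ge_ratio z : cmod z < 1 ->
  (1 - cmod z) / (1 + cmod z) <= Re (psum (dps A) z) - cmod (psum (dps B) z).
Proof.
move=> z1; apply: jac_ge => // C u pC u1.
by apply: (Re_dps_ge alpha_ge0 pC) => //; rewrite cmod_ge0.
Qed.

Lemma jac_ge_ext z : cmod z < 1 ->
  Re (psum (dps ext) (- (cmod z)%:C%C)) <=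
  Re (psum (dps A) z) - cmod (psum (dps B) z).
Proof.
move=> z1; apply: jac_ge => // C u pC u1.
by apply: (Re_dps_ge_ext alpha_ge0 pC) => //; rewrite cmod_ge0.
Qed.

Local Notation f := (harm (psum A) (psum B)).

(* Along the ray through [z], the derivative of [Re (conj(u) h + u g)] is at least
   [Re h' - |g'|], which is minimal for the extremal function. *)
Lemma growth z : cmod z < 1 ->
  - Re (psum ext (- (cmod z)%:C%C)) <= cmod (f z).
Proof.
move=> z1; have [u u1 zu] := polar z.
have z0 := cmod_ge0 z; set s := cmod z in z1 zu z0 *.
have tE := tame_ext alpha_ge0; have cN1 : cmod (-1 : R[i]) = 1 by rewrite cmodN cmod1.
(* The last summand subtracts the extremal growth at t, so that phi 0 = 0 and the claim becomes
   monotonicity of phi. *)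
pose phi t := Re (u^*%C * psum A (0 + t%:C%C * u)) +
   Re (u * psum B (0 + t%:C%C * u)) +
   Re (1 * psum ext (0 + t%:C%C * -1)).
pose dphi t := Re (u^*%C * (u * psum (dps A) (0 + t%:C%C * u))) +
   Re (u * (u * psum (dps B) (0 + t%:C%C * u))) +
   Re (1 * (-1 * psum (dps ext) (0 + t%:C%C * -1))).
have phi0 : phi 0 = 0.
  by rewrite /phi !mul0r addr0 !psum0// (hA0 hAB) (hB0 hAB) !mulr0 /= !addr0.
have : phi 0 <= phi s.
  apply: (@rderiv_le _ phi dphi) => // [x xs|x /andP[x0 xs]].
    by apply: rderivD; [apply: rderivD|]; apply: rderiv_line; apply: psum_cderiv => //;
      exact: line_lt1 xs z1.
  have x1 : cmod (x%:C%C * u) = x by rewrite cmodM u1 mulr1 cmodR gtr0_norm.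
  have := @jac_ge_ext (x%:C%C * u); rewrite x1 => /(_ (lt_trans xs z1)).
  have uu : u^*%C * u = 1 by rewrite mulrC unit_conj.
  rewrite /dphi !add0r (mulrA u^*%C) uu !mul1r mulrN1 mulN1r (mulrA u u).
  have := ler_Re_cmod (u * u * psum (dps B) (x%:C%C * u)).
  rewrite !cmodM u1 !mul1r ler_norml => /andP[h1 h2] h3.
  by rewrite cReN; lra.
rewrite phi0 /phi !add0r mul1r mulrN1 -zu => h.
rewrite lerNl -subr_ge0 opprK; apply: le_trans h _; rewrite addrC; apply: lerD => //.
have -> : Re (u^*%C * psum A z) + Re (u * psum B z) =
   Re (u^*%C * f z) by rewrite /harm !ReImE; ring.
apply: le_trans (ler_norm _) _; apply: le_trans (ler_Re_cmod _) _.
by rewrite cmodM cmod_conj u1 mul1r.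
Qed.

(* Injectivity as in the Noshiro-Warschawski theorem: [Re h' > |g'|] makes
   [Re (conj(v) (f w - f z))] positive for [v = w - z]. *)
Lemma harm_inj z w : cmod z < 1 -> cmod w < 1 -> f z = f w -> z = w.
Proof.
move=> z1 w1 fzw; apply/eqP; rewrite -subr_eq0; apply/negPn/negP => v0.
pose v := w - z.
have vn : v != 0 by apply: contraNneq v0 => v0; rewrite -oppr_eq0 opprB -/v v0.
have v2 : 0 < cmod v ^+ 2 by rewrite exprn_gt0// lt_neqAle cmod_ge0 eq_sym cmod_eq0 vn.
pose phi t := Re (v^*%C * psum A (z + t%:C%C * v)) +
   Re (v * psum B (z + t%:C%C * v)).
pose dphi t := Re (v^*%C * (v * psum (dps A) (z + t%:C%C * v))) +
   Re (v * (v * psum (dps B) (z + t%:C%C * v))).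
have lt1 t : 0 <= t <= 1 -> cmod (z + t%:C%C * v) < 1.
  move=> /andP[t0 t1]; have -> : z + t%:C%C * v = (1 - t)%:C%C * z + t%:C%C * w.
    by rewrite /v rmorphB rmorph1; ring.
  apply: le_lt_trans (cmodD _ _) _; rewrite !cmodM !cmodR !ger0_norm ?subr_ge0//.
  have [->|tn] := eqVneq t 0; first by rewrite mul0r subr0 mul1r addr0.
  have tp : 0 < t by rewrite lt_neqAle eq_sym tn.
  have : t * cmod w < t * 1 by rewrite ltr_pM2l.
  have : (1 - t) * cmod z <= (1 - t) * 1.
    by apply: ler_wpM2l; rewrite ?subr_ge0// ltW.
  by lra.
have : phi 0 < phi 1.
  apply: (@rderiv_lt _ phi dphi) => // [x xs|x /andP[x0 x1]].
    by apply: rderivD; apply: rderiv_line; apply: psum_cderiv => //; exact: lt1.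
  have := lt1 x; rewrite !ltW// => /(_ isT) l1.
  have := jac_ge_ratio l1; rewrite /dphi.
  set a := psum (dps A) _; set b := psum (dps B) _ => h.
  have r0 : 0 < (1 - cmod (z + x%:C%C * v)) / (1 + cmod (z + x%:C%C * v)).
    by rewrite divr_gt0 ?subr_gt0// ltr_wpDr ?cmod_ge0.
  have -> : Re (v^*%C * (v * a)) = cmod v ^+ 2 * Re a.
    by rewrite mulrA (mulrC _ v) mulCconj [LHS]cReM /= mul0r subr0.
  have := ler_Re_cmod (v * (v * b)).
  rewrite mulrA !cmodM -expr2 ler_norml => /andP[h1 h2].
  have : 0 < cmod v ^+ 2 * (Re a - cmod b) by rewrite mulr_gt0//; lra.
  by lra.
have -> : phi 0 = Re (v^*%C * f z).
  by rewrite /phi mul0r addr0 /harm !ReImE; ring.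
have -> : phi 1 = Re (v^*%C * f w).
  rewrite /phi rmorph1 mul1r /v addrCA subrr addr0 -/v /harm !ReImE; ring.
by rewrite fzw ltxx.
Qed.

End HarmonicGrowth.

(** * The extremal function on the negative radius and its limit at -1 *)

Section ExtremalBoundaryValue.
Variable R : realType.
Variable alpha : R.
Hypothesis alpha_ge0 : 0 <= alpha.
Local Notation ext := (ext alpha).
Local Notation cden := (cden alpha).
Implicit Types (s : R).

Lemma real_cauchy (x : nat -> R) : (forall e, 0 < e -> exists N, forall n m,
  (N <= n)%N -> (n <= m)%N -> `|x m - x n| <= e) -> cvgn x.
Proof.
move=> H; apply/cauchy_cvgP; apply/cauchy_ballP => e e0; near_simpl.
have e2 : 0 < e / 2 by rewrite divr_gt0.
have [N hN] := H _ e2.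
exists ([set n | N <= n], [set n | N <= n])%N; first by split; exists N.
move=> [n m] /= [Nn Nm]; rewrite /ball/= .
have lt e' : e' <= e / 2 -> e' < e by lra.
by apply: lt; have [nm|/ltnW mn] := leqP n m; [rewrite distrC|]; exact: hN.
Qed.

Lemma alternating_bound (b : nat -> R) m L : (forall n, (m <= n)%N -> 0 <= b n) ->
  (forall n, (m <= n)%N -> b n.+1 <= b n) ->
  0 <= \sum_(i < L) (-1) ^+ i * b (m + i)%N <= b m.
Proof.
elim: L m => [|L IH] m b0 bd; first by rewrite big_ord0 lexx b0.
rewrite big_ord_recl expr0 mul1r addn0.
have -> : \sum_(i < L) (-1) ^+ (lift ord0 i) * b (m + lift ord0 i)%N =
  - \sum_(i < L) (-1) ^+ i * b (m.+1 + i)%N.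
  by rewrite -sumrN; apply: eq_bigr => i _; rewrite /= exprS addSnnS mulN1r mulNr.
have := IH m.+1 (fun n mn => b0 n (ltnW mn)) (fun n mn => bd n (ltnW mn)).
by have := bd m (leqnn m); lra.
Qed.

(** Half of the nonlinear part of the extremal growth. Being alternating, it still converges at s =
    1, outside the range of [psum_cvg]. *)
Definition altp s N : R := \sum_(2 <= n < N) (-1) ^+ n.-1 * s ^+ n / (n%:R * cden n).

Lemma ncc_gt0 n : 0 < n.+1%:R * cden n.+1.
Proof.
by rewrite mulr_gt0 ?ltr0n// cdenS; have := cdenS_ge1 alpha_ge0 n; lra.
Qed.

Lemma ncc_ge n : n.+1%:R <= n.+1%:R * cden n.+1.
Proof. by rewrite -[leLHS]mulr1 ler_pM// cdenS cdenS_ge1. Qed.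

(** Leibniz's bound by the first omitted term. That it does not depend on s is what gives the limit
    at s = 1. *)
Lemma altp_cauchy s n m : 0 <= s <= 1 -> (n.+2 <= m)%N ->
  `|altp s m - altp s n.+2| <= n.+2%:R^-1.
Proof.
move=> /andP[s0 s1] nm; rewrite /altp (big_cat_nat (n := n.+2))//= addrAC subrr add0r.
pose b i := s ^+ i / (i%:R * cden i).
have b0 i : (n.+2 <= i)%N -> 0 <= b i.
  by case: i => // i _; rewrite divr_ge0 ?exprn_ge0// ltW// ncc_gt0.
have bd i : (n.+2 <= i)%N -> b i.+1 <= b i.
  case: i => // i _; rewrite /b; apply: ler_pM; rewrite ?exprn_ge0 ?invr_ge0 ?(ltW (ncc_gt0 _))//.
    by apply: ler_wiXn2l.
  rewrite lef_pV2 ?posrE ?ncc_gt0//; apply: ler_pM; rewrite ?ler_nat// ?cdenS.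
    by have := cdenS_ge1 alpha_ge0 i; lra.
  by rewrite -natr1 mulrDl mul1r addrA lerDl.
have /andP[l u] := alternating_bound (m - n.+2) b0 bd.
have -> : \sum_(n.+2 <= i < m) (-1) ^+ i.-1 * s ^+ i / (i%:R * cden i) =
  (-1) ^+ n.+1 * \sum_(i < m - n.+2) (-1) ^+ i * b (n.+2 + i)%N.
  rewrite -{1}(add0n n.+2) big_addn big_mkord mulr_sumr; apply: eq_bigr => i _.
  by rewrite (addnC i) /b !mulrA -exprD.
rewrite normrM normrX normrN1 expr1n mul1r ger0_norm//.
apply: le_trans u _; rewrite /b -[leRHS]mul1r.
apply: ler_pM; rewrite ?exprn_ge0 ?exprn_ile1 ?invr_ge0 ?(ltW (ncc_gt0 _))//.
by rewrite lef_pV2 ?posrE ?ncc_gt0 ?ltr0n// ncc_ge.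
Qed.

Lemma altp_cvg s : 0 <= s <= 1 -> cvgn (altp s).
Proof.
move=> s01; apply: real_cauchy => e e0.
exists (Num.trunc e^-1).+2 => n m Nn nm.
case: n Nn nm => [//|[//|n]] Nn nm.
apply: le_trans (altp_cauchy s01 nm) _.
rewrite -[leRHS]invrK lef_pV2 ?posrE ?invr_gt0 ?ltr0n//.
apply/ltW/(lt_le_trans (truncnS_gt _)); rewrite ler_nat; exact: ltnW.
Qed.

Lemma altp_lim s n : 0 <= s <= 1 ->
  `|limn (altp s) - altp s n.+2| <= n.+2%:R^-1.
Proof.
move=> s01.
have H : (fun m => `|altp s m - altp s n.+2|) @ \oo --> `|limn (altp s) - altp s n.+2|.
  by apply: cvg_norm; apply: cvgB; [exact: altp_cvg|exact: cvg_cst].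
rewrite -(cvg_lim _ H)//; apply: limr_le; first by apply/cvg_ex; exists `|limn (altp s) - altp s n.+2|.
by exists n.+2 => // m /= nm; exact: altp_cauchy.
Qed.

Definition extray s : R := - Re (psum ext (- s%:C%C)).

Lemma extrayE s : 0 <= s < 1 -> extray s = s + 2 * limn (altp s).
Proof.
move=> /andP[s0 s1]; have s01 : 0 <= s <= 1 by rewrite s0 ltW.
have cs : cmod (- s%:C%C) < 1 by rewrite cmodN cmodR ger0_norm.
have /cvgCP C := psum_cvg cs (tame_ext alpha_ge0).
have P N : (2 <= N)%N -> - Re (\sum_(n < N) ext n * (- s%:C%C) ^+ n) =
    s + 2 * altp s N.
  move=> N2; rewrite /altp -(big_mkord xpredT (fun n => ext n * (- s%:C%C) ^+ n)).
  rewrite (big_cat_nat (n := 2))//= big_nat_recr//= big_nat1 mul0r add0r mul1r expr1.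
  rewrite cReD opprD cReN /= opprK; congr (_ + _).
  rewrite mulr_sumr cRe_sum -sumrN; apply: eq_big_nat => -[|[|n]]// _.
  rewrite extSS -rmorphN -rmorphXn -rmorphM cReC [(- s) ^+ _]exprNn cdenS.
  by rewrite [(-1) ^+ n.+2]exprS mulN1r [n.+2.-1]/=; ring.
apply/eqP; rewrite -subr_eq0 -normr_eq0 eq_le normr_ge0 andbT.
apply/ler_addgt0Pr => e e0; rewrite add0r.
have e3 : 0 < e / 2 by rewrite divr_gt0.
have [N1 h1] := C _ e3.
have e4 : 0 < e / 4 by rewrite divr_gt0.
have /cvgrPdist_lt/(_ _ e4)[N2 _ h2] := altp_cvg s01.
pose N := maxn 2 (maxn N1 N2).
have := h1 N; rewrite !leq_max leqnn orbT => /(_ isT) {}h1.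
have := h2 N; rewrite /= !leq_max leqnn !orbT => /(_ isT) {}h2.
have := ler_Re_cmod (\sum_(n < N) ext n * (- s%:C%C) ^+ n - psum ext (- s%:C%C)).
rewrite cReD cReN -[X in `|X - _|]opprK P ?leq_max// -/(extray s) => h3.
have {}h3 := le_lt_trans h3 h1.
move: h3 h2; rewrite /extray !ltr_norml => /andP[h3 h4] /andP[h5 h6].
by rewrite ler_norml; apply/andP; split; lra.
Qed.

(* [extray s] is the modulus of the extremal function at [- s]; its limit at
   [s = 1] is the distance from [0] to the boundary of the extremal image. *)
Definition extdist : R := 1 + 2 * limn (fun N => \sum_(2 <= n < N) ((-1) ^+ n.-1 / (n%:R * cden n))).

Lemma extdistE : extdist = 1 + 2 * limn (altp 1).
Proof.
have -> : altp 1 = fun N => \sum_(2 <= n < N) ((-1) ^+ n.-1 / (n%:R * cden n)).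
  by apply/funext => N; apply: eq_bigr => n _; rewrite expr1n mulr1.
by [].
Qed.

(** Abel's limit theorem: the two tails together cost 4 / (n + 2), and the finite sums differ by at
    most (1 - s)(n + 2), because 1 - s^i <= i (1 - s). *)
Lemma extray_near_dd e : 0 < e -> exists2 s0, 0 <= s0 < 1 &
  forall s, s0 <= s < 1 -> `|extray s - extdist| <= e.
Proof.
move=> e0; pose n := Num.trunc (8 / e).
have nn : 4 / n.+2%:R <= e / 2.
  rewrite ler_pdivrMr ?ltr0n//.
  have := truncnS_gt (8 / e); rewrite -/n ltr_pdivrMr// => h.
  by rewrite -natr1; lra.
pose K : R := 1 + 2 * n.+2%:R.
have K0 : 0 < K by rewrite ltr_wpDr// mulr_ge0.
exists (Num.max 0 (1 - e / 2 / K)).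
  rewrite le_max lexx/= gt_max ltr01/= ltrBlDr ltrDl !divr_gt0//.
move=> s; rewrite ge_max => /andP[/andP[s0 se] s1].
have s01 : 0 <= s <= 1 by rewrite s0 ltW.
have sK : (1 - s) * K <= e / 2 by rewrite -ler_pdivlMr//; lra.
rewrite extrayE ?s0// extdistE.
have l1 := altp_lim n s01; have l2 := @altp_lim 1 n ltac:(lra).
have m : `|altp s n.+2 - altp 1 n.+2| <= (1 - s) * n.+2%:R.
  rewrite /altp -sumrB; apply: le_trans (ler_norm_sum _ _ _) _.
  apply: (@le_trans _ _ (\sum_(2 <= i < n.+2) (1 - s))); last first.
    rewrite sumr_const_nat -[leLHS]mulr_natr; apply: ler_wpM2l; first by lra.
    by rewrite ler_nat leq_subr.
  rewrite big_nat [leRHS]big_nat; apply: ler_sum => -[|i]// /andP[i2 _].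
  have -> : (-1) ^+ i.+1.-1 * s ^+ i.+1 / (i.+1%:R * cden i.+1) -
     (-1) ^+ i.+1.-1 * 1 ^+ i.+1 / (i.+1%:R * cden i.+1) =
     (-1) ^+ i * ((s ^+ i.+1 - 1) / (i.+1%:R * cden i.+1)) by rewrite expr1n /=; ring.
  rewrite normrM normrX normrN1 expr1n mul1r normrM normfV (gtr0_norm (ncc_gt0 _)).
  rewrite ler_pdivrMr ?ncc_gt0// distrC ger0_norm ?subr_ge0 ?exprn_ile1 ?(ltW s1)//.
  rewrite -opprB subrX1 -mulNr opprB ler_wpM2l ?subr_ge0 ?(ltW s1)//.
  apply: le_trans (ncc_ge i); rewrite -[X in _ <= X%:R]card_ord -sumr_const.
  by apply: ler_sum => j _; rewrite exprn_ile1 ?(ltW s1).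
move: l1 l2 m nn sK; rewrite -[4 / _]/(4 * n.+2%:R^-1) /K.
set v := _^-1; rewrite !ler_norml => /andP[? ?] /andP[? ?] /andP[? ?] ? ?.
by apply/andP; split; lra.
Qed.

Lemma extray_rderiv x : 0 <= x < 1 ->
  rderiv extray x (Re (psum (dps ext) (- x%:C%C))).
Proof.
move=> /andP[x0 x1].
have -> : extray = fun x => - Re (1 * psum ext (0 + x%:C%C * -1)).
  by apply/funext => t; rewrite mul1r add0r mulrN1.
have -> : Re (psum (dps ext) (- x%:C%C)) =
    - Re (1 * (-1 * psum (dps ext) (0 + x%:C%C * -1))).
  by rewrite mul1r add0r mulrN1 mulN1r cReN opprK.
apply: rderivN; apply: rderiv_line; apply: psum_cderiv; last exact: tame_ext.
by rewrite add0r mulrN1 cmodN cmodR ger0_norm.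
Qed.

Lemma extray_deriv_gt0 x : 0 <= x < 1 -> 0 < Re (psum (dps ext) (- x%:C%C)).
Proof.
move=> x01; have cN1 : cmod (-1 : R[i]) = 1 by rewrite cmodN cmod1.
have := Re_dps_ge alpha_ge0 (posreal_ext alpha_ge0) x01 cN1.
rewrite mulrN1; apply: lt_le_trans.
by case/andP: x01 => x0 x1; rewrite divr_gt0//; lra.
Qed.

Lemma extray_lt s t : 0 <= s -> s < t -> t < 1 -> extray s < extray t.
Proof.
move=> s0 st t1.
apply: (rderiv_lt (df := fun x => Re (psum (dps ext) (- x%:C%C)))) => // x.
  by move=> /andP[sx xt]; apply: extray_rderiv; rewrite (le_trans s0)// (le_lt_trans xt).
by move=> /andP[/ltW sx xt]; apply: extray_deriv_gt0; rewrite (le_trans s0)// (lt_trans xt).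
Qed.

Lemma extray_le s t : 0 <= s -> s <= t -> t < 1 -> extray s <= extray t.
Proof.
move=> s0; rewrite le_eqVlt => /orP[/eqP -> //|st t1]; exact/ltW/extray_lt.
Qed.

Lemma extray0 : extray 0 = 0.
Proof. by rewrite /extray rmorph0 oppr0 psum0 ?oppr0//; exact: tame_ext. Qed.

Lemma extray_le_dd s : 0 <= s < 1 -> extray s <= extdist.
Proof.
move=> /andP[s0 s1]; apply/ler_addgt0Pr => e e0.
have [t0 /andP[t00 t01] H] := extray_near_dd e0.
pose t := Num.max s t0.
have t1 : t < 1 by rewrite gt_max s1.
have := H t; rewrite t1 le_max lexx orbT => /(_ isT).
rewrite ler_norml => /andP[_ h].
have k1 : extray s <= extray t by apply: extray_le => //; rewrite le_max lexx.
by rewrite -lerBlDl; exact: le_trans (lerB k1 (lexx extdist)) h.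
Qed.

Lemma extdist_gt0 : 0 < extdist.
Proof.
have h : 0 <= (1 / 2 : R) < 1 by lra.
apply: lt_le_trans (extray_le_dd h); rewrite -extray0; apply: extray_lt; lra.
Qed.

(** The first term of the series is - 1 / (2 (1 + alpha)) <= - 1/4 and the tail is at most 1/3, so
    the bound is 1 + 2 (1/3 - 1/4). *)
Lemma extdist_le (alpha_le1 : alpha <= 1) : extdist <= 7 / 6.
Proof.
rewrite extdistE; have := @altp_lim 1 1 ltac:(lra).
rewrite {2}/altp big_nat1 expr1n mulr1 expr1 mulN1r /cden ler_norml => /andP[_].
have -> : (2%:R * alpha + 1 - alpha) = 1 + alpha by lra.
have : 1 / 4 <= (2 * (1 + alpha))^-1.
  have p : 0 < 2 * (1 + alpha) by rewrite mulr_gt0// ltr_wpDr.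
  by rewrite div1r lef_pV2 ?posrE//; lra.
have -> : (1.+2%:R^-1 : R) = 1 / 3 by rewrite div1r.
set v := (2%:R * _)^-1; rewrite -/v; lra.
Qed.

End ExtremalBoundaryValue.

(** * Monotonicity, continuity and the root of the radius equation *)

Section BohrFunction.
Variable R : realType.
Variable alpha : R.
Hypothesis alpha_ge0 : 0 <= alpha.
Local Notation cden := (cden alpha).
Implicit Types (r s q : R).

Definition bterm r n : R := (cden n * r ^+ n + 2 * r ^+ (2 * n)) / (n%:R * cden n ^+ 2).

Lemma bohr_funE r : bohr_fun alpha r =
  r + r ^+ 2 + 2 * limn (fun N => \sum_(2 <= n < N) bterm r n) - extdist alpha.
Proof. by rewrite /bohr_fun /extdist opprD addrA. Qed.

Lemma cden_ge1 n : 1 <= cden n.+1.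
Proof. by rewrite cdenS cdenS_ge1. Qed.

Lemma btermE r n : bterm r n.+1 = r ^+ n.+1 / (n.+1%:R * cden n.+1) +
  2 * r ^+ (2 * n.+1) / (n.+1%:R * cden n.+1 ^+ 2).
Proof.
have c1 := cden_ge1 n; have c0 : cden n.+1 != 0 by rewrite gt_eqF//; lra.
have n0 : n.+1%:R != 0 :> R by rewrite pnatr_eq0.
rewrite /bterm; move: c0 n0; move: (cden n.+1) => c; move: (n.+1%:R) => m c0 m0.
by field; rewrite c0 m0.
Qed.

Lemma inv_ncc_le1 n k : (n.+1%:R * cden n.+1 ^+ k)^-1 <= n.+1%:R^-1.
Proof.
have c1 := cden_ge1 n; have ck : 1 <= cden n.+1 ^+ k by exact: exprn_ege1.
have c0 : 0 < cden n.+1 ^+ k by exact: lt_le_trans ck.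
by rewrite lef_pV2 ?posrE ?mulr_gt0 ?ltr0n// -[leLHS]mulr1 ler_pM.
Qed.

Lemma bterm_incr n r s : 0 <= r -> r <= s -> bterm r n.+1 <= bterm s n.+1.
Proof.
move=> r0 rs; have c1 := cden_ge1 n; have c0 : 0 < cden n.+1 by exact: lt_le_trans c1.
rewrite /bterm; apply: ler_wpM2r; first by rewrite invr_ge0 mulr_ge0// exprn_ge0// ltW.
by apply: lerD; (apply: ler_wpM2l; [rewrite ?(ltW c0)//|]);
   apply: lerXn2r; rewrite ?nnegrE// (le_trans r0).
Qed.

Lemma bterm_ge0 n r : 0 <= r -> 0 <= bterm r n.+1.
Proof.
move=> r0; apply: le_trans (bterm_incr n (lexx 0) r0).
by rewrite /bterm mulnS !exprS !mul0r !mulr0 addr0 mul0r.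
Qed.

(** From s^m - r^m <= m q^(m-1) (s - r): the power n + 1 contributes 1, and the power 2 (n + 1) with
    its factor 2 contributes 4, hence the 5. *)
Lemma bterm_lip n r s q : 0 <= r -> r <= s -> s <= q -> q <= 1 ->
  bterm s n.+1 - bterm r n.+1 <= 5 * q ^+ n * (s - r).
Proof.
move=> r0 rs sq q1; have q0 : 0 <= q by rewrite (le_trans r0)// (le_trans rs).
have s0 : 0 <= s by rewrite (le_trans r0).
have P m : s ^+ m - r ^+ m <= m%:R * q ^+ m.-1 * (s - r).
  rewrite subrXX mulrC; apply: ler_wpM2r; first by rewrite subr_ge0.
  rewrite mulr_natl -[X in _ *+ X]card_ord -sumr_const; apply: ler_sum => i _.
  have -> : m.-1 = (m.-1 - i + i)%N.
    by rewrite subnK// -ltnS prednK// (leq_ltn_trans _ (ltn_ord i)).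
  rewrite {1}(_ : m.-1 - i + i - i = m.-1 - i)%N ?addnK// exprD.
  by apply: ler_pM; rewrite ?exprn_ge0//; apply: lerXn2r; rewrite ?nnegrE// (le_trans rs).
have n0 : 0 < n.+1%:R :> R by rewrite ltr0n.
have -> : bterm s n.+1 - bterm r n.+1 =
   (s ^+ n.+1 - r ^+ n.+1) / (n.+1%:R * cden n.+1 ^+ 1) +
   2 * ((s ^+ (2 * n.+1) - r ^+ (2 * n.+1)) / (n.+1%:R * cden n.+1 ^+ 2)).
  by rewrite !btermE expr1; ring.
have D m : r ^+ m <= s ^+ m by apply: lerXn2r; rewrite ?nnegrE.
have Q k m : (s ^+ m - r ^+ m) / (n.+1%:R * cden n.+1 ^+ k) <=
    m%:R * q ^+ m.-1 * (s - r) / n.+1%:R.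
  by apply: ler_pM; rewrite ?subr_ge0 ?D ?invr_ge0 ?mulr_ge0 ?exprn_ge0 ?P ?inv_ncc_le1//;
    rewrite ltW// (lt_le_trans _ (cden_ge1 _)).
have h1 := Q 1%N n.+1; have h2 := Q 2%N (2 * n.+1)%N.
have e1 : n.+1%:R * q ^+ n.+1.-1 * (s - r) / n.+1%:R = q ^+ n * (s - r).
  by rewrite /=; field; rewrite gt_eqF.
have e2 : (2 * n.+1)%:R * q ^+ (2 * n.+1).-1 * (s - r) / n.+1%:R <= 2 * (q ^+ n * (s - r)).
  have -> : (2 * n.+1)%:R * q ^+ (2 * n.+1).-1 * (s - r) / n.+1%:R =
     2 * (q ^+ (2 * n.+1).-1 * (s - r)).
    by rewrite natrM; move: (q ^+ _) => X; field; rewrite gt_eqF.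
  apply: ler_wpM2l => //; apply: ler_wpM2r; first by rewrite subr_ge0.
  by apply: ler_wiXn2l => //; lia.
rewrite e1 in h1; have {}h2 := le_trans h2 e2.
apply: (@le_trans _ _ (q ^+ n * (s - r) + 2 * (2 * (q ^+ n * (s - r))))).
  by apply: lerD => //; apply: ler_wpM2l.
by rewrite le_eqVlt; apply/orP; left; apply/eqP; ring.
Qed.

Definition bsum r N : R := \sum_(2 <= n < N) bterm r n.

Lemma bsum_nd r : 0 <= r -> nondecreasing_seq (bsum r).
Proof.
move=> r0; apply/nondecreasing_seqP => n; rewrite /bsum.
have [n2|n2] := leqP 2 n; last by rewrite !big_geq// ltnW.
rewrite (big_nat_recr n)//= lerDl; case: (n) n2 => // m _; exact: bterm_ge0.
Qed.

Lemma bsum_le r s N : 0 <= r -> r <= s -> bsum r N <= bsum s N.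
Proof.
move=> r0 rs; rewrite /bsum big_nat [leRHS]big_nat; apply: ler_sum => -[|n]// _.
exact: bterm_incr.
Qed.

Lemma bsum_lip r s q N : 0 <= r -> r <= s -> s <= q -> q < 1 ->
  bsum s N - bsum r N <= 5 / (1 - q) * (s - r).
Proof.
move=> r0 rs sq q1; rewrite /bsum -sumrB.
have q0 : 0 <= q by rewrite (le_trans r0)// (le_trans rs).
apply: (@le_trans _ _ (\sum_(2 <= n < N) 5 * q ^+ n.-1 * (s - r))).
  rewrite big_nat [leRHS]big_nat; apply: ler_sum => -[|n]// _.
  by apply: bterm_lip => //; exact: ltW.
rewrite -mulr_suml; apply: ler_wpM2r; first by rewrite subr_ge0.
rewrite -mulr_sumr; apply: ler_wpM2l => //.
apply: le_trans (@geom_le _ q N.-1 _); last by rewrite q0.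
rewrite -(big_mkord xpredT (fun n => q ^+ n)).
case: N => [|[|N]]; [by rewrite !big_geq|by rewrite !big_geq|].
by rewrite (big_add1 _ _ 1%N) /= [leRHS]big_ltn// expr0 lerDr.
Qed.

Lemma bsum_0 N : bsum 0 N = 0.
Proof.
rewrite /bsum big_nat big1// => -[|n]// _.
by rewrite /bterm mulnS !exprS !mul0r !mulr0 addr0 mul0r.
Qed.

Lemma bsum_cvg r : 0 <= r < 1 -> cvgn (bsum r).
Proof.
move=> /andP[r0 r1]; apply: nondecreasing_is_cvgn; first exact: bsum_nd.
exists (5 / (1 - r) * r) => _ [N _ <-].
by have := bsum_lip N (lexx 0) r0 (lexx r) r1; rewrite bsum_0 !subr0.
Qed.

Local Notation bl r := (limn (bsum r)).

(** Strictness comes from the linear term; the remaining terms are nondecreasing. *)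
Lemma bohr_fun_lt r s : 0 <= r -> r < s -> s < 1 ->
  bohr_fun alpha r < bohr_fun alpha s.
Proof.
move=> r0 rs s1; have s0 : 0 <= s by exact/(le_trans r0)/ltW.
have : bl r <= bl s.
  apply: ler_lim; [by apply: bsum_cvg; rewrite r0 (lt_trans rs)|by apply: bsum_cvg; rewrite s0|].
  by apply: nearW => N; apply: bsum_le => //; exact: ltW.
rewrite !bohr_funE -/(bsum r) -/(bsum s).
have : r ^+ 2 <= s ^+ 2 by apply: lerXn2r; rewrite ?nnegrE// ltW.
lra.
Qed.

Lemma bohr_fun_lip r s q : 0 <= r -> r <= s -> s <= q -> q < 1 ->
  bohr_fun alpha s - bohr_fun alpha r <= (3 + 10 / (1 - q)) * (s - r).
Proof.
move=> r0 rs sq q1; have s0 : 0 <= s by exact/(le_trans r0).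
have s1 : s < 1 by exact: le_lt_trans q1.
have r1 : r < 1 by exact: le_lt_trans s1.
have cr : cvgn (bsum r) by apply: bsum_cvg; rewrite r0.
have cs : cvgn (bsum s) by apply: bsum_cvg; rewrite s0.
have : bl s - bl r <= 5 / (1 - q) * (s - r).
  rewrite -limB//; apply: limr_le; first exact: is_cvgB.
  by apply: nearW => N; exact: bsum_lip.
rewrite !bohr_funE -/(bsum r) -/(bsum s).
have : s ^+ 2 - r ^+ 2 <= 2 * (s - r).
  by rewrite subr_sqr mulrC; apply: ler_wpM2r; lra.
have -> : (3 + 10 / (1 - q)) * (s - r) = 3 * (s - r) + 2 * (5 / (1 - q) * (s - r)).
  by move: (_^-1) => X; ring.
lra.
Qed.

Lemma lipschitz_continuous (g : R -> R) (K : R) : 0 <= K ->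
  (forall x y, `|g x - g y| <= K * `|x - y|) -> continuous g.
Proof.
move=> K0 H x; apply/cvgrPdist_lt => e e0.
have K1 : 0 < K + 1 by rewrite ltr_wpDl.
near=> y; apply: le_lt_trans (H x y) _.
have : `|x - y| < e / (K + 1).
  by near: y; apply: cvgr_dist_lt; rewrite ?divr_gt0//; exact: cvg_id.
rewrite ltr_pdivlMr// => h; have := normr_ge0 (x - y); lra.
Unshelve. all: by end_near.
Qed.

Lemma bohr_fun_root : alpha <= 1 -> exists2 r : R, 0 < r < 1 & bohr_fun alpha r = 0.
Proof.
(* At 3/4 already r + r^2 = 21/16 exceeds the bound 7/6 for [extdist], so the function is positive
   there. *)
move=> al1; pose q : R := 3 / 4.
have [q0 q1] : 0 < q /\ q < 1 by rewrite /q; split; lra.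
(* Clamping to [0, q] makes the function Lipschitz on the whole line, so that global continuity is
   available for the intermediate value theorem. *)
pose cl x := Num.max 0 (Num.min x q).
have clb x : 0 <= cl x <= q.
  by rewrite /cl le_max lexx/= ge_max (ltW q0)/= ge_min lexx orbT.
have cl_id x : 0 <= x <= q -> cl x = x.
  by move=> /andP[x0 xq]; rewrite /cl (min_idPl _)// (max_idPr _).
have clm x y : x <= y -> cl x <= cl y.
  by move=> xy; rewrite /cl; apply: le_max2 => //; apply: le_min2.
have cll x y : x <= y -> cl y - cl x <= y - x.
  move=> xy; rewrite /cl; case: (leP x q) => a; case: (leP y q) => b; [| |lra|lra].
    by case: (leP 0 x) => c; case: (leP 0 y) => d; lra.
  by rewrite (max_idPr (ltW q0)); case: (leP 0 x) => c; lra.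
pose g x := bohr_fun alpha (cl x).
pose K : R := 3 + 10 / (1 - q).
have K0 : 0 <= K by rewrite addr_ge0// divr_ge0//; lra.
have gc : continuous g.
  apply: (@lipschitz_continuous g K) => // x y.
  wlog xy : x y / y <= x => [W|].
    by have [/W//|/ltW /W h] := leP y x; rewrite distrC (distrC x).
  have [/andP[x1 x2] /andP[y1 y2]] := (clb x, clb y).
  rewrite (ger0_norm (_ : 0 <= x - y)) ?subr_ge0// ger0_norm.
    apply: le_trans (bohr_fun_lip y1 (clm _ _ xy) x2 q1) _.
    by apply: ler_wpM2l => //; exact: cll.
  rewrite subr_ge0 /g; have := clm _ _ xy; rewrite le_eqVlt => /orP[/eqP -> //|h].
  by apply/ltW/bohr_fun_lt => //; exact: le_lt_trans q1.
have f0 : bohr_fun alpha 0 < 0.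
  rewrite bohr_funE -/(bsum 0) (_ : bsum 0 = fun=> 0); last by apply/funext => N; rewrite bsum_0.
  by rewrite lim_cst// expr0n /= mulr0 !addr0 sub0r oppr_lt0 extdist_gt0.
have fq : 0 < bohr_fun alpha q.
  have h : 0 <= bl q.
    rewrite -[leLHS](bsum_0 0) (le_trans (bsum_le 0 (lexx 0) (ltW q0)))//.
    apply: nondecreasing_cvgn_le; first exact/bsum_nd/ltW.
    by apply: bsum_cvg; rewrite ltW.
  rewrite bohr_funE -/(bsum q); have := extdist_le alpha_ge0 al1.
  have e : q + q ^+ 2 = 21 / 16 by rewrite /q; field.
  by rewrite e; move: h; move: (bl q) => L; lra.
have [||c cq gc0] := @IVT R g 0 q 0 (ltW q0).
- by apply: continuous_subspaceT.
- rewrite /g !cl_id ?lexx ?(ltW q0)//.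
  by rewrite ge_min le_max (ltW f0) (ltW fq) orbT.
move: cq; rewrite in_itv/= => /andP[c0 cq].
exists c; last by rewrite -gc0 /g cl_id ?c0.
have fc : bohr_fun alpha c = 0 by rewrite -gc0 /g cl_id ?c0.
rewrite (le_lt_trans cq q1) andbT lt_neqAle c0 andbT; apply/eqP => c0'.
by subst c; rewrite fc ltxx in f0.
Qed.

End BohrFunction.

(** * Plane Lebesgue measure under translations, shears and linear maps *)

Section LinearArea.
Variable R : realType.
Local Notation RM := (measurableTypeR R).
Local Notation lam := (@lebesgue_measure R).
Local Notation lam2 := (lam \x lam)%E.
Implicit Types (S : set (RM * RM)).

(** The pushforward packaged as a measure, so that invariance follows from the uniqueness of
    Lebesgue measure and of product measures. *)
Definition pushf d d' (T : measurableType d) (U : measurableType d')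
    (m : {measure set T -> \bar R}) (f : T -> U) (mf : measurable_fun setT f) :
    {measure set U -> \bar R} :=
  measure_function_pushforward__canonical__measure_function_Measure m mf.

Lemma measurable_shift (k : R) : measurable_fun setT (fun y : RM => (y + k : RM)).
Proof. by apply: measurable_funD => //; exact: measurable_id. Qed.

Lemma lebesgue_shift (k : R) (A : set RM) : measurable A ->
  lam [set y | A (y + k)] = lam A.
Proof.
move=> mA; rewrite -[LHS]/(pushf lam (measurable_shift k) A).
symmetry; apply: lebesgue_measure_unique => //.
move=> _ [[a b] /= ab <-]; rewrite /pushforward.
have -> : (fun y => y + k) @^-1` `]a, b]%classic = `]a - k, b - k]%classic.
  by apply/seteqP; split=> x /=; rewrite !in_itv/= ltrBlDr lerBrDr.
by rewrite !lebesgue_measure_itv/= !lte_fin ltrD2r; case: ifP => // _;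
  rewrite -!EFinD; congr (_%:E); ring.
Qed.

Lemma measurable_pre d d' (T : measurableType d) (U : measurableType d')
  (f : T -> U) (B : set U) : measurable_fun setT f -> measurable B -> measurable (f @^-1` B).
Proof. by move=> mf mB; rewrite -[X in measurable X]setTI; exact: mf. Qed.

Lemma measurable_lin (a b c : R) :
  measurable_fun setT (fun p : RM * RM => (a * p.1 + b * p.2 + c : RM)).
Proof.
apply: measurable_funD => //; apply: measurable_funD; apply: measurable_funM => //.
Qed.

Lemma measurable_shear (k : R) :
  measurable_fun setT (fun p : RM * RM => (p.1, p.2 + k * p.1) : RM * RM).
Proof.
apply: measurable_fun_pair; first exact: measurable_fst.
have := measurable_lin k 1 0; apply: eq_measurable_fun => p _ /=.
by rewrite mul1r addr0 addrC.
Qed.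

Lemma measurable_translate (w : RM * RM) :
  measurable_fun setT (fun p : RM * RM => (p.1 + w.1, p.2 + w.2) : RM * RM).
Proof.
apply: measurable_fun_pair.
  by have := measurable_lin 1 0 w.1; apply: eq_measurable_fun => p _ /=; ring.
by have := measurable_lin 0 1 w.2; apply: eq_measurable_fun => p _ /=; ring.
Qed.

Lemma measurable_swap_map :
  measurable_fun setT (fun p : RM * RM => (p.2, p.1) : RM * RM).
Proof.
by apply: measurable_fun_pair; [exact: measurable_snd|exact: measurable_fst].
Qed.

Lemma area_swap S : measurable S -> lam2 [set p | S (p.2, p.1)] = lam2 S.
Proof.
move=> mS; rewrite -[LHS]/(pushf lam2 measurable_swap_map S).
symmetry; apply: product_measure_unique => // A B mA mB.
rewrite /= /pushforward.
have -> : (fun p : RM * RM => (p.2, p.1)) @^-1` (A `*` B) = B `*` A.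
  by apply/seteqP; split=> -[x y] /= [].
by rewrite product_measure1E// muleC.
Qed.

(** Cavalieri's principle: each vertical section is merely translated. *)
Lemma area_shear S k : measurable S -> lam2 [set p | S (p.1, p.2 + k * p.1)] = lam2 S.
Proof.
move=> mS; rewrite /product_measure1; apply: eq_integral => x _ /=.
have -> : xsection [set p | S (p.1, p.2 + k * p.1)] x =
    [set y | xsection S x (y + k * x)].
  by apply/seteqP; split=> y /=; rewrite /xsection/= !inE.
by apply: lebesgue_shift; exact: measurable_xsection.
Qed.

Lemma area_translate S w : measurable S ->
  lam2 [set p | S (p.1 + w.1, p.2 + w.2)] = lam2 S.
Proof.
move=> mS; rewrite -[LHS]/(pushf lam2 (measurable_translate w) S).
symmetry; apply: product_measure_unique => // A B mA mB.
rewrite /= /pushforward.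
have -> : (fun p : RM * RM => (p.1 + w.1, p.2 + w.2)) @^-1` (A `*` B) =
    [set x | A (x + w.1)] `*` [set y | B (y + w.2)].
  by apply/seteqP; split=> -[x y] /= [].
have m1 k C : measurable C -> measurable [set x : RM | C (x + k)].
  by move=> mC; exact: (measurable_pre (measurable_shift k)).
rewrite product_measure1E//; try exact: m1.
by congr (_ * _)%E; exact: lebesgue_shift.
Qed.

Lemma area_shear1 S k : measurable S -> lam2 [set p | S (p.1 + k * p.2, p.2)] = lam2 S.
Proof.
move=> mS; pose S' := [set p : RM * RM | S (p.2, p.1)].
have mS' : measurable S' by exact: (measurable_pre measurable_swap_map).
rewrite -[RHS](area_swap mS) -/S' -(area_shear k mS') -[RHS]area_swap.
  by congr lam2; apply/seteqP; split=> -[x y].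
exact: (measurable_pre (measurable_shear k) mS').
Qed.

Definition box (c : R * R) (r1 r2 : R) : set (RM * RM) :=
  `[c.1 - r1, c.1 + r1]%classic `*` `[c.2 - r2, c.2 + r2]%classic.

Lemma measurable_box c r1 r2 : measurable (box c r1 r2).
Proof. by apply: measurableX; exact: measurable_itv. Qed.

Lemma area_box c r1 r2 : 0 <= r1 -> 0 <= r2 ->
  lam2 (box c r1 r2) = (4 * r1 * r2)%:E.
Proof.
have E (a r : R) : 0 <= r -> lam `[a - r, a + r]%classic = (2 * r)%:E.
  move=> r0; rewrite lebesgue_measure_itv /= lte_fin.
  case: ltP => h; rewrite -?EFinD; congr (_%:E); lra.
move=> r10 r20; rewrite product_measure1E; [|exact: measurable_itv|exact: measurable_itv].
transitivity ((2 * r1)%:E * (2 * r2)%:E)%E; first by congr (_ * _)%E; exact: E.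
by rewrite -EFinM; congr (_%:E); ring.
Qed.

Lemma box_abs c r1 r2 p : box c r1 r2 p = (`|p.1 - c.1| <= r1 /\ `|p.2 - c.2| <= r2).
Proof.
apply/propext; rewrite /box/= !in_itv/= !ler_norml.
by split=> -[/andP[? ?] /andP[? ?]]; split; apply/andP; split; lra.
Qed.

Definition lmap (a b c d : R) (p : RM * RM) : RM * RM :=
  (a * p.1 + b * p.2, c * p.1 + d * p.2).

Lemma measurable_lmap a b c d : measurable_fun setT (lmap a b c d).
Proof.
apply: measurable_fun_pair.
  by have := measurable_lin a b 0; apply: eq_measurable_fun => p _ /=; rewrite addr0.
by have := measurable_lin c d 0; apply: eq_measurable_fun => p _ /=; rewrite addr0.
Qed.

(* The matrix factors as a diagonal matrix times two shears, and the preimage of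
   a box under a diagonal matrix is again a box. *)
Lemma area_lmap_box1 (a b c d r : R) : a != 0 -> a * d - b * c != 0 -> 0 <= r ->
  lam2 (lmap a b c d @^-1` box (0, 0) r r) = (4 * r ^+ 2 / `|a * d - b * c|)%:E.
Proof.
move=> a0 D0 r0; set D := a * d - b * c in D0 *.
have Da : D / a != 0 by rewrite mulf_neq0// invr_eq0.
pose B := box (0, 0) (r / `|a|) (r / `|D / a|).
pose k := c * a / D.
pose S1 := [set p : RM * RM | B (p.1, p.2 + k * p.1)].
have mB : measurable B by exact: measurable_box.
have mS1 : measurable S1 by exact: (measurable_pre (measurable_shear k)).
have -> : lmap a b c d @^-1` box (0, 0) r r = [set p | S1 (p.1 + b / a * p.2, p.2)].
  apply/seteqP; split=> -[x y] /=; rewrite /S1/B/= !box_abs /= !subr0.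
    move=> [h1 h2]; rewrite !ler_pdivlMr ?normr_gt0// -!normrM; split.
      by apply: le_trans h1; rewrite le_eqVlt; apply/orP; left; apply/eqP; congr `|_|; field.
    apply: le_trans h2; rewrite le_eqVlt; apply/orP; left; apply/eqP; congr `|_|.
    by rewrite /k /D; field; rewrite a0.
  rewrite !ler_pdivlMr ?normr_gt0// -!normrM => -[h1 h2]; split.
    by apply: le_trans h1; rewrite le_eqVlt; apply/orP; left; apply/eqP; congr `|_|; field.
  apply: le_trans h2; rewrite le_eqVlt; apply/orP; left; apply/eqP; congr `|_|.
  by rewrite /k /D; field; rewrite a0.
rewrite area_shear1// area_shear// area_box ?divr_ge0//; congr (_%:E).
rewrite normrM normfV; have : `|a| != 0 by rewrite normr_eq0.
have : `|D| != 0 by rewrite normr_eq0.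
by move: `|a| `|D| => u v v0 u0; field; rewrite u0 v0.
Qed.

(** If the leading entry vanishes, a shear adds the second column to the first, which makes that
    entry nonzero and preserves the determinant. *)
Lemma area_lmap_box (a b c d r : R) : a * d - b * c != 0 -> 0 <= r ->
  lam2 (lmap a b c d @^-1` box (0, 0) r r) = (4 * r ^+ 2 / `|a * d - b * c|)%:E.
Proof.
move=> D0 r0; have [a0|a0] := eqVneq a 0; last exact: area_lmap_box1.
have b0 : b != 0.
  by apply: contraNneq D0 => b0; rewrite a0 b0 !mul0r subrr.
have E : (a + b) * d - b * (c + d) = a * d - b * c by ring.
have := @area_lmap_box1 (a + b) b (c + d) d r; rewrite E a0 add0r => /(_ b0).
rewrite {1}a0 in D0; move=> /(_ D0 r0) <-.
rewrite -(area_shear 1); last exact: (measurable_pre (measurable_lmap _ _ _ _)) (measurable_box _ _ _).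
congr lam2; apply/seteqP; split=> -[x y] /=; rewrite /lmap/= !box_abs /= !subr0;
 move=> -[h1 h2]; split; [apply: le_trans h1|apply: le_trans h2|apply: le_trans h1|apply: le_trans h2];
 rewrite le_eqVlt; apply/orP; left; apply/eqP; congr `|_|; ring.
Qed.

End LinearArea.

(** * Images of squares under maps close to a linear one *)

Section LocalInverse.
Variable R : realType.
Implicit Types (z w p u v c : R[i]) (e eta m : R).

(** The sup norm is used because its balls are squares, which tile the polar rectangle and whose
    linear images are parallelograms. *)
Definition supn z : R := Num.max `|Re z| `|Im z|.

Lemma supn_le z e : (supn z <= e) = (`|Re z| <= e) && (`|Im z| <= e).
Proof. by rewrite /supn ge_max. Qed.

Lemma supn_ge0 z : 0 <= supn z.
Proof. by rewrite /supn le_max normr_ge0. Qed.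

Lemma supnD z w : supn (z + w) <= supn z + supn w.
Proof.
rewrite supn_le cReD cImD; apply/andP; split; apply: le_trans (ler_normD _ _) _;
by apply: lerD; rewrite /supn le_max lexx ?orbT.
Qed.

Lemma supnN z : supn (- z) = supn z.
Proof. by rewrite /supn cReN cImN !normrN. Qed.

Lemma supnC z w : supn (z - w) = supn (w - z).
Proof. by rewrite -supnN opprB. Qed.

Lemma supn0 : supn 0 = 0.
Proof. by rewrite /supn /= normr0 maxxx. Qed.

Lemma supn_le0 z : supn z <= 0 -> z = 0.
Proof.
by rewrite supn_le !normr_le0 => /andP[/eqP r /eqP i]; apply: complexP.
Qed.

Lemma supn_cmod z : supn z <= cmod z.
Proof. by rewrite supn_le ler_Re_cmod ler_Im_cmod. Qed.

Lemma cmod_sn z : cmod z <= 2 * supn z.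
Proof.
apply: le_trans (ler_cmod_ReIm z) _.
have : `|Re z| <= supn z by rewrite /supn le_max lexx.
have : `|Im z| <= supn z by rewrite /supn le_max lexx orbT.
by lra.
Qed.

Lemma pow_small (eta a e : R) : 0 <= eta < 1 -> 0 < e -> exists n, eta ^+ n * a <= e.
Proof.
move=> eta01 e0; have [eta0 eta1] := andP eta01.
have [a0|a0] := leP a 0.
  by exists 0%N; rewrite expr0 mul1r; exact/(le_trans a0)/ltW.
pose b := a / (1 - eta) / e.
have b0 : 0 < b by rewrite !divr_gt0// subr_gt0.
exists (Num.trunc b).+1; set n := _.+1.
have n0 : 0 < n%:R :> R by rewrite ltr0n.
have bn : b < n%:R by exact: truncnS_gt.
have := natr_geom_le n eta01 => h.
rewrite -(ler_pM2l n0) mulrA; apply: (@le_trans _ _ ((1 - eta)^-1 * a)).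
  by rewrite ler_pM2r.
rewrite mulrC -ler_pdivrMr//; exact: ltW.
Qed.

(** Banach's fixed point theorem on a closed ball. The condition on [T c] keeps the iterates in the
    ball, and the limit is formed in each coordinate. *)
Lemma supn_fixpoint (T : R[i] -> R[i]) c e eta : 0 <= eta < 1 ->
  (forall x y, supn (x - c) <= e -> supn (y - c) <= e -> supn (T x - T y) <= eta * supn (x - y)) ->
  supn (T c - c) <= (1 - eta) * e ->
  exists2 x, supn (x - c) <= e & T x = x.
Proof.
move=> eta01 Tc Tcc; have [eta0 eta1] := andP eta01.
have e0 : 0 <= e.
  by have := le_trans (supn_ge0 _) Tcc; rewrite pmulr_rge0// subr_gt0.
pose x n := iter n T c.
have xb n : supn (x n - c) <= e.
  elim: n => [|n IH]; first by rewrite /x /= subrr supn0.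
  have -> : x n.+1 - c = (T (x n) - T c) + (T c - c) by rewrite /x /=; ring.
  apply: le_trans (supnD _ _) _.
  have := Tc (x n) c IH; rewrite subrr supn0 => /(_ e0) h.
  have : eta * supn (x n - c) <= eta * e by apply: ler_wpM2l.
  by lra.
have xd n k : supn (x (n + k)%N - x n) <= eta ^+ n * e.
  elim: n => [|n IH]; first by rewrite add0n expr0 mul1r; exact: xb.
  apply: le_trans (Tc _ _ (xb _) (xb _)) _; rewrite exprS -mulrA.
  exact: ler_wpM2l.
have C (f : R[i] -> R) : (forall z w, `|f z - f w| <= supn (z - w)) -> cvgn (f \o x).
  move=> fs; apply: real_cauchy => d d0.
  have [N hN] := pow_small e eta01 d0.
  exists N => n n' Nn nn'; apply: le_trans (fs _ _) _; rewrite -(subnKC nn').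
  apply: le_trans (xd _ _) _; apply: le_trans hN; apply: ler_wpM2r => //.
  by apply: ler_wiXn2l => //; exact: ltW.
have fR z w : `|Re z - Re w| <= supn (z - w).
  by rewrite -cReN -cReD /supn le_max lexx.
have fI z w : `|Im z - Im w| <= supn (z - w).
  by rewrite -cImN -cImD /supn le_max lexx orbT.
pose X : R[i] := (limn (@Re R \o x) +i* limn (@Im R \o x))%C.
have L (f : R[i] -> R) n : (forall z w, `|f z - f w| <= supn (z - w)) ->
    `|limn (f \o x) - f (x n)| <= eta ^+ n * e.
  move=> fs.
  have H : (fun k => `|(f \o x) k - f (x n)|) @ \oo --> `|limn (f \o x) - f (x n)|.
    by apply: cvg_norm; apply: cvgB; [exact: C|exact: cvg_cst].
  rewrite -(cvg_lim _ H)//; apply: limr_le.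
    by apply/cvg_ex; exists `|limn (f \o x) - f (x n)|.
  exists n => // k /= nk; apply: le_trans (fs _ _) _.
  by rewrite -(subnKC nk); exact: xd.
have XL n : supn (X - x n) <= eta ^+ n * e.
  by rewrite supn_le cReD cImD cReN cImN !L.
have XB : supn (X - c) <= e by have := XL 0%N; rewrite expr0 mul1r.
exists X => //; apply/eqP; rewrite -subr_eq0; apply/eqP/supn_le0.
apply/ler_addgt0Pr => d d0; rewrite add0r.
have [n hn] := pow_small (2 * e) eta01 d0.
have -> : T X - X = (T X - T (x n)) + (x n.+1 - X) by rewrite /x /=; ring.
apply: le_trans (supnD _ _) _; rewrite (supnC _ X).
have h1 := Tc _ _ XB (xb n); have h2 := XL n; have h3 := XL n.+1.
have : eta * supn (X - x n) <= supn (X - x n) by rewrite ler_piMl ?supn_ge0// ltW.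
have : eta ^+ n.+1 * e <= eta ^+ n * e.
  by apply: ler_wpM2r => //; rewrite exprS ler_piMl ?exprn_ge0// ltW.
lra.
Qed.

Definition cdet u v : R := Re u * Im v - Im u * Re v.

(** The real-linear map sending 1 to u and 'i to v; [cdet] is its determinant and [lin2V] its
    inverse by Cramer's rule. *)
Definition lin2 u v z : R[i] := (Re z)%:C%C * u + (Im z)%:C%C * v.

Definition lin2V u v p : R[i] :=
  ((Im v / cdet u v * Re p + - Re v / cdet u v * Im p) +i*
   (- Im u / cdet u v * Re p + Re u / cdet u v * Im p))%C.

Lemma lin2K u v p : cdet u v != 0 -> lin2 u v (lin2V u v p) = p.
Proof.
by move=> D0; apply: complexP; rewrite /lin2 !ReImE /=; move: D0; rewrite /cdet => D0; field.
Qed.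

Lemma lin2VK u v z : cdet u v != 0 -> lin2V u v (lin2 u v z) = z.
Proof.
by move=> D0; apply: complexP; rewrite /lin2V/= !ReImE /=; move: D0; rewrite /cdet => D0; field.
Qed.

Lemma lin2VB u v p q : lin2V u v (p - q) = lin2V u v p - lin2V u v q.
Proof. by apply: complexP; rewrite ?cReD ?cImD ?cReN ?cImN /= ?cReD ?cImD ?cReN ?cImN; ring. Qed.

Lemma lin20 u v : lin2 u v 0 = 0.
Proof. by rewrite /lin2 /= !mul0r addr0. Qed.

Section Cover.
Variables (Phi : R[i] -> R[i]) (u v c : R[i]) (e eta m : R).
Hypothesis D0 : cdet u v != 0.
Hypothesis m0 : 0 < m.
Hypothesis Lm : forall z, m * supn z <= cmod (lin2 u v z).
Hypothesis eta01 : 0 <= eta < 1.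
Hypothesis hPhi : forall x y, supn (x - c) <= e -> supn (y - c) <= e ->
  cmod (Phi x - Phi y - lin2 u v (x - y)) <= eta * m * supn (x - y).

Lemma supn_Linv p : m * supn (lin2V u v p) <= cmod p.
Proof. by rewrite -{2}(lin2K p D0). Qed.

Lemma supn_Linv_err x y : supn (x - c) <= e -> supn (y - c) <= e ->
  supn (lin2V u v (Phi x - Phi y) - (x - y)) <= eta * supn (x - y).
Proof.
move=> xc yc; rewrite -{1}(lin2VK (x - y) D0) -lin2VB -(ler_pM2l m0).
by apply: le_trans (supn_Linv _) _; apply: le_trans (hPhi xc yc) _; rewrite mulrA (mulrC m).
Qed.

(** A simplified Newton iteration: x - L^-1 (Phi x - w), with L the fixed linear map, is a
    contraction of ratio eta, and its fixed point is a preimage of w. *)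
Lemma cover_in w : supn (lin2V u v (w - Phi c)) <= (1 - eta) * e ->
  exists2 x, supn (x - c) <= e & Phi x = w.
Proof.
move=> hw; have [eta0 eta1] := andP eta01.
pose T x := x - lin2V u v (Phi x - w).
have [x y xc yc||x xc Tx] := @supn_fixpoint T c e eta eta01.
- have -> : T x - T y = - (lin2V u v (Phi x - Phi y) - (x - y)).
    by rewrite /T !lin2VB; ring.
  by rewrite supnN; exact: supn_Linv_err.
- have -> : T c - c = lin2V u v (w - Phi c) by rewrite /T !lin2VB; ring.
  exact: hw.
exists x => //; apply/eqP; rewrite -subr_eq0 -(lin2K (Phi x - w) D0).
have -> : lin2V u v (Phi x - w) = x - T x by rewrite /T; ring.
by rewrite Tx subrr lin20.
Qed.

Lemma cover_out x : supn (x - c) <= e -> supn (lin2V u v (Phi x - Phi c)) <= (1 + eta) * e.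
Proof.
move=> xc; have e0 := le_trans (supn_ge0 _) xc.
have cce : supn (c - c) <= e by rewrite subrr supn0.
have h := supn_Linv_err xc cce.
have := supnD (lin2V u v (Phi x - Phi c) - (x - c)) (x - c); rewrite subrK => h2.
have [eta0 _] := andP eta01.
have : eta * supn (x - c) <= eta * e by apply: ler_wpM2l.
lra.
Qed.

End Cover.

(** The parallelogram w + L(square of half-side e), written with the inverse of L so that it is a
    preimage of a box. *)
Definition para w u v e : set (measurableTypeR R * measurableTypeR R) :=
  [set p | supn (lin2V u v ((p.1 +i* p.2)%C - w)) <= e].

Lemma para_pre w u v e : para w u v e =
  [set p | (lmap (Im v / cdet u v) (- Re v / cdet u v)
     (- Im u / cdet u v) (Re u / cdet u v) @^-1` box (0, 0) e e)
     (p.1 + - Re w, p.2 + - Im w)].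
Proof.
apply/seteqP; split=> -[x y]; rewrite /para /= box_abs /= !subr0 supn_le /= !ReImE /=.
  by move=> /andP.
by move=> ?; apply/andP.
Qed.

Lemma measurable_para0 u v e : measurable
  (lmap (Im v / cdet u v) (- Re v / cdet u v)
     (- Im u / cdet u v) (Re u / cdet u v) @^-1` box (0, 0) e e).
Proof. by apply: measurable_pre; [exact: measurable_lmap|exact: measurable_box]. Qed.

Lemma measurable_para w u v e : measurable (para w u v e).
Proof.
rewrite para_pre.
exact: (measurable_pre (measurable_translate (- Re w, - Im w)) (measurable_para0 u v e)).
Qed.

Lemma area_para w u v e : 0 <= e -> cdet u v != 0 ->
  (lebesgue_measure \x lebesgue_measure)%E (para w u v e) = (4 * e ^+ 2 * `|cdet u v|)%:E.
Proof.
move=> e0 D0; rewrite para_pre.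
rewrite (area_translate (- Re w, - Im w) (measurable_para0 u v e)).
have E : Im v / cdet u v * (Re u / cdet u v) -
   - Re v / cdet u v * (- Im u / cdet u v) = (cdet u v)^-1.
  by move: D0; rewrite /cdet => D0; field.
rewrite area_lmap_box// E ?invr_eq0//; congr (_%:E).
by rewrite normfV invrK.
Qed.

End LocalInverse.

(** * The differential of h + conj(g) and a uniform open mapping property *)

Section HarmonicLinearisation.
Variable R : realType.
Implicit Types (z w p q u v : R[i]) (A B : nat -> R[i]) (r s e : R).

(** The real differential of h + conj(g) at a point where h' = p and g' = q; its determinant is
    |p|^2 - |q|^2 ([cdet_RL]). *)
Definition rlin p q z : R[i] := p * z + (q * z)^*%C.

Lemma rlinD p q z w : rlin p q (z + w) = rlin p q z + rlin p q w.
Proof. by apply: complexP; rewrite /rlin !ReImE; ring. Qed.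

Lemma rlin_scale p q (x : R) z : rlin p q (x%:C%C * z) = x%:C%C * rlin p q z.
Proof. by apply: complexP; rewrite /rlin !ReImE /=; ring. Qed.

Lemma rlin_ub p q z : cmod (rlin p q z) <= (cmod p + cmod q) * cmod z.
Proof. by apply: le_trans (cmodD _ _) _; rewrite cmod_conj !cmodM mulrDl. Qed.

Lemma rlin_lb p q z : (Re p - cmod q) * cmod z <= cmod (rlin p q z).
Proof.
have := cmodB (rlin p q z) (q * z)^*%C; rewrite /rlin addrK cmod_conj !cmodM.
have : Re p * cmod z <= cmod p * cmod z.
  apply: ler_wpM2r; first exact: cmod_ge0.
  by apply: le_trans (ler_norm _) _; exact: ler_Re_cmod.
lra.
Qed.

Lemma cdet_RL p q u v :
  cdet (rlin p q u) (rlin p q v) = (cmod p ^+ 2 - cmod q ^+ 2) * cdet u v.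
Proof. by rewrite !cmod_sqr /cdet /rlin !ReImE; ring. Qed.

Lemma lin2_RL p q u v z : lin2 (rlin p q u) (rlin p q v) z = rlin p q (lin2 u v z).
Proof. by rewrite /lin2 rlinD !rlin_scale. Qed.

Lemma rlin_strict (fw fz gw gz p p0 q q0 d : R[i]) (KA KB LA LB y : R) :
  0 <= KA -> 0 <= KB -> 0 <= LA -> 0 <= LB -> 0 <= y ->
  cmod (fw - fz - d * p) <= KA * cmod d ^+ 2 ->
  cmod (gw - gz - d * q) <= KB * cmod d ^+ 2 ->
  cmod (p - p0) <= LA * y -> cmod (q - q0) <= LB * y ->
  cmod ((fw + gw^*%C) - (fz + gz^*%C) - rlin p0 q0 d) <=
  (KA + KB + LA + LB) * (cmod d + y) * cmod d.
Proof.
move=> KA0 KB0 LA0 LB0 y0.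
have -> : (fw + gw^*%C) - (fz + gz^*%C) - rlin p0 q0 d =
  ((fw - fz - d * p) + d * (p - p0)) + ((gw - gz - d * q) + d * (q - q0))^*%C.
  by apply: complexP; rewrite /rlin !ReImE; ring.
move: (fw - fz - d * p) (gw - gz - d * q) (p - p0) (q - q0) => a b c e ha hb hc hd.
apply: le_trans (cmodD _ _) _; rewrite cmod_conj.
have h1 := cmodD a (d * c); have h2 := cmodD b (d * e).
rewrite !cmodM in h1 h2.
have x0 := cmod_ge0 d; move: x0 ha hb hc hd h1 h2.
move: (cmod (a + _)) (cmod (b + _)) (cmod d) (cmod a) (cmod b) (cmod c) (cmod e).
move=> U V x a1 b1 c1 e1 x0 ha hb hc hd h1 h2.
have g1 : x * c1 <= x * (LA * y) by apply: ler_wpM2l.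
have g2 : x * e1 <= x * (LB * y) by apply: ler_wpM2l.
have xy : 0 <= x * y by rewrite mulr_ge0.
have xx : 0 <= x * x by rewrite mulr_ge0.
have i1 : 0 <= KA * (x * y) by rewrite mulr_ge0.
have i2 : 0 <= KB * (x * y) by rewrite mulr_ge0.
have i3 : 0 <= LA * (x * x) by rewrite mulr_ge0.
have i4 : 0 <= LB * (x * x) by rewrite mulr_ge0.
lra.
Qed.

(** The differential at z0 controls increments between two other points z and w, as a contraction
    argument requires. *)
Lemma harm_strict A B r : tame A -> tame B -> 0 < r < 1 ->
  exists2 K, 0 <= K & forall z0 z w, cmod z0 <= r -> cmod z <= r -> cmod w <= r ->
  cmod (harm (psum A) (psum B) w - harm (psum A) (psum B) z -
        rlin (psum (dps A) z0) (psum (dps B) z0) (w - z)) <=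
  K * (cmod (w - z) + cmod (z - z0)) * cmod (w - z).
Proof.
move=> tA tB r01.
have [KA KA0 hKA] := psum_quad r01 tA; have [KB KB0 hKB] := psum_quad r01 tB.
have [LA LA0 hLA] := psum_lip r01 (tame_dps tA).
have [LB LB0 hLB] := psum_lip r01 (tame_dps tB).
exists (KA + KB + LA + LB); first by rewrite !addr_ge0.
move=> z0 z w z0r zr wr; rewrite /harm.
apply: rlin_strict; [exact: KA0|exact: KB0|exact: LA0|exact: LB0|exact: cmod_ge0|..].
- exact: hKA.
- exact: hKB.
- exact: hLA.
- exact: hLB.
Qed.

Lemma psum_dps_bound A r : 0 <= r < 1 -> tame A ->
  exists2 K, 0 <= K & forall z, cmod z <= r -> cmod (psum (dps A) z) <= K.
Proof. by move=> r01 tA; apply: psum_bound => //; exact: tame_dps. Qed.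

Variable alpha : R.
Hypothesis alpha_ge0 : 0 <= alpha.
Variables A B : nat -> R[i].
Hypothesis hAB : hpair alpha A B.
Local Notation f := (harm (psum A) (psum B)).
Let tA := tameA hAB.
Let tB := tameB hAB.

Lemma ratio_gt0 r : 0 <= r < 1 -> 0 < (1 - r) / (1 + r) :> R.
Proof. by move=> /andP[r0 r1]; rewrite divr_gt0//; lra. Qed.

Lemma ratio_le (x y : R) : 0 <= x -> x <= y -> (1 - y) / (1 + y) <= (1 - x) / (1 + x).
Proof.
move=> x0 xy; rewrite ler_pdivrMr; last by lra.
rewrite mulrAC ler_pdivlMr; last by lra.
by lra.
Qed.

Lemma jac_ge_uniform r z : r < 1 -> cmod z <= r ->
  (1 - r) / (1 + r) <= Re (psum (dps A) z) - cmod (psum (dps B) z).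
Proof.
move=> r1 zr; have z0 := cmod_ge0 z; have z1 := le_lt_trans zr r1.
apply: le_trans (jac_ge_ratio alpha_ge0 hAB z1).
exact: ratio_le.
Qed.

Lemma jac_det_gt0 z : cmod z < 1 ->
  0 < cmod (psum (dps A) z) ^+ 2 - cmod (psum (dps B) z) ^+ 2.
Proof.
move=> z1; have h := jac_ge_uniform z1 (lexx _).
have h2 := @ratio_gt0 (cmod z); rewrite cmod_ge0 z1 in h2; have {}h2 := h2 isT.
have := le_trans (ler_norm _) (ler_Re_cmod (psum (dps A) z)).
have := cmod_ge0 (psum (dps B) z); nra.
Qed.

(** The radius e is the same for all |z| <= s. [boundary_ge] depends on this, since there z is found
    only after e has been chosen. *)
Lemma harm_open s tau : 0 <= s < 1 -> 0 < tau ->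
  exists2 e : R, 0 < e & forall z w, cmod z <= s -> cmod (w - f z) <= e ->
    exists z', [/\ cmod (z' - z) <= tau, cmod z' < 1 & f z' = w].
Proof.
move=> /andP[s0 s1] tau0; pose r := (1 + s) / 2.
have [r0 r1 sr] : [/\ 0 < r, r < 1 & s < r] by rewrite /r; split; lra.
have r01 : 0 < r < 1 by rewrite r0.
have [K K0 hK] := harm_strict tA tB r01.
pose mu := (1 - r) / (1 + r).
have mu0 : 0 < mu by apply: ratio_gt0; rewrite r1 ltW.
have K24 : 0 < 24 * K + 1 by rewrite ltr_wpDl// mulr_ge0.
(* The three bounds keep z' within tau of z, keep the ball inside |x| <= r, and make the contraction
   ratio 1/2: the error is at most K * 6e * 2 [supn (x - y)], to be compared with mu / 2. *)
pose e := Num.min (Num.min (tau / 2) ((1 - s) / 4)) (mu / (24 * K + 1)).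
have s4 : 0 < (1 - s) / 4 by lra.
have e0 : 0 < e by rewrite /e !lt_min s4 (divr_gt0 mu0 K24) andbT divr_gt0.
have e1 : e <= tau / 2 by rewrite /e !ge_min lexx.
have e2 : e <= (1 - s) / 4 by rewrite /e !ge_min lexx orbT.
have e3 : e * (24 * K + 1) <= mu by rewrite -ler_pdivlMr// /e !ge_min lexx !orbT.
exists (mu * e / 2); first by apply: divr_gt0 => //; exact: mulr_gt0.
move=> z w zs wz; set p := psum (dps A) z; set q := psum (dps B) z.
have zr : cmod z <= r by apply: le_trans (ltW sr).
have z1 : cmod z < 1 by exact: le_lt_trans s1.
have ball x : supn (x - z) <= e -> cmod (x - z) <= 2 * e /\ cmod x <= r.
  move=> xz; have h := cmod_sn (x - z); have h2 := cmodD (x - z) z.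
  by rewrite subrK in h2; rewrite /r; split; lra.
pose u := rlin p q 1; pose v := rlin p q 'i%C.
have Luv x : lin2 u v x = rlin p q x.
  rewrite /u /v lin2_RL; congr rlin; apply: complexP; rewrite /lin2 !ReImE /=; ring.
have D0 : cdet u v != 0.
  rewrite /u /v cdet_RL (_ : cdet 1 'i%C = 1); last by rewrite /cdet /= ; ring.
  by rewrite mulr1 gt_eqF// jac_det_gt0.
have Lm x : mu * supn x <= cmod (lin2 u v x).
  rewrite Luv; apply: le_trans (rlin_lb p q x).
  apply: le_trans (ler_wpM2l (ltW mu0) (supn_cmod x)) _.
  by apply: ler_wpM2r; [exact: cmod_ge0|exact: jac_ge_uniform].
have hPhi x y : supn (x - z) <= e -> supn (y - z) <= e ->
    cmod (f x - f y - lin2 u v (x - y)) <= 2^-1 * mu * supn (x - y).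
  move=> /ball [xz xr] /ball [yz yr]; rewrite Luv.
  apply: le_trans (hK z y x zr yr xr) _.
  have h := cmod_sn (x - y); have h2 := cmodB (x - z) (y - z).
  rewrite (_ : x - z - (y - z) = x - y) in h2; last by ring.
  have g : cmod (x - y) + cmod (y - z) <= 6 * e by lra.
  have x0 := cmod_ge0 (x - y).
  apply: (@le_trans _ _ (K * (6 * e) * (2 * supn (x - y)))).
    apply: ler_pM => //; last exact: ler_wpM2l.
    by rewrite mulr_ge0// addr_ge0// cmod_ge0.
  have -> : K * (6 * e) * (2 * supn (x - y)) = (e * (24 * K)) / 2 * supn (x - y) by field.
  by apply: ler_wpM2r; [exact: supn_ge0|lra].
have [||z' z'z fz'] := @cover_in R f u v z e 2^-1 mu D0 mu0 Lm _ hPhi w.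
- by rewrite invr_ge0 ler0n/= invf_lt1// ltr1n.
- rewrite -(ler_pM2l mu0); apply: le_trans (supn_Linv D0 Lm _) _.
  by apply: le_trans wz _; rewrite le_eqVlt; apply/orP; left; apply/eqP; field.
have [h1 h2] := ball _ z'z.
by exists z'; split => //; [lra|exact: le_lt_trans r1].
Qed.

End HarmonicLinearisation.

(** * Polar coordinates and their differential *)

Section Polar.
Variable R : realType.
Implicit Types (z w x y : R[i]) (A B : nat -> R[i]) (r s t d : R).

Lemma abs_sin_le t : `|sin t| <= `|t|.
Proof.
wlog t0 : t / 0 <= t => [W|].
  have [/W//|/ltW t0] := leP 0 t.
  by rewrite -normrN -sinN -(normrN t); apply: W; rewrite oppr_ge0.
have [c ct] : exists2 c : R, c \in `[0, t]%R & sin t - sin 0 = cos c * (t - 0).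
  apply: (@MVT_segment _ (@sin R) (@cos R)) => //.
  exact/continuous_subspaceT/continuous_sin.
rewrite sin0 !subr0 => ->; rewrite normrM ler_piMl// ler_norml.
by rewrite cos_geN1 cos_le1.
Qed.

Lemma cosB1_le t : `|cos t - 1| <= `|t| /\ `|cos t - 1| <= t ^+ 2.
Proof.
wlog t0 : t / 0 <= t => [W|].
  have [/W//|/ltW t0] := leP 0 t.
  by rewrite -cosN -(normrN t) -sqrrN; apply: W; rewrite oppr_ge0.
have [|c] := @MVT_segment R (@cos R) (fun x : R => - sin x) 0 t t0 (fun c _ => is_derive_cos c).
  exact/continuous_subspaceT/continuous_cos.
rewrite in_itv/= => /andP[c0 ct]; rewrite cos0 subr0 => ->; rewrite normrM normrN.
have h := abs_sin_le c; rewrite (ger0_norm c0) in h.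
rewrite (ger0_norm t0); split.
  by rewrite ler_piMl// ler_norml sin_geN1 sin_le1.
by rewrite expr2; apply: ler_wpM2r => //; exact: le_trans ct.
Qed.

Lemma sinB_le t : `|sin t - t| <= t ^+ 2.
Proof.
wlog t0 : t / 0 <= t => [W|].
  have [/W//|/ltW t0] := leP 0 t.
  have := W (- t); rewrite oppr_ge0 sqrrN sinN => /(_ t0).
  by rewrite -normrN; congr (`|_| <= _); ring.
have [|c] := @MVT_segment R (fun x : R => sin x - x) (fun x : R => cos x - 1) 0 t t0.
  apply: continuous_subspaceT => x.
  by apply: cvgB; [exact: continuous_sin|exact: cvg_id].
rewrite in_itv/= => /andP[c0 ct]; rewrite sin0 !subr0 => ->; rewrite normrM.
have [h _] := cosB1_le c; rewrite (ger0_norm c0) in h.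
by rewrite (ger0_norm t0) expr2; apply: ler_wpM2r => //; exact: le_trans ct.
Qed.

Lemma eitB1_le t : cmod (eit t - 1) <= 2 * `|t|.
Proof.
apply: le_trans (ler_cmod_ReIm _) _; rewrite !ReImE /= oppr0 addr0.
by have [h _] := cosB1_le t; have := abs_sin_le t; lra.
Qed.

Lemma eit_quad1 t : cmod (eit t - 1 - t%:C%C * 'i%C) <= 2 * t ^+ 2.
Proof.
apply: le_trans (ler_cmod_ReIm _) _; rewrite !ReImE /=.
have [_ h] := cosB1_le t; have h2 := sinB_le t.
rewrite (_ : cos t - 1 - (t * 0 - 0 * 1) = cos t - 1); last by ring.
rewrite (_ : sin t - 0 - (t * 1 + 0 * 0) = sin t - t); last by ring.
lra.
Qed.

Lemma eit_lip s t : cmod (eit s - eit t) <= 2 * `|s - t|.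
Proof.
have -> : eit s - eit t = eit t * (eit (s - t) - 1).
  by rewrite mulrBr mulr1 -eitD; congr (eit _ - _); ring.
by rewrite cmodM cmod_eit mul1r eitB1_le.
Qed.

Lemma eit_quad s t :
  cmod (eit s - eit t - (s - t)%:C%C * ('i%C * eit t)) <= 2 * (s - t) ^+ 2.
Proof.
have -> : eit s - eit t - (s - t)%:C%C * ('i%C * eit t) =
    eit t * (eit (s - t) - 1 - (s - t)%:C%C * 'i%C).
  have -> : eit s = eit t * eit (s - t) by rewrite -eitD; congr eit; ring.
  ring.
by rewrite cmodM cmod_eit mul1r eit_quad1.
Qed.

Local Notation tau := (2 * pi : R).

Lemma tau_ge4 : 4 <= tau.
Proof. by have := @pi_ge2 R; lra. Qed.

(* The rectangle with coordinates (radius / r, angle / 2 pi) is encoded as a subset of [R[i]];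
   [polU] and [polV] are the two partial derivatives of [polE]. *)
Definition polE r z : R[i] := (r * Re z)%:C%C * eit (tau * Im z).

Definition polU r z : R[i] := r%:C%C * eit (tau * Im z).
Definition polV r z : R[i] :=
  (tau * r * Re z)%:C%C * ('i%C * eit (tau * Im z)).

Definition unit_re z := 0 <= Re z <= 1.

Lemma cmod_polE r z : 0 <= r -> unit_re z -> cmod (polE r z) = r * Re z.
Proof.
by move=> r0 /andP[z0 _]; rewrite cmodM cmod_eit mulr1 cmodR ger0_norm// mulr_ge0.
Qed.

Lemma Re_sn z : `|Re z| <= supn z.
Proof. by rewrite /supn le_max lexx. Qed.

Lemma Im_sn z : `|Im z| <= supn z.
Proof. by rewrite /supn le_max lexx orbT. Qed.

Lemma Re_snB z w : `|Re z - Re w| <= supn (z - w).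
Proof. by rewrite -cReN -cReD Re_sn. Qed.

Lemma Im_snB z w : `|Im z - Im w| <= supn (z - w).
Proof. by rewrite -cImN -cImD Im_sn. Qed.

Lemma polE_lip r x y : 0 <= r <= 1 -> unit_re y ->
  cmod (polE r x - polE r y) <= (1 + 2 * tau) * supn (x - y).
Proof.
move=> /andP[r0 r1] /andP[y0 y1].
have -> : polE r x - polE r y =
  r%:C%C * ((Re x - Re y)%:C%C * eit (tau * Im x) +
     (Re y)%:C%C * (eit (tau * Im x) - eit (tau * Im y))).
  by rewrite /polE !rmorphM rmorphB /=; ring.
rewrite cmodM cmodR (ger0_norm r0).
have h := eit_lip (tau * Im x) (tau * Im y).
have g := cmodD ((Re x - Re y)%:C%C * eit (tau * Im x))
     ((Re y)%:C%C * (eit (tau * Im x) - eit (tau * Im y))).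
rewrite !cmodM !cmodR cmod_eit mulr1 (ger0_norm y0) in g.
have i1 := Re_snB x y; have i2 := Im_snB x y.
rewrite -mulrBr normrM (ger0_norm (_ : 0 <= tau)) in h; last by have := tau_ge4; lra.
move: g h i1 i2; set X := cmod (_ + _); set Y := cmod (_ - _); set S := supn _.
set a := `|_|; set b := `|_| => g h i1 i2.
have X0 : 0 <= X by exact: cmod_ge0.
have j : tau * b <= tau * S by apply: ler_wpM2l => //; have := tau_ge4; lra.
have k : Re y * Y <= 1 * Y by apply: ler_wpM2r; rewrite ?cmod_ge0.
have l : r * X <= 1 * X by apply: ler_wpM2r.
lra.
Qed.

Lemma polE_strict r d z x y : 0 <= r <= 1 -> unit_re z -> unit_re x -> unit_re y ->
  supn (x - z) <= d -> supn (y - z) <= d ->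
  cmod (polE r x - polE r y - lin2 (polU r z) (polV r z) (x - y)) <=
  (3 * tau + 6 * tau ^+ 2) * d * supn (x - y).
Proof.
move=> /andP[r0 r1] /andP[z0 z1] /andP[x0 x1] /andP[y0 y1] xz yz.
pose s := Re x; pose t := Im x; pose s' := Re y.
pose t' := Im y; pose s0 := Re z; pose t0 := Im z.
pose e1 := eit (tau * t); pose e2 := eit (tau * t'); pose e0 := eit (tau * t0).
have tau0 : 0 <= tau by have := tau_ge4; lra.
(* Three second-order errors: the radial increment in a direction differing from that at z, the
   Taylor remainder in the angle, and the change of the angular derivative from y to z. *)
have -> : polE r x - polE r y - lin2 (polU r z) (polV r z) (x - y) =
  r%:C%C * ((s - s')%:C%C * (e1 - e0) +
   (s'%:C%C * (e1 - e2 - (tau * t - tau * t')%:C%C * ('i%C * e2)) +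
    (tau * (t - t'))%:C%C * ('i%C * ((s' - s0)%:C%C * e2 + s0%:C%C * (e2 - e0))))).
  rewrite /polE /polU /polV /lin2 cReD cImD cReN cImN.
  rewrite -/s -/t -/s' -/t' -/s0 -/t0 -/e1 -/e2 -/e0.
  rewrite !(rmorphB, rmorphM) /=; ring.
have D : 0 <= d by exact: le_trans (supn_ge0 _) xz.
have h1 := eit_lip (tau * t) (tau * t0).
have h2 := eit_lip (tau * t') (tau * t0).
have h3 := eit_quad (tau * t) (tau * t').
have st : `|s - s'| <= supn (x - y) by exact: Re_snB.
have tt : `|t - t'| <= supn (x - y) by exact: Im_snB.
have tt0 : `|t - t0| <= d by exact: le_trans (Im_snB _ _) _.
have t't0 : `|t' - t0| <= d by exact: le_trans (Im_snB _ _) _.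
have s's0 : `|s' - s0| <= d by exact: le_trans (Re_snB _ _) _.
have tt2 : `|t - t'| <= 2 * d.
  have := ler_normB (t - t0) (t' - t0).
  by rewrite (_ : t - t0 - (t' - t0) = t - t'); [lra|ring].
have S0 := supn_ge0 (x - y).
rewrite -mulrBr normrM (ger0_norm tau0) in h1.
rewrite -mulrBr normrM (ger0_norm tau0) in h2.
rewrite -mulrBr exprMn in h3.
move: st tt S0; set S := supn _ => st tt S0.
have T1 : cmod ((s - s')%:C%C * (e1 - e0)) <= S * (2 * (tau * d)).
  rewrite cmodM cmodR; apply: ler_pM => //; first exact: cmod_ge0.
  apply: le_trans h1 _; apply: ler_wpM2l => //; exact: ler_wpM2l.
have T2 : cmod (s'%:C%C * (e1 - e2 - (tau * t - tau * t')%:C%C * ('i%C * e2))) <=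
    2 * (tau ^+ 2 * (2 * d * S)).
  rewrite cmodM cmodR (ger0_norm y0) -[leRHS]mul1r; apply: ler_pM => //; first exact: cmod_ge0.
  rewrite -mulrBr; apply: le_trans h3 _; apply: ler_wpM2l => //; apply: ler_wpM2l; first exact: sqr_ge0.
  by rewrite -real_normK ?num_real// expr2; apply: ler_pM.
have T3 : cmod ((tau * (t - t'))%:C%C * ('i%C * ((s' - s0)%:C%C * e2 + s0%:C%C * (e2 - e0)))) <=
    tau * S * (d + 2 * (tau * d)).
  rewrite cmodM cmodR normrM (ger0_norm tau0); apply: ler_pM => //.
  - by rewrite mulr_ge0.
  - exact: cmod_ge0.
  - exact: ler_wpM2l.
  rewrite cmodM (_ : cmod 'i%C = 1) ?mul1r; last by rewrite /= expr0n expr1n add0r sqrtr1.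
  apply: le_trans (cmodD _ _) _; rewrite !cmodM !cmodR cmod_eit mulr1 (ger0_norm z0).
  apply: lerD => //; rewrite -[leRHS]mul1r; apply: ler_pM => //; first exact: cmod_ge0.
  apply: le_trans h2 _; apply: ler_wpM2l => //; exact: ler_wpM2l.
rewrite cmodM cmodR (ger0_norm r0).
move: T1 T2 T3; set a1 := _ * (e1 - e0); set a2 := _ * (e1 - e2 - _); set a3 := _ * ('i%C * _).
move=> T1 T2 T3.
have g1 := cmodD a1 (a2 + a3); have g2 := cmodD a2 a3.
have X0 := cmod_ge0 (a1 + (a2 + a3)).
move: T1 T2 T3 g1 g2 X0; move: (cmod a1) (cmod a2) (cmod a3) (cmod (a2 + a3)) (cmod (a1 + _)).
move=> b1 b2 b3 b4 X T1 T2 T3 g1 g2 X0.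
have l : r * X <= 1 * X by apply: ler_wpM2r.
lra.
Qed.

End Polar.

(** * The harmonic mapping in polar coordinates, on one cell *)

Section PolarHarmonic.
Variable R : realType.
Variable alpha : R.
Hypothesis alpha_ge0 : 0 <= alpha.
Variables A B : nat -> R[i].
Hypothesis hAB : hpair alpha A B.
Local Notation f := (harm (psum A) (psum B)).
Let tA := tameA hAB.
Let tB := tameB hAB.
Implicit Types (z w x y : R[i]) (d delta : R).
Local Notation tau := (2 * pi : R).

Variable r : R.
Hypothesis r01 : 0 < r < 1.

Definition polPhi z := f (polE r z).

Definition phiU z := rlin (psum (dps A) (polE r z)) (psum (dps B) (polE r z)) (polU r z).
Definition phiV z := rlin (psum (dps A) (polE r z)) (psum (dps B) (polE r z)) (polV r z).

Let r0 : 0 < r. Proof. by case/andP: r01. Qed.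
Let r1 : r < 1. Proof. by case/andP: r01. Qed.

Lemma polE_in z : unit_re z -> cmod (polE r z) <= r.
Proof.
move=> uz; rewrite cmod_polE ?(ltW r0)//; case/andP: uz => z0 z1.
by rewrite ler_piMr// ltW.
Qed.

(** One constant serves all cells, so the relative error becomes small as the mesh d tends to 0. *)
Lemma polPhi_strict : exists2 C, 0 <= C & forall d z x y,
  unit_re z -> unit_re x -> unit_re y -> supn (x - z) <= d -> supn (y - z) <= d ->
  cmod (polPhi x - polPhi y - lin2 (phiU z) (phiV z) (x - y)) <= C * d * supn (x - y).
Proof.
have [K K0 hK] := harm_strict tA tB r01.
have r0' : 0 <= r < 1 by rewrite (ltW r0).
have [M M0 hM] := psum_dps_bound r0' tA; have [N N0 hN] := psum_dps_bound r0' tB.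
pose a := 1 + 2 * tau; pose b := 3 * tau + 6 * tau ^+ 2.
have t4 := tau_ge4 R.
have a0 : 0 <= a by rewrite /a; lra.
have b0 : 0 <= b by rewrite /b addr_ge0 ?mulr_ge0 ?sqr_ge0//; lra.
exists (K * (3 * a) * a + (M + N) * b) => [|d z x y uz ux uy xz yz].
  by rewrite addr_ge0// ?mulr_ge0// addr_ge0.
have rr : 0 <= r <= 1 by rewrite !ltW.
have S0 := supn_ge0 (x - y); have d0 := le_trans (supn_ge0 _) xz.
have h1 := hK _ _ _ (polE_in uz) (polE_in uy) (polE_in ux).
have h2 := polE_strict rr uz ux uy xz yz.
have l1 := polE_lip x rr uy; have l2 := polE_lip y rr uz.
have hp := hM _ (polE_in uz); have hq := hN _ (polE_in uz).
rewrite /phiU /phiV lin2_RL /polPhi.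
move: (psum (dps A) (polE r z)) (psum (dps B) (polE r z)) hp hq h1 => p q hp hq h1.
pose l := lin2 (polU r z) (polV r z) (x - y).
have -> : f (polE r x) - f (polE r y) - rlin p q (lin2 (polU r z) (polV r z) (x - y)) =
  (f (polE r x) - f (polE r y) - rlin p q (polE r x - polE r y)) +
  rlin p q (polE r x - polE r y - l).
  have -> : polE r x - polE r y = (polE r x - polE r y - l) + l by rewrite subrK.
  rewrite addrK rlinD -/l; move: (f _) (f _) (rlin _ _ _) (rlin _ _ _) => F G U V.
  by rewrite [- (U + V)]opprD [- U - V]addrC addrA subrK.
apply: le_trans (cmodD _ _) _; have h3 := rlin_ub p q (polE r x - polE r y - l).
have sxy : supn (x - y) <= 2 * d.
  have := supnD (x - z) (z - y); rewrite (supnC z y) (_ : x - z + (z - y) = x - y); last by ring.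
  by lra.
move: h1 h2 h3 l1 l2 (cmod_ge0 (polE r x - polE r y - l)); rewrite -/l.
move: (cmod (f _ - _ - _)) (cmod (rlin _ _ _)) (cmod (polE r x - polE r y - l)).
move: (cmod (polE r x - polE r y)) (cmod (polE r y - polE r z)) (cmod_ge0 (polE r x - polE r y))
  (cmod_ge0 (polE r y - polE r z)).
rewrite -/a -/b; move: (cmod p) (cmod q) hp hq (cmod_ge0 p) (cmod_ge0 q) => P Q hp hq P0 Q0.
move: sxy S0 yz; move: (supn (x - y)) (supn (y - z)) => S S' sxy S0 yz.
move=> X Y X0 Y0 T1 T2 T3 h1 h2 h3 l1 l2 T30.
have Y1 : Y <= a * d by apply: le_trans l2 _; exact: ler_wpM2l.
have X1 : X <= a * (2 * d) by apply: le_trans l1 _; exact: ler_wpM2l.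
have g1 : T1 <= K * (3 * a * d) * (a * S).
  apply: le_trans h1 _; apply: ler_pM => //.
    by rewrite mulr_ge0// addr_ge0.
  by apply: ler_wpM2l => //; lra.
have g2 : T2 <= (M + N) * (b * d * S).
  by apply: le_trans h3 _; apply: ler_pM => //; [rewrite addr_ge0|exact: lerD].
lra.
Qed.

Definition mu : R := (1 - r) / (1 + r).

Lemma mu_gt0 : 0 < mu.
Proof. by apply: ratio_gt0; rewrite (ltW r0). Qed.

Lemma lin2_pol z x : lin2 (polU r z) (polV r z) x =
  r%:C%C * eit (tau * Im z) * (Re x +i* (tau * Re z * Im x))%C.
Proof.
by apply: complexP; rewrite /lin2 /polU /polV /eit !ReImE /=; ring.
Qed.

(** Polar coordinates degenerate at the origin, hence the factor delta; the grid therefore leaves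
    out a central disk of relative radius delta. *)
Lemma phi_lb delta z x : unit_re z -> 0 <= delta -> delta <= Re z ->
  mu * r * delta * supn x <= cmod (lin2 (phiU z) (phiV z) x).
Proof.
move=> uz d0 dz; rewrite /phiU /phiV lin2_RL.
apply: le_trans (rlin_lb _ _ _).
have h := jac_ge_uniform alpha_ge0 hAB r1 (polE_in uz).
have m0 := mu_gt0; rewrite -/mu in h; move: (mu) m0 h => nu m0 h.
apply: (@le_trans _ _ (nu * cmod (lin2 (polU r z) (polV r z) x))); last first.
  by apply: ler_wpM2r => //; exact: cmod_ge0.
rewrite -!mulrA; apply: ler_wpM2l; first exact: ltW.
rewrite lin2_pol !cmodM cmod_eit mulr1 cmodR (gtr0_norm r0).
apply: ler_wpM2l; first exact: ltW.
apply: le_trans (supn_cmod _); case/andP: uz => z0 z1; have t4 := tau_ge4 R.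
have tz : delta <= tau * Re z.
  by apply: le_trans dz _; rewrite ler_peMl//; lra.
rewrite /supn /= le_max; case: (leP `|Re x| `|Im x|) => h2.
  apply/orP; right; rewrite normrM ler_wpM2r//.
  by apply: le_trans tz _; exact: ler_norm.
by apply/orP; left; rewrite ler_piMl// (le_trans dz).
Qed.

Lemma cdet_phi z : cdet (phiU z) (phiV z) =
  (cmod (psum (dps A) (polE r z)) ^+ 2 - cmod (psum (dps B) (polE r z)) ^+ 2) *
   (tau * r ^+ 2 * Re z).
Proof.
rewrite /phiU /phiV cdet_RL; congr (_ * _).
have := cos2Dsin2 (tau * Im z).
rewrite /cdet /polU /polV /eit !ReImE /=.
set c := cos _; set s := sin _ => h.
transitivity (tau * r ^+ 2 * Re z * (c ^+ 2 + s ^+ 2)); last by rewrite h mulr1.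
ring.
Qed.

Lemma cdet_phi_gt0 z : unit_re z -> 0 < Re z -> 0 < cdet (phiU z) (phiV z).
Proof.
move=> uz z0; rewrite cdet_phi; apply: mulr_gt0.
  by apply: (jac_det_gt0 alpha_ge0 hAB); exact: le_lt_trans (polE_in uz) r1.
by have t4 := tau_ge4 R; rewrite !mulr_gt0// ?exprn_gt0//; lra.
Qed.

(** Injectivity of f leaves only the ambiguity of the angle, an integer number of turns, which the
    bound on the imaginary parts excludes. *)
Lemma polPhi_inj x y : unit_re x -> unit_re y -> 0 < Re x ->
  `|Im x - Im y| < 1 -> polPhi x = polPhi y -> x = y.
Proof.
move=> ux uy x0 xy h.
have E := harm_inj alpha_ge0 hAB (le_lt_trans (polE_in ux) r1) (le_lt_trans (polE_in uy) r1) h.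
have rr : Re x = Re y.
  have := congr1 (@ComplexField.Normc.normc R) E; rewrite !cmod_polE ?(ltW r0)// => /mulfI; apply.
  by rewrite gt_eqF.
apply: complexP; first exact: rr.
have e1 : eit (tau * Im x) = eit (tau * Im y).
  apply: (mulfI (_ : (r * Re x)%:C%C != 0)).
    apply/eqP => /(congr1 (@Re R)); rewrite [in RHS]/= => e0.
    by have := mulr_gt0 r0 x0; rewrite [X in _ < X]e0 ltxx.
  by move: E; rewrite /polE rr.
have P a b : eit (tau * a) = eit (tau * b) -> 0 < a - b -> a - b < 1 -> False.
  move=> ab ab0 ab1; have t4 := tau_ge4 R.
  have : eit (tau * (a - b)) != 1.
    have tau0 : 0 < tau by lra.
    by apply: eit_neq1; rewrite (mulr_gt0 tau0 ab0) gtr_pMr.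
  rewrite mulrBr eitD ab -eitD subrr eit0 eqxx//.
move: xy; rewrite ltr_norml => /andP[h1 h2].
case: (ltgtP (Im x) (Im y)) => [d|d|d]; last exact: d.
  by exfalso; apply: (P _ _ (esym e1)); lra.
by exfalso; apply: (P _ _ e1); lra.
Qed.

Section Cell.
Variables (C delta eta e d : R) (c z : R[i]).
Hypothesis hC : forall d z x y,
  unit_re z -> unit_re x -> unit_re y -> supn (x - z) <= d -> supn (y - z) <= d ->
  cmod (polPhi x - polPhi y - lin2 (phiU z) (phiV z) (x - y)) <= C * d * supn (x - y).
Hypothesis delta0 : 0 < delta.
Hypothesis dz : delta <= Re z.
Hypothesis uz : unit_re z.
Hypothesis eta01 : 0 <= eta < 1.
Hypothesis etaC : C * d <= eta * (mu * r * delta).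
Hypothesis ball : forall x, supn (x - c) <= e -> unit_re x /\ supn (x - z) <= d.

Let D0 : cdet (phiU z) (phiV z) != 0.
Proof. by rewrite gt_eqF// cdet_phi_gt0//; exact: lt_le_trans dz. Qed.

Let m0 : 0 < mu * r * delta.
Proof. by apply: mulr_gt0 => //; apply: mulr_gt0 => //; exact: mu_gt0. Qed.

Let Lm x : mu * r * delta * supn x <= cmod (lin2 (phiU z) (phiV z) x).
Proof. by apply: phi_lb => //; exact: ltW. Qed.

Let hPhi x y : supn (x - c) <= e -> supn (y - c) <= e ->
  cmod (polPhi x - polPhi y - lin2 (phiU z) (phiV z) (x - y)) <=
  eta * (mu * r * delta) * supn (x - y).
Proof.
move=> /ball [ux xz] /ball [uy yz]; apply: le_trans (hC uz ux uy xz yz) _.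
by apply: ler_wpM2r => //; exact: supn_ge0.
Qed.

(** The square is centred at c while the differential is taken at another point z: in the grid z is
    a corner lying on a circle of nodes, where Parseval's identity is available. *)
Lemma cell_out x p : supn (x - c) <= e -> polPhi x = (p.1 +i* p.2)%C ->
  para (polPhi c) (phiU z) (phiV z) ((1 + eta) * e) p.
Proof. by move=> xc xp; rewrite /para /= -xp; exact: (cover_out D0 m0 Lm eta01 hPhi). Qed.

Lemma cell_in p : para (polPhi c) (phiU z) (phiV z) ((1 - eta) * e) p ->
  exists2 x, supn (x - c) <= e & polPhi x = (p.1 +i* p.2)%C.
Proof. exact: (cover_in D0 m0 Lm eta01 hPhi). Qed.

End Cell.

End PolarHarmonic.

(** * Parseval sums on circles and Riemann sums in the radius *)

Section GridSums.
Variable R : realType.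
Implicit Types (A : nat -> R[i]) (r s e a b : R).

(** Parseval's identity is exact for the polynomial truncated at the number n of nodes; the tail
    bound makes the error uniform in rho. *)
Lemma parseval_row A r e : tame A -> 0 <= r < 1 -> 0 < e ->
  exists M0, forall n, (M0 <= n)%N -> forall rho, 0 <= rho <= r ->
   `|\sum_(k < n) cmod (psum A (rho%:C%C * root1 R n ^+ k)) ^+ 2 -
      n%:R * \sum_(m < n) cmod (A m) ^+ 2 * rho ^+ (2 * m)| <= n%:R * e.
Proof.
move=> tA r01 e0; have [r0 r1] := andP r01.
have [K K0 hK] := psum_bound r01 tA.
have K1 : 0 < 2 * K + 1 by lra.
(* With P the series, Q its truncation and |P - Q| <= d <= 1, the squares differ by at most d (|P| +
   |Q|) <= d (2K + 1). *)
pose d := Num.min 1 (e / (2 * K + 1)).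
have d0 : 0 < d by rewrite lt_min ltr01 divr_gt0.
have d1 : d <= 1 by rewrite ge_min lexx.
have de : d * (2 * K + 1) <= e by rewrite -ler_pdivlMr// ge_min lexx orbT.
have [M0 tail] := psum_tail r01 tA d0.
exists M0 => n Mn rho /andP[rho0 rhor].
have E : n%:R * \sum_(m < n) cmod (A m) ^+ 2 * rho ^+ (2 * m) =
   \sum_(k < n) cmod (\sum_(m < n) A m * (rho%:C%C * root1 R n ^+ k) ^+ m) ^+ 2.
  have -> : \sum_(m < n) cmod (A m) ^+ 2 * rho ^+ (2 * m) =
      \sum_(m < n) cmod (A m * rho%:C%C ^+ m) ^+ 2.
    apply: eq_bigr => m _; rewrite cmodM cmodX cmodR ger0_norm// exprMn.
    by rewrite -exprM mulnC.
  rewrite -(parseval n (fun m => A m * rho%:C%C ^+ m)); apply: eq_bigr => k _.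
  by congr (cmod _ ^+ 2); apply: eq_bigr => m _; rewrite exprMn mulrA.
rewrite E -sumrB; apply: le_trans (ler_norm_sum _ _ _) _.
rewrite mulr_natl -[X in _ *+ X]card_ord -sumr_const; apply: ler_sum => k _.
have zr : cmod (rho%:C%C * root1 R n ^+ k) <= r.
  by rewrite cmodM cmodX cmod_rt expr1n mulr1 cmodR ger0_norm.
have h := tail _ Mn _ zr; have hk := hK _ zr.
move: h hk; set P := psum _ _; set Q := \sum_(_ < _) _ => h hk.
have h1 := cmodD (P - Q) Q; rewrite subrK in h1.
have h2 := cmodB P (P - Q); rewrite opprB addrC subrK in h2.
have p0 := cmod_ge0 P; have q0 := cmod_ge0 Q.
have -> : cmod P ^+ 2 - cmod Q ^+ 2 = (cmod P - cmod Q) * (cmod P + cmod Q) by ring.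
rewrite normrM (ger0_norm (addr_ge0 p0 q0)).
apply: le_trans de; apply: ler_pM => //; first by rewrite addr_ge0.
  by rewrite ler_norml; apply/andP; split; lra.
lra.
Qed.

Lemma pow_telescope_le a b k : 0 <= a -> a <= b ->
  (b - a) * a ^+ k * k.+1%:R <= b ^+ k.+1 - a ^+ k.+1.
Proof.
move=> a0 ab; rewrite subrXX -mulrA; apply: ler_wpM2l; first by rewrite subr_ge0.
rewrite mulr_natr -[X in _ *+ X]card_ord -sumr_const; apply: ler_sum => i _ /=.
rewrite -{1}(subnK (_ : i <= k)%N) ?exprD; last by rewrite -ltnS.
by apply: ler_pM; rewrite ?exprn_ge0//; apply: lerXn2r; rewrite ?nnegrE// (le_trans a0).
Qed.

Lemma pow_telescope_ge a b k : 0 <= a -> a <= b ->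
  b ^+ k.+1 - a ^+ k.+1 <= (b - a) * b ^+ k * k.+1%:R.
Proof.
move=> a0 ab; rewrite subrXX -mulrA; apply: ler_wpM2l; first by rewrite subr_ge0.
rewrite mulr_natr -[X in _ *+ X]card_ord -sumr_const; apply: ler_sum => i _ /=.
rewrite -[X in _ <= _ ^+ X](subnK (_ : i <= k)%N) ?exprD; last by rewrite -ltnS.
have b0 : 0 <= b by exact: le_trans ab.
by apply: ler_pM; rewrite ?exprn_ge0//; apply: lerXn2r; rewrite ?nnegrE.
Qed.

Section Rows.
Variables (g : nat -> R) (r : R) (N n n' : nat).
Hypothesis g0 : forall m, 0 <= g m.
Hypothesis r0 : 0 <= r.
Hypothesis n0 : (0 < n)%N.
Hypothesis n'n : (n' <= n)%N.
Let s j : R := j%:R / n%:R.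

Let nR : 0 < n%:R :> R. Proof. by rewrite ltr0n. Qed.
Let s0 j : 0 <= s j. Proof. by rewrite divr_ge0. Qed.
Let sS j : s j.+1 - s j = n%:R^-1.
Proof. by rewrite /s -mulrBl -natr1 addrAC subrr add0r mul1r. Qed.
Let sle j : s j <= s j.+1. Proof. by rewrite -subr_ge0 sS invr_ge0 ltW. Qed.

(** A left Riemann sum of an increasing function, below its integral: s (r s)^(2m) has integral
    r^(2m) / (2m + 2) over [0, 1]. Each term is compared with an exact telescoping difference of
    powers. *)
Lemma rows_le : \sum_(n' <= j < n) n%:R^-1 * s j * \sum_(m < N) g m * (r * s j) ^+ (2 * m) <=
  \sum_(m < N) g m * r ^+ (2 * m) / (2 * m.+1)%:R.
Proof.
under eq_bigr do rewrite mulr_sumr.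
rewrite exchange_big; apply: ler_sum => m _ /=.
apply: (@le_trans _ _ (\sum_(n' <= j < n) g m * r ^+ (2 * m) / (2 * m.+1)%:R *
    (s j.+1 ^+ (2 * m).+2 - s j ^+ (2 * m).+2))).
  apply: ler_sum => j _.
  have -> : n%:R^-1 * s j * (g m * (r * s j) ^+ (2 * m)) =
    g m * r ^+ (2 * m) / (2 * m.+1)%:R * ((s j.+1 - s j) * s j ^+ (2 * m).+1 * (2 * m).+2%:R).
    rewrite sS exprMn exprS (_ : (2 * m.+1 = (2 * m).+2)%N); last by rewrite mulnS.
    by move: (s j ^+ _) (r ^+ _) => X Y; field; rewrite gt_eqF//= pnatr_eq0.
  apply: ler_wpM2l; last exact: pow_telescope_le.
  by rewrite divr_ge0// mulr_ge0// exprn_ge0.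
rewrite -mulr_sumr telescope_sumr//.
rewrite -[leRHS]mulr1; apply: ler_wpM2l; first by rewrite divr_ge0// mulr_ge0// exprn_ge0.
by rewrite {1}/s divff ?gt_eqF// expr1n lerBlDr lerDl exprn_ge0.
Qed.

(** The right Riemann sum; the missing inner rings cost a proportion s_(n')^(2m+2) <= s_(n')^2 of
    each term. *)
Lemma rows_ge : (1 - s n' ^+ 2) * \sum_(m < N) g m * r ^+ (2 * m) / (2 * m.+1)%:R <=
  \sum_(n' <= j < n) n%:R^-1 * s j.+1 * \sum_(m < N) g m * (r * s j.+1) ^+ (2 * m).
Proof.
under [leRHS]eq_bigr do rewrite mulr_sumr.
rewrite exchange_big mulr_sumr; apply: ler_sum => m _ /=.
apply: (@le_trans _ _ (\sum_(n' <= j < n) g m * r ^+ (2 * m) / (2 * m.+1)%:R *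
    (s j.+1 ^+ (2 * m).+2 - s j ^+ (2 * m).+2))); last first.
  apply: ler_sum => j _.
  have -> : n%:R^-1 * s j.+1 * (g m * (r * s j.+1) ^+ (2 * m)) =
    g m * r ^+ (2 * m) / (2 * m.+1)%:R * ((s j.+1 - s j) * s j.+1 ^+ (2 * m).+1 * (2 * m).+2%:R).
    rewrite sS exprMn exprS (_ : (2 * m.+1 = (2 * m).+2)%N); last by rewrite mulnS.
    by move: (s j.+1 ^+ _) (r ^+ _) => X Y; field; rewrite gt_eqF//= pnatr_eq0.
  apply: ler_wpM2l; last exact: pow_telescope_ge.
  by rewrite divr_ge0// mulr_ge0// exprn_ge0.
rewrite -mulr_sumr telescope_sumr// mulrC.
apply: ler_wpM2l; first by rewrite divr_ge0// mulr_ge0// exprn_ge0.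
rewrite {2}/s divff ?gt_eqF// expr1n lerD2l lerN2.
apply: ler_wiXn2l => //; by rewrite ler_pdivrMr// mul1r ler_nat.
Qed.

End Rows.

End GridSums.

(** * Measures of finite unions *)

Section FiniteUnions.
Local Open Scope ereal_scope.
Context d (T : measurableType d) (R : realType) (mu : {measure set T -> \bar R}).

Lemma measure_bigsetU_le (I : Type) (s : seq I) (F : I -> set T) :
  (forall i, measurable (F i)) ->
  mu (\big[setU/set0]_(i <- s) F i) <= \sum_(i <- s) mu (F i).
Proof.
move=> mF; elim: s => [|i s IH]; first by rewrite !big_nil measure0.
rewrite !big_cons; apply: (@le_trans _ _ (mu (F i) + mu (\big[setU/set0]_(i <- s) F i))).
  by apply: measureU2 => //; exact: bigsetU_measurable.
exact: leeD2l.
Qed.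

Lemma measure_bigsetU_disj (I : choiceType) (s : seq I) (F : I -> set T) : uniq s ->
  (forall i, measurable (F i)) ->
  (forall i j p, i \in s -> j \in s -> F i p -> F j p -> i = j) ->
  mu (\big[setU/set0]_(i <- s) F i) = \sum_(i <- s) mu (F i).
Proof.
move=> us mF; elim: s us => [|i s IH] /=; first by rewrite !big_nil measure0.
move=> /andP[is_ us] D; rewrite !big_cons.
transitivity (mu (F i) + mu (\big[setU/set0]_(i <- s) F i)); last first.
  by rewrite IH// => k l p ks ls; apply: D; rewrite inE ?ks ?ls orbT.
apply: measureU => //; first exact: bigsetU_measurable.
apply/seteqP; split=> // p [Fi]; rewrite -classical_sets.bigcup_seq => -[j /= js Fj].
by move: is_; rewrite (D i j p) ?inE ?eqxx ?js ?orbT.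
Qed.

End FiniteUnions.

(** * Measurability of plane open sets, and the argument of a unimodular number *)

Section PlaneOpen.
Variable R : realType.
Local Notation RM := (measurableTypeR R).

Lemma measurable_plane_open (O : set (RM * RM)) :
  (forall p, O p -> exists2 e : R, 0 < e & forall q, box p e e q -> O q) ->
  measurable O.
Proof.
move=> openO.
(* Rational boxes not contained in O are replaced by the empty set, so that the union runs over all
   countably many indices. *)
pose F (a b : rat) (n : nat) : set (RM * RM) :=
  if `[< box (ratr a, ratr b) n.+1%:R^-1 n.+1%:R^-1 `<=` O >]
  then box (ratr a, ratr b) n.+1%:R^-1 n.+1%:R^-1 else set0.
have -> : O = \bigcup_(a : rat) \bigcup_(b : rat) \bigcup_n F a b n.
  apply/seteqP; split=> [p Op|p [a _ [b _ [n _]]]]; last first.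
    by rewrite /F; case: asboolP => // h; exact: h.
  have [e e0 he] := openO p Op.
  pose n := Num.trunc (2 / e); pose h : R := n.+1%:R^-1.
  have h0 : 0 < h by rewrite invr_gt0 ltr0n.
  have h2 : 2 * h <= e.
    rewrite /h ler_pdivrMr ?ltr0n// mulrC -ler_pdivrMr//; exact/ltW/truncnS_gt.
  have [a] := @rat_in_itvoo R (p.1 - h) (p.1 + h) ltac:(lra).
  have [b] := @rat_in_itvoo R (p.2 - h) (p.2 + h) ltac:(lra).
  rewrite !in_itv/= => /andP[b1 b2] /andP[a1 a2].
  exists a => //; exists b => //; exists n => //; rewrite /F -/h.
  case: asboolP => [_|].
    by rewrite box_abs/= !ler_norml; split; apply/andP; split; lra.
  case=> q; rewrite box_abs /= !ler_norml => -[/andP[q1 q2] /andP[q3 q4]].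
  by apply: he; rewrite box_abs !ler_norml; split; apply/andP; split; lra.
apply: bigcupT_measurable_rat => a; apply: bigcupT_measurable_rat => b.
apply: bigcupT_measurable => n; rewrite /F; case: ifP => _ //.
exact: measurable_box.
Qed.

Lemma angle (u : R[i]) : cmod u = 1 -> exists2 t : R, 0 <= t < 1 & u = eit (2 * pi * t).
Proof.
case: u => a b u1; have h : a ^+ 2 + b ^+ 2 = 1.
  by have := cmod_sqr (a +i* b)%C; rewrite u1 expr1n /= => ->.
have a1 : -1 <= a <= 1 by have := ler_Re_cmod (a +i* b)%C; rewrite u1 ler_norml.
pose th := acos a.
have hca : cos th = a by apply: acosK; rewrite in_itv.
have th0 : 0 <= th by exact: acos_ge0.
have thp : th <= pi by exact: acos_lepi.
have s0 : 0 <= sin th by apply: sin_ge0_pi; rewrite th0.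
have p0 := @pi_gt0 R; have p2 : 0 < 2 * pi :> R by lra.
have tq : th / (2 * pi) <= 1 / 2 by rewrite ler_pdivrMr//; lra.
have tq0 : 0 <= th / (2 * pi) by rewrite divr_ge0// ltW.
have sb : (b == sin th) || (b == - sin th).
  by rewrite -eqf_sqr sin2cos2 hca -h addrAC subrr add0r.
have [b0|b0] := leP 0 b.
  have hbs : b = sin th by case/orP: sb => /eqP e; lra.
  exists (th / (2 * pi)).
    by apply/andP; split; lra.
  have -> : 2 * pi * (th / (2 * pi)) = th by rewrite mulrC divfK// gt_eqF.
  by rewrite /eit hca hbs.
have hbs : - b = sin th by case/orP: sb => /eqP e; lra.
have th1 : 0 < th.
  by rewrite lt_neqAle th0 andbT; apply/eqP => e; rewrite -e sin0 in hbs; lra.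
exists (1 - th / (2 * pi)).
  have : 0 < th / (2 * pi) by rewrite divr_gt0.
  by move=> *; apply/andP; split; lra.
have -> : 2 * pi * (1 - th / (2 * pi)) = 2 * pi + - th.
  by rewrite mulrBr mulr1 (mulrC _ (th / _)) divfK// gt_eqF.
by rewrite eitD eit_2pi mul1r /eit cosN sinN hca -hbs opprK.
Qed.

End PlaneOpen.

(** * Area estimates on a polar grid *)

Section AreaGrid.
Variable R : realType.
Variable alpha : R.
Hypothesis alpha_ge0 : 0 <= alpha.
Variables A B : nat -> R[i].
Hypothesis hAB : hpair alpha A B.
Local Notation f := (harm (psum A) (psum B)).
Local Notation tau := (2 * pi : R).
Local Notation RM := (measurableTypeR R).
Local Notation lam2 := (@lebesgue_measure R \x @lebesgue_measure R)%E.
Variable r : R.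
Hypothesis r01 : 0 < r < 1.
Local Notation Phi := (polPhi A B r).
Local Notation phiU := (phiU A B r).
Local Notation phiV := (phiV A B r).
Local Notation mu := (mu r).

Let r0 : 0 < r. Proof. by case/andP: r01. Qed.
Let r1 : r < 1. Proof. by case/andP: r01. Qed.

Definition image_disk : set (RM * RM) := [set p | (f @` disk r) (p.1 +i* p.2)%C].

Lemma measurable_image_disk : measurable image_disk.
Proof.
apply: measurable_plane_open => p [z zr fz]; rewrite /disk/= in zr.
have z01 : 0 <= cmod z < 1 by rewrite cmod_ge0 (lt_trans zr).
have tau0 : 0 < (r - cmod z) / 2 by lra.
have [e e0 he] := harm_open alpha_ge0 hAB z01 tau0.
exists (e / 2); first by rewrite divr_gt0.
move=> q; rewrite box_abs => -[q1 q2].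
have [|z' [z'z z'1 fz']] := he z (q.1 +i* q.2)%C (lexx _).
  by rewrite fz; apply: le_trans (ler_cmod_ReIm _) _; rewrite !ReImE /=; lra.
exists z' => //; rewrite /disk/=.
by have := cmodD (z' - z) z; rewrite subrK; lra.
Qed.

Lemma disk_polar z : cmod z < r -> exists x,
  [/\ 0 <= Re x < 1, 0 <= Im x < 1 & z = polE r x].
Proof.
move=> zr; have [u u1 zu] := polar z; have [t t01 ut] := angle u1.
exists (cmod z / r +i* t)%C; split => //=.
  by rewrite divr_ge0 ?cmod_ge0 ?(ltW r0)//= ltr_pdivrMr// mul1r.
have rE : r * (cmod z / r) = cmod z by rewrite mulrC divfK// gt_eqF.
by rewrite /polE /= rE -ut.
Qed.

Variables (n n' : nat) (C delta eta eps : R) (g : nat -> R).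
Hypothesis n0 : (0 < n)%N.
Hypothesis n'n : (n' <= n)%N.
Hypothesis deltaE : delta = n'%:R / n%:R.
Hypothesis delta0 : 0 < delta.
Hypothesis eta01 : 0 < eta < 1.
Hypothesis hC : forall d z x y,
  unit_re z -> unit_re x -> unit_re y -> supn (x - z) <= d -> supn (y - z) <= d ->
  cmod (Phi x - Phi y - lin2 (phiU z) (phiV z) (x - y)) <= C * d * supn (x - y).
Hypothesis etaC : C * n%:R^-1 <= eta * (mu * r * delta).
Hypothesis g0 : forall m, 0 <= g m.
Hypothesis eps0 : 0 <= eps.

Let h : R := n%:R^-1.
Let nR : 0 < n%:R :> R. Proof. by rewrite ltr0n. Qed.
Let h0 : 0 < h. Proof. by rewrite invr_gt0. Qed.
Let nh : n%:R * h = 1. Proof. by rewrite divff// gt_eqF. Qed.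
Let eta0 : 0 <= eta. Proof. by case/andP: eta01 => /ltW. Qed.
Let eta1 : eta < 1. Proof. by case/andP: eta01. Qed.

(** Centres and corners of the cells of side 1 / n. The upper estimate linearises at [crn j k] and
    the lower one at [crn j.+1 k], matching the left and right sums of [rows_le] and [rows_ge]. *)
Definition ctr (j k : nat) : R[i] := ((j%:R + 1 / 2) * h +i* ((k%:R + 1 / 2) * h))%C.
Definition crn (j k : nat) : R[i] := (j%:R * h +i* (k%:R * h))%C.

Lemma supn_ctr x j k e : supn (x - ctr j k) <= e ->
  `|Re x - (j%:R + 1 / 2) * h| <= e /\ `|Im x - (k%:R + 1 / 2) * h| <= e.
Proof. by rewrite supn_le !ReImE /= => /andP. Qed.

Let jh j : (j < n)%N -> j%:R * h + h <= 1.
Proof.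
move=> jn; have -> : j%:R * h + h = j.+1%:R * h by rewrite -natr1; ring.
by rewrite -[leRHS]nh ler_pM2r// ler_nat.
Qed.

Let jh0 (j : nat) : 0 <= j%:R * h.
Proof. by rewrite mulr_ge0// ltW. Qed.

Lemma ctr_ball_left x j k : (j < n)%N -> supn (x - ctr j k) <= h / 2 ->
  unit_re x /\ supn (x - crn j k) <= h.
Proof.
move=> jn /supn_ctr; rewrite !ler_norml => -[/andP[x1 x2] /andP[x3 x4]].
have := jh jn; have := jh0 j => j0 j1.
split; first by apply/andP; split; lra.
by rewrite supn_le !ReImE /= !ler_norml; do 2 (apply/andP; split); lra.
Qed.

Lemma ctr_ball_right x j k e : (j < n)%N -> e <= h / 2 -> supn (x - ctr j k) <= e ->
  unit_re x /\ supn (x - crn j.+1 k) <= h.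
Proof.
move=> jn eh /supn_ctr; rewrite !ler_norml => -[/andP[x1 x2] /andP[x3 x4]].
have := jh jn; have := jh0 j => j0 j1.
split; first by apply/andP; split; lra.
by rewrite supn_le !ReImE /= -natr1 !ler_norml; do 2 (apply/andP; split); lra.
Qed.

Lemma crn_unit j k : (j <= n)%N -> unit_re (crn j k).
Proof.
by move=> jn; rewrite /unit_re /= jh0 /= -[leRHS]nh ler_pM2r// ler_nat.
Qed.

Lemma polE_crn j k : polE r (crn j k) = (r * (j%:R * h))%:C%C * root1 R n ^+ k.
Proof. by rewrite root1X /polE /=; congr (_ * eit _); rewrite /h mulrA. Qed.

Lemma cdet_crn j k : cdet (phiU (crn j k)) (phiV (crn j k)) =
  (cmod (psum (dps A) ((r * (j%:R * h))%:C%C * root1 R n ^+ k)) ^+ 2 -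
   cmod (psum (dps B) ((r * (j%:R * h))%:C%C * root1 R n ^+ k)) ^+ 2) *
   (tau * r ^+ 2 * (j%:R * h)).
Proof. by rewrite cdet_phi polE_crn. Qed.

Definition pairs := [seq (j, k) | j <- index_iota n' n, k <- index_iota 0 n].

Lemma pairsP jk : jk \in pairs -> [/\ (n' <= jk.1)%N, (jk.1 < n)%N & (jk.2 < n)%N].
Proof.
by case/allpairsP => -[a b] /= []; rewrite !mem_index_iota => /andP[? ?] /andP[_ ?] ->.
Qed.

Lemma in_pairs j k : (n' <= j)%N -> (j < n)%N -> (k < n)%N -> (j, k) \in pairs.
Proof.
by move=> nj jn kn; apply/allpairsP; exists (j, k); rewrite !mem_index_iota nj jn kn.
Qed.

Lemma uniq_pairs : uniq pairs.
Proof. by apply: allpairs_uniq; rewrite ?iota_uniq// => -[a b] [c d]. Qed.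

Lemma sum_pairs (F : nat -> nat -> R) : \sum_(i <- pairs) F i.1 i.2 =
  \sum_(n' <= j < n) \sum_(k < n) F j k.
Proof. by rewrite big_allpairs; apply: eq_bigr => j _; rewrite big_mkord. Qed.

Lemma delta_le j : (n' <= j)%N -> delta <= j%:R * h.
Proof. by move=> nj; rewrite deltaE ler_pM2r// ler_nat. Qed.

Lemma sum_h_le (a : nat -> R) : (forall j, (j < n)%N -> 0 <= a j <= 1) ->
  0 <= \sum_(n' <= j < n) h * a j <= 1.
Proof.
move=> a1; apply/andP; split.
  rewrite big_nat; apply: sumr_ge0 => j /andP[_ jn]; case/andP: (a1 j jn) => a0 _.
  by rewrite mulr_ge0// ltW.
apply: (@le_trans _ _ (\sum_(n' <= j < n) h)).
  rewrite big_nat [leRHS]big_nat; apply: ler_sum => j /andP[_ jn].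
  by case/andP: (a1 j jn) => _ a2; rewrite ler_piMr// ltW.
by rewrite sumr_const_nat -[leLHS]mulr_natl -[leRHS]nh ler_pM2r// ler_nat leq_subr.
Qed.

Definition gsum : R := \sum_(m < n) g m * r ^+ (2 * m) / (2 * m.+1)%:R.

(* Each polar cell is mapped into (and contains) a slightly dilated (contracted)
   parallelogram whose area is the Jacobian at a node; Parseval on every circle of
   nodes sums these areas. *)
Lemma area_grid_le (K : R) : 0 <= K ->
  (forall z, cmod z <= r -> cmod (f z) <= K * cmod z) ->
  (forall rho, 0 <= rho <= r ->
    \sum_(k < n) (cmod (psum (dps A) (rho%:C%C * root1 R n ^+ k)) ^+ 2 +
                  cmod (psum (dps B) (rho%:C%C * root1 R n ^+ k)) ^+ 2) <=
    n%:R * (\sum_(m < n) g m * rho ^+ (2 * m) + eps)) ->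
  (lam2 image_disk <= (4 * (K * delta) ^+ 2 +
     (1 + eta) ^+ 2 * (tau * r ^+ 2) * (gsum + eps))%:E)%E.
Proof.
move=> K0 fK row; have tau0 : 0 < tau by have := tau_ge4 R; lra.
have tr0 : 0 < tau * r ^+ 2 by rewrite mulr_gt0// exprn_gt0.
pose P jk := para (Phi (ctr jk.1 jk.2)) (phiU (crn jk.1 jk.2)) (phiV (crn jk.1 jk.2))
   ((1 + eta) * (h / 2)).
have mP jk : measurable (P jk) by exact: measurable_para.
have mU : measurable (\big[setU/set0]_(jk <- pairs) P jk) by exact: bigsetU_measurable.
pose b0 := box (0, 0) (K * delta) (K * delta).
have mb0 : measurable b0 by exact: measurable_box.
have Kd : 0 <= K * delta by rewrite mulr_ge0// ltW.
have sub : image_disk `<=` b0 `|` \big[setU/set0]_(jk <- pairs) P jk.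
  move=> p [z zr fz]; have [x [/andP[x0 x1] /andP[y0 y1] zx]] := disk_polar zr.
  have ux : unit_re x by rewrite /unit_re x0 ltW.
  (* The central disk, where the cells are not controlled, is sent into the small box [b0] by |f(z)|
     <= K |z|. *)
  have [xd|dx] := ltP (Re x) delta.
    left; rewrite /b0 box_abs /= !subr0.
    have zK : cmod (f z) <= K * delta.
      apply: le_trans (fK _ (ltW zr)) _; apply: ler_wpM2l => //.
      rewrite zx cmod_polE ?(ltW r0)//; apply: le_trans (ltW xd).
      by rewrite ler_piMl// ltW.
    rewrite fz in zK; split; first exact: le_trans (ler_Re_cmod _) zK.
    exact: le_trans (ler_Im_cmod _) zK.
  right; rewrite -classical_sets.bigcup_seq.
  have xn0 : 0 <= Re x * n%:R by rewrite mulr_ge0.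
  have yn0 : 0 <= Im x * n%:R by rewrite mulr_ge0.
  pose j := Num.trunc (Re x * n%:R); pose k := Num.trunc (Im x * n%:R).
  have /andP[j1 j2] := truncn_itv xn0; have /andP[k1 k2] := truncn_itv yn0.
  rewrite -/j in j1 j2; rewrite -/k in k1 k2.
  have jn : (j < n)%N.
    by rewrite -(ltr_nat R); apply: le_lt_trans j1 _; rewrite -[ltRHS]mul1r ltr_pM2r.
  have kn : (k < n)%N.
    by rewrite -(ltr_nat R); apply: le_lt_trans k1 _; rewrite -[ltRHS]mul1r ltr_pM2r.
  have nj : (n' <= j)%N.
    rewrite -ltnS -(ltr_nat R); apply: le_lt_trans j2.
    by move: dx; rewrite deltaE ler_pdivrMr.
  have j1' : j%:R * h <= Re x by rewrite ler_pdivrMr.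
  have k1' : k%:R * h <= Im x by rewrite ler_pdivrMr.
  have j2' : Re x <= (j%:R + 1) * h by rewrite natr1 ler_pdivlMr// ltW.
  have k2' : Im x <= (k%:R + 1) * h by rewrite natr1 ler_pdivlMr// ltW.
  exists (j, k); first exact: in_pairs.
  apply: (@cell_out R alpha alpha_ge0 A B hAB r r01 C delta eta (h / 2) h
     (ctr j k) (crn j k) hC delta0 (delta_le nj) (crn_unit k (ltnW jn)) _ etaC _ x) => //.
  - by rewrite eta0.
  - by move=> x' hx'; exact: ctr_ball_left.
  - by rewrite supn_le !ReImE /= !ler_norml; do 2 (apply/andP; split); lra.
  - by rewrite /polPhi -zx fz.
apply: le_trans (le_measure _ _ _ sub) _; rewrite ?inE//; first exact: measurable_image_disk.
  exact: measurableU.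
apply: le_trans (measureU2 _ mb0 mU) _.
rewrite EFinD; apply: leeD.
  apply: (@le_trans _ _ (lam2 b0)) => //.
  by rewrite area_box// lee_fin; lra.
apply: le_trans (measure_bigsetU_le _ _ mP) _.
pose G j k := cmod (psum (dps A) ((r * (j%:R * h))%:C%C * root1 R n ^+ k)) ^+ 2 +
  cmod (psum (dps B) ((r * (j%:R * h))%:C%C * root1 R n ^+ k)) ^+ 2.
pose c j k := (1 + eta) ^+ 2 * (tau * r ^+ 2) * (h * (j%:R * h) * (h * G j k)).
have e1 : 0 <= (1 + eta) * (h / 2) by rewrite mulr_ge0 ?addr_ge0// divr_ge0// ltW.
apply: (@le_trans _ _ (\sum_(i <- pairs) (c i.1 i.2)%:E)%E).
  rewrite big_seq [leRHS]big_seq; apply: lee_sum => -[j k] /pairsP /= [nj jn kn].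
  have jp : 0 < j%:R * h by apply: lt_le_trans (delta_le nj).
  have D0 : 0 < cdet (phiU (crn j k)) (phiV (crn j k)).
    exact: (cdet_phi_gt0 alpha_ge0 hAB r01 (crn_unit k (ltnW jn))).
  apply: (@le_trans _ _ (lam2 (P (j, k)))) => //.
  rewrite area_para ?gt_eqF// lee_fin gtr0_norm// cdet_crn /c /G.
  set a := cmod _ ^+ 2; set b := cmod _ ^+ 2.
  have b0' : 0 <= b by exact: sqr_ge0.
  have X0 : 0 <= (1 + eta) ^+ 2 * h ^+ 2 * (tau * r ^+ 2 * (j%:R * h)).
    by apply: mulr_ge0; apply: mulr_ge0; rewrite ?sqr_ge0// ltW.
  (* The sign of |g'|^2 is reversed here, which leaves sums of squares of coefficients. *)
  have : (1 + eta) ^+ 2 * h ^+ 2 * (tau * r ^+ 2 * (j%:R * h)) * (a - b) <=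
         (1 + eta) ^+ 2 * h ^+ 2 * (tau * r ^+ 2 * (j%:R * h)) * (a + b).
    by apply: ler_wpM2l => //; lra.
  move=> H; apply: le_trans (le_trans _ H) _; rewrite le_eqVlt; apply/orP; left; apply/eqP; by field.
rewrite sumEFin lee_fin sum_pairs.
under eq_bigr do rewrite -mulr_sumr -mulr_sumr -mulr_sumr.
rewrite -mulr_sumr; apply: ler_wpM2l.
  by rewrite mulr_ge0 ?sqr_ge0// ltW.
apply: (@le_trans _ _ (\sum_(n' <= j < n) (h * (j%:R * h) * \sum_(m < n) g m * (r * (j%:R * h)) ^+ (2 * m)
    + eps * (h * (j%:R * h))))).
  rewrite big_nat [leRHS]big_nat; apply: ler_sum => j /andP[nj jn].
  rewrite [eps * _]mulrC -mulrDr; apply: ler_wpM2l; first by rewrite mulr_ge0// ltW.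
  have j1 : j%:R * h <= 1 by have := jh jn; have := h0; lra.
  have /row H : 0 <= r * (j%:R * h) <= r by rewrite mulr_ge0 ?(ltW r0)//= ler_piMr// ltW.
  by apply: le_trans (ler_wpM2l (ltW h0) H) _; rewrite [leLHS]mulrA (mulrC h) nh mul1r.
rewrite big_split /=; apply: lerD; first exact: rows_le g0 (ltW r0) n0 n'n.
rewrite -mulr_sumr -[leRHS]mulr1; apply: ler_wpM2l => //.
suff /andP[] : 0 <= \sum_(n' <= j < n) h * (j%:R * h) <= 1 by [].
by apply: sum_h_le => j jn; rewrite jh0; have := jh jn; have := h0; lra.
Qed.

(** The cells are first shrunk by 1 - eta, which makes the closed squares disjoint and hence their
    images too, by injectivity. [cover_in] costs a second factor 1 - eta; in area the two give the
    fourth power. *)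
Lemma area_grid_ge :
  (forall rho, 0 <= rho <= r ->
    n%:R * (\sum_(m < n) g m * rho ^+ (2 * m) - eps) <=
    \sum_(k < n) (cmod (psum (dps A) (rho%:C%C * root1 R n ^+ k)) ^+ 2 -
                  cmod (psum (dps B) (rho%:C%C * root1 R n ^+ k)) ^+ 2)) ->
  (((1 - eta) ^+ 4 * (tau * r ^+ 2) * ((1 - delta ^+ 2) * gsum - eps))%:E <=
   lam2 image_disk)%E.
Proof.
move=> row; have tau0 : 0 < tau by have := tau_ge4 R; lra.
have tr0 : 0 < tau * r ^+ 2 by rewrite mulr_gt0// exprn_gt0.
have et0 : 0 < eta by case/andP: eta01.
pose e' := (1 - eta) * (h / 2).
have e'h : e' < h / 2.
  by rewrite /e' gtr_pMl ?divr_gt0//; lra.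
have e'0 : 0 < e' by rewrite mulr_gt0 ?divr_gt0 ?subr_gt0.
pose P jk := para (Phi (ctr jk.1 jk.2)) (phiU (crn jk.1.+1 jk.2)) (phiV (crn jk.1.+1 jk.2))
   ((1 - eta) * e').
have mP jk : measurable (P jk) by exact: measurable_para.
have mU : measurable (\big[setU/set0]_(jk <- pairs) P jk) by exact: bigsetU_measurable.
have PE jk p : jk \in pairs -> P jk p -> exists x,
    [/\ supn (x - ctr jk.1 jk.2) <= e', unit_re x, 0 < Re x < 1, 0 < Im x < 1 &
     Phi x = (p.1 +i* p.2)%C].
  case: jk => j k /pairsP /= [nj jn kn].
  have dj : delta <= Re (crn j.+1 k).
    by apply: le_trans (delta_le nj) _ => /=; rewrite ler_pM2r// ler_nat.
  have et01 : 0 <= eta < 1 by rewrite eta0.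
  have bl x : supn (x - ctr j k) <= e' -> unit_re x /\ supn (x - crn j.+1 k) <= h.
    by apply: ctr_ball_right => //; exact: ltW.
  move=> /(@cell_in R alpha alpha_ge0 A B hAB r r01 C delta eta e' h
     (ctr j k) (crn j.+1 k) hC delta0 dj (crn_unit k jn) et01 etaC bl p)[x xc xp].
  exists x; have [ux _] := bl _ xc; split => //.
    move: (xc) => /supn_ctr[]; rewrite ler_norml => /andP[x1 x2] _.
    by have := jh jn; have := jh0 j; have := h0 => *; apply/andP; split; lra.
  move: (xc) => /supn_ctr[] _; rewrite ler_norml => /andP[x1 x2].
  by have := jh kn; have := jh0 k; have := h0 => *; apply/andP; split; lra.
have sub : \big[setU/set0]_(jk <- pairs) P jk `<=` image_disk.
  move=> p; rewrite -classical_sets.bigcup_seq => -[jk /= jkp /PE-/(_ jkp)].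
  move=> [x [_ ux /andP[x0 x1] _ xp]]; exists (polE r x) => //.
  suff : cmod (polE r x) < r by [].
  by rewrite cmod_polE ?(ltW r0)// gtr_pMr.
have near (a b : nat) (u : R) : `|u - (a%:R + 1 / 2) * h| <= e' ->
    `|u - (b%:R + 1 / 2) * h| <= e' -> (a <= b)%N.
  rewrite !ler_norml => /andP[a1 a2] /andP[b1 b2].
  rewrite -ltnS -(ltr_nat R) -(ltr_pM2r h0) -natr1.
  by lra.
have disj jk jk' p : jk \in pairs -> jk' \in pairs -> P jk p -> P jk' p -> jk = jk'.
  move=> jkp jkp' /PE-/(_ jkp)[x [xc ux /andP[x0 x1] /andP[y0 y1] xp]].
  move=> /PE-/(_ jkp')[x' [xc' ux' _ /andP[y0' y1'] xp']].
  have xx : x = x'.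
    have xi : `|Im x - Im x'| < 1.
      by rewrite ltr_norml; apply/andP; split; lra.
    exact: (polPhi_inj alpha_ge0 hAB r01 ux ux' x0 xi (etrans xp (esym xp'))).
  move: xc' xp'; rewrite -xx => /supn_ctr[j1' k1'] _; move: xc => /supn_ctr[j1 k1].
  case: jk jk' jkp jkp' j1 k1 j1' k1' => j k [j' k'] /= _ _ j1 k1 j1' k1'.
  congr (_, _); apply/eqP; rewrite eqn_leq.
    by rewrite (near _ _ _ j1 j1') (near _ _ _ j1' j1).
  by rewrite (near _ _ _ k1 k1') (near _ _ _ k1' k1).
apply: le_trans (le_measure _ _ _ sub); rewrite ?inE//; last exact: measurable_image_disk.
apply: (@le_trans _ _ (\sum_(i <- pairs) lam2 (P i))%E); last first.
  rewrite le_eqVlt; apply/orP; left; apply/eqP/esym.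
  by apply: measure_bigsetU_disj; [exact: uniq_pairs|exact: mP|exact: disj].
pose G j k := cmod (psum (dps A) ((r * (j.+1%:R * h))%:C%C * root1 R n ^+ k)) ^+ 2 -
  cmod (psum (dps B) ((r * (j.+1%:R * h))%:C%C * root1 R n ^+ k)) ^+ 2.
pose c j k := (1 - eta) ^+ 4 * (tau * r ^+ 2) * (h * (j.+1%:R * h) * (h * G j k)).
apply: (@le_trans _ _ (\sum_(i <- pairs) (c i.1 i.2)%:E)%E); last first.
  rewrite big_seq [leRHS]big_seq; apply: lee_sum => -[j k] /pairsP /= [nj jn kn].
  have jp : 0 < Re (crn j.+1 k) by rewrite /= mulr_gt0// ltr0n.
  have D0 : 0 < cdet (phiU (crn j.+1 k)) (phiV (crn j.+1 k)).
    exact: (cdet_phi_gt0 alpha_ge0 hAB r01 (crn_unit k jn)).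
  apply: (@le_trans _ _ (lam2 (P (j, k)))) => //.
  rewrite area_para ?gt_eqF//; last by rewrite mulr_ge0 ?(ltW e'0)// subr_ge0 ltW.
  rewrite lee_fin gtr0_norm// cdet_crn /c /G /e'.
  by rewrite le_eqVlt; apply/orP; left; apply/eqP; field.
rewrite sumEFin lee_fin sum_pairs.
under [leRHS]eq_bigr do rewrite -mulr_sumr -mulr_sumr -mulr_sumr.
rewrite -mulr_sumr; apply: ler_wpM2l.
  by apply: mulr_ge0; [rewrite exprn_ge0// subr_ge0 ltW|exact: ltW].
apply: (@le_trans _ _ (\sum_(n' <= j < n) (h * (j.+1%:R * h) *
    \sum_(m < n) g m * (r * (j.+1%:R * h)) ^+ (2 * m)
    - eps * (h * (j.+1%:R * h))))); last first.
  rewrite big_nat [leRHS]big_nat; apply: ler_sum => j /andP[nj jn].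
  rewrite [eps * _]mulrC -mulrBr; apply: ler_wpM2l; first by rewrite mulr_ge0// ltW.
  have j1 : j.+1%:R * h <= 1 by have := jh jn; have := h0; rewrite -natr1; lra.
  have /row H : 0 <= r * (j.+1%:R * h) <= r by rewrite mulr_ge0 ?(ltW r0)//= ler_piMr// ltW.
  by apply: le_trans (ler_wpM2l (ltW h0) H); rewrite [leRHS]mulrA (mulrC h) nh mul1r.
rewrite sumrB; apply: lerB.
  by have := rows_ge n g0 (ltW r0) n0 n'n; rewrite -deltaE.
rewrite -mulr_sumr -[leRHS]mulr1; apply: ler_wpM2l => //.
suff /andP[] : 0 <= \sum_(n' <= j < n) h * (j.+1%:R * h) <= 1 by [].
by apply: sum_h_le => j jn; rewrite jh0; have := jh jn; have := h0; rewrite -natr1; lra.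
Qed.

End AreaGrid.

(** * The area of the image of a disk, as the mesh tends to 0 *)

Section ImageArea.
Variable R : realType.
Variable alpha : R.
Hypothesis alpha_ge0 : 0 <= alpha.
Variables A B : nat -> R[i].
Hypothesis hAB : hpair alpha A B.
Local Notation f := (harm (psum A) (psum B)).
Local Notation tau := (2 * pi : R).
Local Notation lam2 := (@lebesgue_measure R \x @lebesgue_measure R)%E.
Variable r : R.
Hypothesis r01 : 0 < r < 1.
Let tA := tameA hAB.
Let tB := tameB hAB.
Let T : R := tau * r ^+ 2.

Lemma inv_nat_le (x : R) : 0 < x -> exists2 D : nat, (0 < D)%N & D%:R^-1 <= x.
Proof.
move=> x0; exists (Num.trunc x^-1).+1 => //.
by rewrite -[leRHS]invrK lef_pV2 ?posrE ?invr_gt0 ?ltr0n//; exact/ltW/truncnS_gt.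
Qed.

Lemma harm_lip0 : exists2 K, 0 <= K & forall z, cmod z <= r -> cmod (f z) <= K * cmod z.
Proof.
have [KA KA0 hKA] := psum_lip r01 tA; have [KB KB0 hKB] := psum_lip r01 tB.
exists (KA + KB) => [|z zr]; first by rewrite addr_ge0.
have z0 : cmod (0 : R[i]) <= r by rewrite cmod0; case/andP: r01 => /ltW.
have := hKA _ _ z0 zr; have := hKB _ _ z0 zr.
rewrite !subr0 !psum0// (hA0 hAB) (hB0 hAB) !subr0 => hb ha.
by apply: le_trans (cmodD _ _) _; rewrite cmod_conj mulrDl lerD.
Qed.

(** The ratio delta = 1 / D and eta are fixed before the mesh, because the last condition bounds 1 /
    n in terms of both. Taking n = D n' keeps n' / n = 1 / D while n grows. *)
Lemma grid_exists (e1 e2 C : R) (M : nat) : 0 < e1 -> 0 < e2 -> 0 <= C ->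
  exists n n' : nat, exists eta : R,
    [/\ (0 < n)%N, (n' <= n)%N, 0 < n'%:R / n%:R :> R, n'%:R / n%:R <= Num.min e1 1 &
       [/\ 0 < eta < 1, eta <= e2, (M <= n)%N &
           C * n%:R^-1 <= eta * (mu r * r * (n'%:R / n%:R))]].
Proof.
move=> e10 e20 C0; have [D D0 hD] := inv_nat_le e10.
pose eta := Num.min e2 (1 / 2).
have eta0 : 0 < eta by rewrite lt_min e20/= divr_gt0.
have eta1 : eta <= 1 / 2 by rewrite ge_min lexx orbT.
have DR : 0 < D%:R :> R by rewrite ltr0n.
have [r0 r1] := andP r01.
have m0 : 0 < mu r by exact: mu_gt0.
have q0 : 0 < eta * (mu r * r * D%:R^-1).
  by apply: mulr_gt0 => //; apply: mulr_gt0; [exact: mulr_gt0|rewrite invr_gt0].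
have [k k0 hk] := inv_nat_le (divr_gt0 q0 (ltr_wpDl C0 ltr01)).
pose n' := maxn k M; pose n := (D * n')%N.
have n'0 : (0 < n')%N by rewrite /n' leq_max k0.
have n'R : 0 < n'%:R :> R by rewrite ltr0n.
have E : n'%:R / n%:R = D%:R^-1 :> R by rewrite /n natrM; field; rewrite !gt_eqF.
exists n, n', eta; rewrite E; split.
- by rewrite muln_gt0 D0.
- by rewrite /n leq_pmull.
- by rewrite invr_gt0.
- by rewrite le_min hD invf_le1// ler1n.
split.
- by rewrite eta0/=; lra.
- by rewrite ge_min lexx.
- by rewrite /n (leq_trans _ (leq_pmull _ D0))// leq_maxr.
have kn : n%:R^-1 <= k%:R^-1 :> R.
  rewrite lef_pV2 ?posrE ?ltr0n ?muln_gt0 ?D0// ler_nat /n.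
  by rewrite (leq_trans _ (leq_pmull _ D0))// leq_maxl.
have h1 : n%:R^-1 * (C + 1) <= eta * (mu r * r * D%:R^-1).
  by rewrite -ler_pdivlMr ?ltr_wpDl//; exact: le_trans kn hk.
have : 0 <= n%:R^-1 :> R by rewrite invr_ge0.
by move: h1; rewrite mulrDr mulr1 (mulrC C); lra.
Qed.

Let gA m := cmod (dps A m) ^+ 2.
Let gB m := cmod (dps B m) ^+ 2.

Let T0 : 0 < T.
Proof.
have := tau_ge4 R; case/andP: r01 => r0 r1 t4.
by rewrite mulr_gt0 ?exprn_gt0//; lra.
Qed.

Lemma image_area_le (S : R) :
  (forall N, \sum_(m < N) (gA m + gB m) * r ^+ (2 * m) / (2 * m.+1)%:R <= S) ->
  (lam2 (image_disk A B r) <= (T * S)%:E)%E.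
Proof.
move=> hS; have S0 : 0 <= S by have := hS 0%N; rewrite big_ord0.
apply/lee_addgt0Pr => e e0; rewrite -EFinD.
have [K K0 hK] := harm_lip0.
have [C C0 hC] := polPhi_strict hAB r01.
have r01' : 0 <= r < 1 by case/andP: r01 => /ltW -> ->.
(* One third each for the central box, the dilation factor (1 + eta)^2 and the Parseval error. *)
have e3 : 0 < e / 3 by rewrite divr_gt0.
pose eps := Num.min 1 (e / 3 / T).
have eps0 : 0 < eps by rewrite lt_min ltr01 divr_gt0.
have eps1 : eps <= 1 by rewrite ge_min lexx.
have epsT : eps * T <= e / 3 by rewrite -ler_pdivlMr// ge_min lexx orbT.
have [MA rowA] := parseval_row (tame_dps tA) r01' (divr_gt0 eps0 (ltr0Sn R 1)).
have [MB rowB] := parseval_row (tame_dps tB) r01' (divr_gt0 eps0 (ltr0Sn R 1)).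
have TS : 0 < 3 * (T * (S + 1)).
  by rewrite mulr_gt0// mulr_gt0// ltr_wpDl.
have K4 : 0 < 4 * K ^+ 2 + 1 by rewrite ltr_wpDl// mulr_ge0// sqr_ge0.
have [n [n' [eta [n0 n'n d0 d1 [eta01 eta2 Mn etaC]]]]] :=
  grid_exists (maxn MA MB) (divr_gt0 e3 K4) (divr_gt0 e3 TS) C0.
have g0 m : 0 <= gA m + gB m by rewrite addr_ge0// sqr_ge0.
have [eta0 eta1] := andP eta01.
apply: le_trans (area_grid_le alpha_ge0 hAB r01 n0 n'n erefl d0 eta01 hC etaC g0
   (ltW eps0) K0 hK _) _.
  move=> rho rr.
  move: Mn; rewrite geq_max => /andP[/rowA/(_ _ rr) hA /rowB/(_ _ rr) hB].
  rewrite big_split /=.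
  have -> : \sum_(m < n) (gA m + gB m) * rho ^+ (2 * m) =
     \sum_(m < n) cmod (dps A m) ^+ 2 * rho ^+ (2 * m) +
     \sum_(m < n) cmod (dps B m) ^+ 2 * rho ^+ (2 * m).
    by rewrite -big_split; apply: eq_bigr => m _; rewrite mulrDl.
  by move: hA hB; rewrite !ler_norml => /andP[_ hA] /andP[_ hB]; lra.
rewrite lee_fin; set dl := n'%:R / n%:R in d0 d1 etaC *.
set G := gsum _ _ _.
have GS : G <= S by exact: hS.
have G0 : 0 <= G.
  apply: sumr_ge0 => m _; rewrite divr_ge0// mulr_ge0// exprn_ge0//.
  by case/andP: r01 => /ltW.
rewrite le_min in d1; case/andP: d1 => d1 d1'.
have i1 : 4 * (K * dl) ^+ 2 <= e / 3.
  rewrite ler_pdivlMr// in d1.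
  have : 4 * K ^+ 2 * dl ^+ 2 <= 4 * K ^+ 2 * dl.
    apply: ler_wpM2l; first by rewrite mulr_ge0// sqr_ge0.
    by rewrite expr2 ler_piMr// ltW.
  by rewrite [(K * dl) ^+ 2]exprMn; lra.
have i2 : (1 + eta) ^+ 2 <= 1 + 3 * eta by have : eta * eta <= eta * 1; [rewrite ler_pM2l// ltW|lra].
have i3 : 3 * (T * (S + 1)) * eta <= e / 3 by rewrite mulrC -ler_pdivlMr.
have i4 : (1 + eta) ^+ 2 * T * (G + eps) <= (1 + 3 * eta) * T * (S + eps).
  apply: ler_pM => //.
  - by apply: mulr_ge0; [exact: sqr_ge0|exact: ltW].
  - by rewrite addr_ge0// ltW.
  - by apply: ler_wpM2r => //; exact: ltW.
  - by apply: lerD.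
have i5 : 3 * eta * T * (S + eps) <= 3 * eta * T * (S + 1).
  apply: ler_wpM2l; last exact: lerD.
  by apply: mulr_ge0; [apply: mulr_ge0 => //; exact: ltW|exact: ltW].
rewrite -/T; lra.
Qed.

(** With g = 0 the Jacobian is |h'|^2, so Parseval's identity also bounds the area from below; this
    serves the extremal function. *)
Lemma image_area_ge (N : nat) : B = (fun=> 0) ->
  ((T * \sum_(m < N) gA m * r ^+ (2 * m) / (2 * m.+1)%:R)%:E <= lam2 (image_disk A B r))%E.
Proof.
move=> B0; set X := \sum_(m < N) _.
apply/lee_addgt0Pr => e e0; rewrite -leeBlDr// -EFinB.
have [C C0 hC] := polPhi_strict hAB r01.
have r01' : 0 <= r < 1 by case/andP: r01 => /ltW -> ->.
have rge0 : 0 <= r by case/andP: r01'.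
have e3 : 0 < e / 3 by rewrite divr_gt0.
pose eps := e / 3 / T.
have eps0 : 0 < eps by rewrite divr_gt0.
have epsT : eps * T = e / 3 by rewrite /eps divfK// gt_eqF.
have [MA rowA] := parseval_row (tame_dps tA) r01' eps0.
have gt m : 0 <= gA m * r ^+ (2 * m) / (2 * m.+1)%:R.
  by rewrite divr_ge0// mulr_ge0 ?sqr_ge0// exprn_ge0.
have X0 : 0 <= X by apply: sumr_ge0.
have TX : 0 < T * X + 1 by rewrite ltr_wpDl// mulr_ge0// ltW.
have TX4 : 0 < 4 * (T * X + 1) by rewrite mulr_gt0.
have h4 : 0 < Num.min (1 / 4) (e / 3 / (4 * (T * X + 1))).
  by rewrite lt_min !divr_gt0.
have [n [n' [eta [n0 n'n d0 d1 [eta01 eta2 Mn etaC]]]]] :=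
  grid_exists (maxn MA N) (divr_gt0 e3 TX) h4 C0.
have g0 m : 0 <= gA m by rewrite sqr_ge0.
have [eta0 eta1] := andP eta01.
have pB z : cmod z < 1 -> psum (dps B) z = 0.
  move=> z1; apply: psum_uniq => //; first exact: tame_dps.
  rewrite B0; apply: cvgC_eq (cvgC_cst (c := 0)) => k; rewrite big1// => m _.
  by rewrite /dps mulr0 mul0r.
move: Mn; rewrite geq_max => /andP[Mn Nn].
apply: le_trans (area_grid_ge alpha_ge0 hAB r01 n0 n'n erefl d0 eta01 hC etaC g0
   (ltW eps0) _); last first.
  move=> rho rr; have := rowA _ Mn _ rr; rewrite ler_norml => /andP[h1 _].
  under [leRHS]eq_bigr => k _.
    rewrite pB ?cmod0 ?expr0n ?subr0; last first.
      rewrite cmodM cmodX cmod_rt expr1n mulr1 cmodR ger0_norm; last by case/andP: rr.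
      by case/andP: rr => _ rr; apply: le_lt_trans rr _; case/andP: r01.
    over.
  by rewrite /gA; lra.
rewrite lee_fin; set dl := n'%:R / n%:R in d0 d1 etaC *.
set G := gsum _ _ _.
have XG : X <= G.
  rewrite /X /G /gsum (big_ord_widen _ (fun m => gA m * r ^+ (2 * m) / (2 * m.+1)%:R) Nn).
  by rewrite [leLHS]big_mkcond; apply: ler_sum => i _; case: ifP.
rewrite le_min in d1; case/andP: d1 => d1 d1'.
rewrite le_min in eta2; case/andP: eta2 => eta2 eta3.
have i1 : dl * (T * X) <= e / 3.
  rewrite ler_pdivlMr// in d1; lra.
have i2 : 4 * eta * (T * X) <= e / 3.
  rewrite ler_pdivlMr// in eta3; lra.
have dl2 : dl ^+ 2 <= dl by rewrite expr2 ler_piMr// ltW.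
pose Y := (1 - dl ^+ 2) * G - eps.
have YX : (1 - dl) * X - eps <= Y.
  rewrite /Y lerD2r; apply: ler_pM => //; first by rewrite subr_ge0.
  by rewrite lerD2l lerN2.
have TY : T * ((1 - dl) * X - eps) <= T * Y by rewrite ler_pM2l.
rewrite -/T -/Y -mulrA.
have TXY : T * X - e / 3 - e / 3 <= T * Y by lra.
(* For T Y >= 0 one uses (1 - eta)^4 >= 1 - 4 eta; for T Y < 0 a factor at most 1 only increases the
   product. *)
have [Y0|Y0] := leP 0 (T * Y).
  have i3 : 1 - 4 * eta <= (1 - eta) ^+ 4.
    have -> : (1 - eta) ^+ 4 = 1 - 4 * eta + (eta ^+ 2 * (4 * (1 - eta)  + (1 + eta^+2) + 1)) by ring.
    rewrite lerDl mulr_ge0 ?sqr_ge0// !addr_ge0// ?sqr_ge0// mulr_ge0//; lra.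
  have i4 : (1 - 4 * eta) * (T * Y) <= (1 - eta) ^+ 4 * (T * Y) by apply: ler_wpM2r.
  have i5 : (1 - 4 * eta) * (T * X - e / 3 - e / 3) <= (1 - 4 * eta) * (T * Y).
    by apply: ler_wpM2l => //; lra.
  have i6 : 0 <= eta * e by rewrite mulr_ge0// ltW.
  lra.
have i3 : (1 - eta) ^+ 4 <= 1 by rewrite exprn_ile1//; lra.
have : 1 * (T * Y) <= (1 - eta) ^+ 4 * (T * Y) by rewrite ler_nM2r.
lra.
Qed.

End ImageArea.

(** * The distance from 0 to the boundary of the image *)

Section Boundary.
Variable R : realType.
Implicit Types (X : set R[i]) (z w : R[i]).

Lemma nbhsCP X w : nbhs w X <->
  exists2 e : R, 0 < e & forall a, cmod (a - w) < e -> X a.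
Proof.
split=> [/nbhs_ballP[e e0 h]|[e e0 h]].
  exists (Re e); first exact: real_e.
  move=> a ha; apply: h; rewrite -ball_normE /= normCP// cmodC//.
apply/nbhs_ballP; exists e%:C%C; first by rewrite /= ltcR.
by move=> a; rewrite -ball_normE /= normCP ?ltcR// cmodC => /h.
Qed.

Lemma closureCP X w : closure X w <->
  forall e : R, 0 < e -> exists2 a, X a & cmod (a - w) < e.
Proof.
split=> [cX e e0|H Y /nbhsCP[e e0 h]].
  have [|a [Xa ha]] := cX [set a | cmod (a - w) < e]; last by exists a.
  by apply/nbhsCP; exists e.
by have [a Xa /h Ya] := H e e0; exists a.
Qed.

Variable alpha : R.
Hypothesis alpha_ge0 : 0 <= alpha.

(** If |w| were smaller, image points close to w would come from a fixed disk |z| <= s0 by the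
    growth bound. There [harm_open] covers a ball of fixed radius around each image point, so w
    would be interior. *)
Lemma boundary_ge (A B : nat -> R[i]) w : hpair alpha A B ->
  boundary (harm (psum A) (psum B) @` disk 1) w -> extdist alpha <= cmod w.
Proof.
move=> hAB [/closureCP cl ni]; rewrite leNgt; apply/negP => wd; apply: ni.
set f := harm _ _ in cl *.
pose g := (extdist alpha - cmod w) / 4.
have g0 : 0 < g by rewrite divr_gt0// subr_gt0.
have [s0 s01 hs] := extray_near_dd alpha_ge0 g0.
have [e e0 he] := harm_open alpha_ge0 hAB s01 ltr01.
have m0 : 0 < Num.min (e / 2) g by rewrite lt_min divr_gt0.
have [a [z z1 fz]] := cl _ m0; rewrite lt_min => /andP[a1 a2].
have zs : cmod z <= s0.
  rewrite leNgt; apply/negP => sz.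
  have := hs (cmod z); rewrite ltW//= => /(_ z1); rewrite ler_norml => /andP[k1 _].
  have := growth alpha_ge0 hAB z1; rewrite -/(extray alpha (cmod z)) -/f fz => k2.
  have := cmodD (a - w) w; rewrite subrK /g in a2 k1 *; lra.
apply/nbhsCP; exists (e / 2); first by rewrite divr_gt0.
move=> w' hw'.
have [|z' [_ z'1 fz']] := he z w' zs; last by exists z'.
rewrite -/f fz; have := cmodB (w' - w) (a - w).
by rewrite (_ : w' - w - (a - w) = w' - a); [lra|ring].
Qed.

Local Notation ext := (ext alpha).
Definition zeroc (n : nat) : R[i] := 0.

Lemma tame_zeroc : tame zeroc.
Proof. by apply: (@tame_bounded _ _ 0) => n; rewrite cmod0. Qed.

Lemma psum_zeroc z : cmod z < 1 -> psum zeroc z = 0.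
Proof.
move=> z1; apply: psum_uniq => //; first exact: tame_zeroc.
by apply: cvgC_eq (cvgC_cst (c := 0)) => k; rewrite big1// => m _; rewrite mul0r.
Qed.

Lemma pps_zeroc : pps alpha zeroc = zeroc.
Proof. by apply/funext => n; rewrite /pps /dps /zeroc !mulr0. Qed.

Lemma hpair_ext : hpair alpha ext zeroc.
Proof.
split=> //; [exact: tame_ext|exact: tame_zeroc|].
move=> z z1; rewrite pps_zeroc psum_zeroc// cmod0.
exact/ltW/(Re_psum_pps_ext alpha_ge0).
Qed.

Lemma ext_ge0 n : exists2 x : R, 0 <= x & ext n = x%:C%C.
Proof.
case: n => [|[|n]].
- by exists 0.
- by exists 1.
exists (2 / (n.+2%:R * (1 + n.+1%:R * alpha))) => //.
by rewrite divr_ge0// mulr_ge0// addr_ge0// mulr_ge0.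
Qed.

Lemma psum_ext_conj z : cmod z < 1 -> psum ext z^*%C = (psum ext z)^*%C.
Proof.
move=> z1; have tE := tame_ext alpha_ge0.
apply: psum_uniq => //; first by rewrite cmod_conj.
have /cvgCP H := psum_cvg z1 tE.
apply/cvgCP => e /H[N hN]; exists N => n /hN.
rewrite -cmod_conj; congr (cmod _ < e).
have -> : \sum_(n0 < n) ext n0 * z^*%C ^+ n0 = (\sum_(n0 < n) ext n0 * z ^+ n0)^*%C.
  rewrite conj_sum; apply: eq_bigr => k _; have [x _ ->] := ext_ge0 k.
  by rewrite -conjX -[in LHS](conjc_real x); apply/esym/(rmorphM (@conjc R)).
by rewrite rmorphB.
Qed.

Lemma Re_psum_ext_ge0 (x : R) : 0 <= x < 1 -> 0 <= Re (psum ext x%:C%C).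
Proof.
move=> /andP[x0 x1]; have z1 : cmod (x%:C%C) < 1 by rewrite cmodR ger0_norm.
apply: (Re_cvg_ge (psum_cvg z1 (tame_ext alpha_ge0))); exists 0%N => n _.
rewrite cRe_sum; apply: sumr_ge0 => k _; have [y y0 ->] := ext_ge0 k.
by rewrite -rmorphXn -rmorphM /= mulr_ge0// exprn_ge0.
Qed.

Lemma fE z : cmod z < 1 -> harm (psum ext) (psum zeroc) z = psum ext z.
Proof. by move=> z1; rewrite /harm psum_zeroc// conjc0 addr0. Qed.

Lemma psum_ext_neg (s : R) : 0 <= s < 1 -> psum ext (- s%:C%C) = (- extray alpha s)%:C%C.
Proof.
move=> /andP[s0 s1]; have z1 : cmod (- s%:C%C) < 1 by rewrite cmodN cmodR ger0_norm.
have e : - s%:C%C = (- s)%:C%C by rewrite rmorphN.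
rewrite e in z1 *; have := psum_ext_conj z1; rewrite conjc_real => h.
apply: complexP; first by rewrite /extray opprK -e.
have := congr1 (@Im R) h; rewrite cImJ -[Im (- extray _ _)%:C%C]/0.
by move: (Im _) => y; lra.
Qed.

(** The point is a radial limit. It is not interior: a real value slightly below it would, by
    conjugation symmetry and injectivity, be taken at a real point, where values stay above -
    [extdist]. *)
Lemma boundary_ext : boundary (harm (psum ext) (psum zeroc) @` disk 1) (- extdist alpha)%:C%C.
Proof.
split.
  apply/closureCP => e e0; have e2 : 0 < e / 2 by rewrite divr_gt0.
  have [s /andP[s0 s1] hs] := extray_near_dd alpha_ge0 e2.
  have z1 : cmod (- s%:C%C) < 1 by rewrite cmodN cmodR ger0_norm.
  exists (harm (psum ext) (psum zeroc) (- s%:C%C)); first by exists (- s%:C%C).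
  rewrite fE// psum_ext_neg ?s0// -rmorphB cmodR -normrN.
  have := hs s; rewrite lexx s1 => /(_ isT).
  by rewrite (_ : - (- extray alpha s - - extdist alpha) = extray alpha s - extdist alpha); [lra|ring].
move=> /nbhsCP[e e0 H].
have [|z z1 fz] := H (- extdist alpha - e / 2)%:C%C.
  rewrite -rmorphB cmodR (_ : - extdist alpha - e / 2 - - extdist alpha = - (e / 2)); last by ring.
  by rewrite normrN gtr0_norm; lra.
rewrite /disk/= in z1; rewrite fE// in fz.
have zc : z^*%C = z.
  have z1' : cmod z^*%C < 1 by rewrite cmod_conj.
  apply: (harm_inj alpha_ge0 hpair_ext z1' z1).
  by rewrite !fE// psum_ext_conj// fz conjc_real.
have zr : z = (Re z)%:C%C.
  apply: complexP => //=; have := congr1 (@Im R) zc; rewrite cImJ; lra.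
have zl : `|Re z| < 1 by exact: le_lt_trans (ler_Re_cmod z) z1.
have fr : Re (psum ext z) = - extdist alpha - e / 2 by rewrite fz.
have d0 := extdist_gt0 alpha_ge0.
move: zl; rewrite ltr_norml => /andP[x1 x2].
have [x0|x0] := leP 0 (Re z).
  have := @Re_psum_ext_ge0 (Re z); rewrite x0 x2 => /(_ isT).
  have -> : psum ext (Re z)%:C%C = psum ext z by congr psum; exact/esym/zr.
  by rewrite fr; lra.
have s01 : 0 <= - Re z < 1 by apply/andP; split; lra.
have := extray_le_dd alpha_ge0 s01; rewrite /extray rmorphN opprK.
have -> : psum ext (Re z)%:C%C = psum ext z by congr psum; exact/esym/zr.
by rewrite fr; lra.
Qed.

End Boundary.

(** * The radius equation split into its coefficient part and its area part *)

Section Series.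
Variable R : realType.
Variable alpha : R.
Hypothesis alpha_ge0 : 0 <= alpha.
Local Notation cden := (cden alpha).

(** [lin_sum] bounds the coefficient sum and [sq_sum] the area, up to factors 2; indices are shifted
    by 2. *)
Definition lin_sum r N := \sum_(n < N) (r ^+ n.+2 / (n.+2%:R * cden n.+2)).
Definition sq_sum r N := \sum_(n < N) (2 * r ^+ (2 * n.+2) / (n.+2%:R * cden n.+2 ^+ 2)).

Lemma bsum_pq r N : bsum alpha r N.+2 = lin_sum r N + sq_sum r N.
Proof.
rewrite /bsum -{1}[2%N]add0n big_addn subn2 big_mkord -big_split /=.
by apply: eq_bigr => n _; rewrite addn2 btermE.
Qed.

Lemma ncc2_gt0 n : 0 < n.+1%:R * cden n.+1 ^+ 2.
Proof. by rewrite mulr_gt0// exprn_gt0//; have := ncc_gt0 alpha_ge0 n; rewrite pmulr_rgt0. Qed.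

Lemma lin_sum_nd r : 0 <= r -> nondecreasing_seq (lin_sum r).
Proof.
move=> r0; apply/nondecreasing_seqP => N; rewrite /lin_sum big_ord_recr/= lerDl.
by rewrite divr_ge0 ?exprn_ge0// ltW// ncc_gt0.
Qed.

Lemma sq_sum_nd r : 0 <= r -> nondecreasing_seq (sq_sum r).
Proof.
move=> r0; apply/nondecreasing_seqP => N; rewrite /sq_sum big_ord_recr/= lerDl.
by apply: divr_ge0; [rewrite mulr_ge0 ?exprn_ge0|exact/ltW/ncc2_gt0].
Qed.

Lemma lin_sum_ge0 r N : 0 <= r -> 0 <= lin_sum r N.
Proof. by move=> /lin_sum_nd /(_ _ _ (leq0n N)); rewrite {1}/lin_sum big_ord0. Qed.

Lemma sq_sum_ge0 r N : 0 <= r -> 0 <= sq_sum r N.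
Proof. by move=> /sq_sum_nd /(_ _ _ (leq0n N)); rewrite {1}/sq_sum big_ord0. Qed.

Lemma bohr_fun_pq r : 0 <= r < 1 -> exists P Q,
  [/\ bohr_fun alpha r = r + r ^+ 2 + 2 * (P + Q) - extdist alpha,
      forall N, lin_sum r N <= P & forall N, sq_sum r N <= Q].
Proof.
move=> /[dup] r01 /andP[r0 _]; have cvb := bsum_cvg alpha_ge0 r01.
have le_bs N : lin_sum r N + sq_sum r N <= limn (bsum alpha r).
  by rewrite -bsum_pq; apply: nondecreasing_cvgn_le => //; exact: bsum_nd.
have ub (u : nat -> R) : (forall N, u N <= limn (bsum alpha r)) -> has_ubound (range u).
  by move=> h; exists (limn (bsum alpha r)) => _ [N _ <-].
have cp : cvgn (lin_sum r).
  apply: nondecreasing_is_cvgn (lin_sum_nd r0) (ub _ _) => N.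
  by apply: le_trans (le_bs N); rewrite lerDl sq_sum_ge0.
have cq : cvgn (sq_sum r).
  apply: nondecreasing_is_cvgn (sq_sum_nd r0) (ub _ _) => N.
  by apply: le_trans (le_bs N); rewrite lerDr lin_sum_ge0.
exists (limn (lin_sum r)), (limn (sq_sum r)); split; last 2 first.
- by move=> N; apply: nondecreasing_cvgn_le => //; exact: lin_sum_nd.
- by move=> N; apply: nondecreasing_cvgn_le => //; exact: sq_sum_nd.
rewrite bohr_funE; congr (_ + 2 * _ - _).
rewrite -[LHS]/(limn (bsum alpha r)).
apply/cvg_lim => //; rewrite -(cvg_shiftn 2%N).
rewrite (_ : (fun N => bsum alpha r (N + 2)%N) = (fun N => lin_sum r N + sq_sum r N)).
  exact: cvgD cp cq.
by apply/funext => N; rewrite addn2 bsum_pq.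
Qed.

Lemma bohr_fun_le0 r : 0 <= r < 1 ->
  (forall N, r + r ^+ 2 + 2 * (lin_sum r N + sq_sum r N) <= extdist alpha) -> bohr_fun alpha r <= 0.
Proof.
move=> r01 H; rewrite bohr_funE.
suff : limn (bsum alpha r) <= (extdist alpha - r - r ^+ 2) / 2.
  by rewrite -[limn (bsum alpha r)]/(limn (fun N => \sum_(2 <= n < N) bterm alpha r n)); lra.
apply: limr_le; first exact: bsum_cvg.
exists 2%N => // -[|[|N]]// _; rewrite bsum_pq; have := H N; lra.
Qed.

End Series.

(** * From the class of the statement to coefficient sequences *)

Section Class.
Variable R : realType.
Implicit Types (h g : R[i] -> R[i]) (a b A B : nat -> R[i]) (z : R[i]).

Lemma harm_image A B h g r : r <= 1 ->
  (forall z, cmod z < 1 -> h z = psum A z) ->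
  (forall z, cmod z < 1 -> g z = psum B z) ->
  harm h g @` disk r = harm (psum A) (psum B) @` disk r.
Proof.
move=> r1 hA gB; apply/seteqP; split=> _ [z zr <-]; exists z => //.
  by rewrite /harm hA ?gB//; exact: lt_le_trans zr r1.
by rewrite /harm hA ?gB//; exact: lt_le_trans zr r1.
Qed.

Lemma psum_derive1n2 (F : R[i] -> R[i]) A z : tame A ->
  (forall w, cmod w < 1 -> F w = psum A w) -> cmod z < 1 ->
  derive1n 2 F z = psum (dps (dps A)) z.
Proof.
move=> tA FA z1; rewrite /derive1n /=.
by have [] := psum_deriv (tame_dps tA) (fun w w1 => (psum_deriv tA FA w1).2) z1.
Qed.

Lemma psum_pps_derive (alpha : R) (F : R[i] -> R[i]) A z : tame A ->
  (forall w, cmod w < 1 -> F w = psum A w) -> cmod z < 1 ->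
  derive1 F z + alpha%:C%C * z * derive1n 2 F z = psum (pps alpha A) z.
Proof.
move=> tA FA z1; rewrite (psum_derive1n2 tA FA z1) psum_pps//.
by have [_ ->] := psum_deriv tA FA z1.
Qed.

Definition coef_h a (n : nat) : R[i] := if n is n'.+2 then a n else (n == 1)%:R.
Definition coef_g b (n : nat) : R[i] := if n is n'.+2 then b n else 0.

Lemma coefs_h_psum h a : coefs_h h a ->
  tame (coef_h a) /\ forall z, cmod z < 1 -> h z = psum (coef_h a) z.
Proof.
move=> ha; apply: tame_cvg => z z1.
move: (ha z z1); rewrite -(cvg_shiftn 2%N) => H; rewrite -(cvg_shiftn 2%N).
move: H; apply: cvgC_eq => N /=; rewrite addn2 2!big_ord_recl /= mul0r add0r mul1r; congr (_ + _).
rewrite -{1}[2%N]add0n big_addn subn2 big_mkord; apply: eq_bigr => n _.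
by rewrite /bump /= !add1n addn2.
Qed.

Lemma coefs_g_psum g b : coefs_g g b ->
  tame (coef_g b) /\ forall z, cmod z < 1 -> g z = psum (coef_g b) z.
Proof.
move=> hb; apply: tame_cvg => z z1.
move: (hb z z1); rewrite -(cvg_shiftn 2%N) => H; rewrite -(cvg_shiftn 2%N).
move: H; apply: cvgC_eq => N /=; rewrite addn2 2!big_ord_recl /= !mul0r !add0r.
rewrite -{1}[2%N]add0n big_addn subn2 big_mkord; apply: eq_bigr => n _.
by rewrite /bump /= !add1n addn2.
Qed.

Lemma classW0_hpair (alpha : R) h g a b :
  classW0 alpha h g -> coefs_h h a -> coefs_g g b ->
  hpair alpha (coef_h a) (coef_g b).
Proof.
move=> [_ dom] /coefs_h_psum[tA hA] /coefs_g_psum[tB gB]; split=> // z z1.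
rewrite -(psum_pps_derive alpha tA hA z1) -(psum_pps_derive alpha tB gB z1).
exact/ltW/dom.
Qed.

End Class.

(** * Bounds for the area term *)

Section Bohr.
Variable R : realType.
Variable alpha : R.
Hypothesis alpha_ge0 : 0 <= alpha.
Implicit Types (h g : R[i] -> R[i]) (a b A B : nat -> R[i]) (z : R[i]).
Local Notation cden := (cden alpha).
Local Notation ext := (ext alpha).

Lemma cmod_dps A n : cmod (dps A n) = n.+1%:R * cmod (A n.+1).
Proof. by rewrite /dps cmodM cmod_nat. Qed.

(** The sum of squares is at most the square of the sum, which [coef_bound] controls. *)
Lemma dps_le A B n : hpair alpha A B ->
  cmod (dps A n.+1) ^+ 2 + cmod (dps B n.+1) ^+ 2 <= 4 / cden n.+2 ^+ 2.
Proof.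
move=> hAB; have [|//] := coef_bound alpha_ge0 hAB n.+1.
have c0 : 0 < cden n.+2 by have := ncc_gt0 alpha_ge0 n.+1; rewrite pmulr_rgt0.
have n0 : 0 < n.+2%:R :> R by [].
rewrite !cmod_dps invfM mulrCA ler_pdivlMl// mulrDr => hs.
have x0 : 0 <= n.+2%:R * cmod (A n.+2) by rewrite mulr_ge0// cmod_ge0.
have y0 : 0 <= n.+2%:R * cmod (B n.+2) by rewrite mulr_ge0// cmod_ge0.
move: hs x0 y0; set x := (X in X + _ <= _); set y := (X in _ + X <= _) => hs x0 y0.
apply: (@le_trans _ _ ((x + y) ^+ 2)); first by rewrite sqrrD addrAC lerDl mulrn_wge0// mulr_ge0.
rewrite (_ : 4 / _ = (2 / cden n.+2) ^+ 2); last by rewrite expr_div_n; congr (_ / _); ring.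
by rewrite ler_sqr ?nnegrE ?addr_ge0// divr_ge0// ltW.
Qed.

Lemma sq_sum_term r n : 0 < r -> 4 / cden n.+2 ^+ 2 * r ^+ (2 * n.+1) / (2 * n.+2)%:R =
  2 * r ^+ (2 * n.+2) / (n.+2%:R * cden n.+2 ^+ 2) / r ^+ 2.
Proof.
move=> r0; have c0 : 0 < cden n.+2 by have := ncc_gt0 alpha_ge0 n.+1; rewrite pmulr_rgt0.
have n0 : n.+2%:R != 0 :> R by rewrite pnatr_eq0.
rewrite [in RHS](_ : (2 * n.+2 = 2 * n.+1 + 2)%N); last lia.
rewrite exprD natrM; field.
by rewrite !lt0r_neq0// ltr_wpDr.
Qed.

Lemma area_ub A B r Q : hpair alpha A B -> 0 < r < 1 -> (forall N, sq_sum alpha r N <= Q) ->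
  (area (harm (psum A) (psum B) @` disk r) <= (pi * (r ^+ 2 + 2 * Q))%:E)%E.
Proof.
move=> hAB /[dup] r01 /andP[r0 _] hQ.
(* The form required by [image_area_le]; 1/2 is the term m = 0, which comes from h'(0) = 1. *)
rewrite (_ : pi * _ = 2 * pi * r ^+ 2 * (2^-1 + Q / r ^+ 2)); last first.
  by field; rewrite lt0r_neq0.
apply: (image_area_le alpha_ge0 hAB r01) => -[|N].
  rewrite big_ord0; have := hQ 0%N; rewrite /sq_sum big_ord0 => Q0.
  by rewrite addr_ge0// divr_ge0// exprn_ge0// ltW.
rewrite big_ord_recl; apply: lerD.
  rewrite !cmod_dps (hA1 hAB) (hB1 hAB) cmod0 cmod1 mulr0 expr0n addr0 expr0 !mulr1.
  by rewrite expr1n mul1r.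
rewrite ler_pdivlMr ?exprn_gt0//; apply: le_trans (hQ N).
rewrite /sq_sum mulr_suml; apply: ler_sum => n _.
rewrite -ler_pdivlMr ?exprn_gt0// -sq_sum_term//.
rewrite ler_pM2r ?invr_gt0 ?ltr0n// ler_pM2r ?exprn_gt0//.
exact: dps_le.
Qed.

Lemma area_ext r N : 0 < r < 1 ->
  ((pi * (r ^+ 2 + 2 * sq_sum alpha r N))%:E <=
   area (harm (psum ext) (psum (@zeroc R)) @` disk r))%E.
Proof.
move=> /[dup] r01 /andP[r0 _].
apply: le_trans (image_area_ge alpha_ge0 (hpair_ext alpha_ge0) r01 N.+1 erefl).
rewrite lee_fin big_ord_recl cmod_dps mul1r.
rewrite (_ : cmod (ext 1) = 1 :> R); last exact: cmod1.
rewrite expr1n expr0 mulr1.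
rewrite (_ : \sum_(i < N) _ = sq_sum alpha r N / r ^+ 2).
  by rewrite le_eqVlt; apply/orP; left; apply/eqP; rewrite muln1; field; rewrite lt0r_neq0.
rewrite /sq_sum mulr_suml; apply: eq_bigr => n _.
rewrite lift0 -sq_sum_term// cmod_dps extSS -(cdenS alpha n.+1).
have c0 : 0 < cden n.+2 by have := ncc_gt0 alpha_ge0 n.+1; rewrite pmulr_rgt0.
rewrite cmodR ger0_norm; last by rewrite divr_ge0// mulr_ge0// ltW.
congr (_ * _ / _); field.
by rewrite !lt0r_neq0// ltr_wpDr.
Qed.

End Bohr.

(** * The Bohr inequality and its sharpness *)

Section Main.
Variable R : realType.
Variable alpha : R.
Hypothesis alpha_ge0 : 0 <= alpha.
Implicit Types (h g : R[i] -> R[i]) (a b A B : nat -> R[i]) (z : R[i]).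
Local Notation cden := (cden alpha).
Local Notation ext := (ext alpha).
Local Notation zeroc := (@zeroc R).

Lemma bohr_ineq_le h g a b z : classW0 alpha h g -> coefs_h h a -> coefs_g g b ->
  cmod z < 1 -> bohr_fun alpha (cmod z) <= 0 -> bohr_ineq h g a b z.
Proof.
move=> W ha gb z1 hz; have hAB := classW0_hpair W ha gb.
have [_ hA] := coefs_h_psum ha; have [_ gB] := coefs_g_psum gb.
have z0 := cmod_ge0 z.
have f0 : harm h g 0 = 0.
  by have [[[_ _ h0 _ g0] _] _] := W; rewrite /harm h0 g0 conjc0 addr0.
rewrite /bohr_ineq f0 (harm_image (lexx 1) hA gB) (harm_image (ltW z1) hA gB).
set E := (\big[_/_]_(2 <= n <oo) _)%E.
apply: (@le_trans _ _ (extdist alpha)%:E); last first.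
  apply/ereal_infP => _ [w /(boundary_ge alpha_ge0 hAB) hw <-].
  by rewrite lee_fin sub0r cmodN.
have r01 : 0 <= cmod z < 1 by rewrite z0.
have [P [Q [eF hP hQ]]] := bohr_fun_pq alpha_ge0 r01.
have hE : (E <= (2 * P)%:E)%E.
  apply: lime_le.
    by apply: is_cvg_nneseries => n _ _; rewrite lee_fin mulr_ge0 ?addr_ge0 ?exprn_ge0 ?cmod_ge0.
  exists 2%N => // -[|[|N]]// _; rewrite sumEFin lee_fin.
  apply: le_trans (_ : 2 * lin_sum alpha (cmod z) N <= _); last by rewrite ler_pM2l.
  rewrite -{1}[2%N]add0n big_addn subn2 big_mkord /lin_sum mulr_sumr.
  apply: ler_sum => n _; rewrite addn2 [leRHS]mulrCA [leRHS]mulrC.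
  apply: ler_wpM2r; first exact: exprn_ge0.
  by have [|] := coef_bound alpha_ge0 hAB n.+1.
(* The area estimate needs a positive radius; for z = 0 the disk is empty and the left side
   vanishes. *)
have [r0|] := ltP 0 (cmod z); last first.
  move=> r0; have {r0 z0} r0 : cmod z = 0 by apply/eqP; rewrite eq_le r0.
  rewrite (_ : disk (cmod z) = set0); last first.
    rewrite r0; apply/seteqP; split=> // w hw.
    by have := cmod_ge0 w; rewrite leNgt hw.
  rewrite image_set0 (_ : area set0 = 0%E); last exact: measure0.
  rewrite mul0e adde0 r0 add0e /E eseries0 ?lee_fin ?ltW ?extdist_gt0//.
  by move=> [|[|n]]// _ _; rewrite r0 expr0n/= mulr0.
have r01' : 0 < cmod z < 1 by rewrite r0.
have ar := area_ub alpha_ge0 hAB r01' hQ.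
apply: (@le_trans _ _ ((cmod z)%:E + (2 * P)%:E + (cmod z ^+ 2 + 2 * Q)%:E)%E).
  rewrite leeD ?leeD2l//.
  apply: (@le_trans _ _ ((pi * (cmod z ^+ 2 + 2 * Q))%:E * (pi^-1)%:E)%E).
    by rewrite lee_wpmul2r// lee_fin invr_ge0 pi_ge0.
  by rewrite -EFinM lee_fin mulrAC divff ?mul1r// lt0r_neq0// pi_gt0.
rewrite -!EFinD lee_fin; rewrite eF in hz; lra.
Qed.

Lemma classW0_ext : classW0 alpha (psum ext) (psum zeroc).
Proof.
have tE := tame_ext alpha_ge0; have tZ := @tame_zeroc R.
have dE z (z1 : cmod z < 1) := psum_deriv tE (fun _ _ => erefl) z1.
have dZ z (z1 : cmod z < 1) := psum_deriv tZ (fun _ _ => erefl) z1.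
have c01 : cmod (0 : R[i]) < 1 by rewrite cmod0.
split; first split; first split.
- by move=> z /dE[].
- by move=> z /dZ[].
- by rewrite psum0.
- by have [_ ->] := dE _ c01; rewrite (psum0 (tame_dps tE)); exact: mul1r.
- by rewrite psum0.
- by have [_ ->] := dZ _ c01; rewrite (psum0 (tame_dps tZ)); exact: mulr0.
move=> z z1.
have eE := @psum_pps_derive R alpha (psum ext) ext z tE (fun _ _ => erefl) z1.
have eZ := @psum_pps_derive R alpha (psum zeroc) zeroc z tZ (fun _ _ => erefl) z1.
have h : cmod (psum (pps alpha zeroc) z) < Re (psum (pps alpha ext) z).
  by rewrite pps_zeroc psum_zeroc// cmod0; exact: Re_psum_pps_ext.
rewrite -eE -eZ in h; exact: h.
Qed.

Lemma psum_coefs A z : tame A -> cmod z < 1 ->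
  (A 0%N + A 1%N * z + \sum_(2 <= n < N) A n * z ^+ n) @[N --> \oo] --> psum A z.
Proof.
move=> tA z1; move: (psum_cvg z1 tA); rewrite -(cvg_shiftn 2%N) => H.
rewrite -(cvg_shiftn 2%N); move: H; apply: cvgC_eq => N /=.
rewrite addn2 2!big_ord_recl /= expr0 mulr1 expr1 addrA; congr (_ + _).
rewrite -{1}[2%N]add0n big_addn subn2 big_mkord; apply: eq_bigr => n _.
by rewrite /bump /= !add1n addn2.
Qed.

(** For the extremal pair the left side dominates every partial sum of the radius equation, and the
    right side is at most [extdist], because - [extdist] is a boundary point. *)
Lemma bohr_ineq_ext r : 0 < r < 1 ->
  bohr_ineq (psum ext) (psum zeroc) ext zeroc r%:C%C -> bohr_fun alpha r <= 0.
Proof.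
move=> /[dup] r01 /andP[r0 r1]; rewrite /bohr_ineq cmodR gtr0_norm//.
set E := (\big[_/_]_(2 <= n <oo) _)%E => H.
apply: bohr_fun_le0 => //; first by rewrite ltW.
move=> N; rewrite -lee_fin.
have e0 : harm (psum ext) (psum zeroc) 0 = 0.
  by rewrite fE ?cmod0// (psum0 (tame_ext alpha_ge0)).
apply: (le_trans _ (le_trans H _)); last first.
  rewrite e0; apply: ge_ereal_inf; exists (extdist alpha)%:E => //.
  exists (- extdist alpha)%:C%C; first exact: boundary_ext.
  by rewrite sub0r cmodN cmodR normrN gtr0_norm ?extdist_gt0.
rewrite (_ : r + r ^+ 2 + _ = r + 2 * lin_sum alpha r N + (r ^+ 2 + 2 * sq_sum alpha r N)); last by ring.
rewrite 2!EFinD; apply: leeD; first apply: leeD2l.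
  apply: le_trans (nneseries_lim_ge N.+2 _); last first.
    by move=> n _ _; rewrite lee_fin mulr_ge0 ?addr_ge0 ?exprn_ge0 ?cmod_ge0 ?ltW.
  rewrite sumEFin lee_fin [leRHS](big_addn 0 _ 2) subn2 big_mkord /lin_sum mulr_sumr.
  apply: ler_sum => n _; rewrite addn2 cmod0 addr0 extSS -(cdenS alpha n.+1) cmodR.
  rewrite ger0_norm; last by apply: divr_ge0 => //; exact/ltW/ncc_gt0.
  by rewrite mulrCA mulrC.
apply: (@le_trans _ _ ((pi * (r ^+ 2 + 2 * sq_sum alpha r N))%:E * (pi^-1)%:E)%E).
  by rewrite -EFinM lee_fin mulrAC divff ?mul1r// lt0r_neq0// pi_gt0.
apply: lee_wpmul2r; first by rewrite lee_fin invr_ge0 pi_ge0.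
exact: area_ext.
Qed.

End Main.

Theorem theorem3p4 (R : realType) (alpha : R) (alpha_ge0 : 0 <= alpha)
    (alpha_lt1 : alpha < 1) :
  exists r4 : R,
    [/\ unique (fun r : R => 0 < r < 1 /\ bohr_fun alpha r = 0) r4,
        forall (h g : R[i] -> R[i]) (a b : nat -> R[i]),
          classW0 alpha h g -> coefs_h h a -> coefs_g g b ->
          forall z : R[i], cmod z <= r4 -> bohr_ineq h g a b z
      & forall rho : R, r4 < rho ->
          ~ (forall (h g : R[i] -> R[i]) (a b : nat -> R[i]),
               classW0 alpha h g -> coefs_h h a -> coefs_g g b ->
               forall z : R[i], cmod z < 1 -> cmod z <= rho ->
                 bohr_ineq h g a b z)].
Proof.
have [r4 /andP[r40 r41] F0] := bohr_fun_root alpha_ge0 (ltW alpha_lt1).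
have lt := bohr_fun_lt alpha_ge0.
exists r4; split.
- split=> [|s [/andP[s0 s1] Fs]]; first by rewrite r40.
  have [h|h|//] := ltgtP r4 s.
    by have := lt _ _ (ltW r40) h s1; rewrite F0 Fs ltxx.
  by have := lt _ _ (ltW s0) h r41; rewrite F0 Fs ltxx.
- move=> h g a b W ha gb z zr.
  apply: (bohr_ineq_le alpha_ge0 W ha gb); first exact: le_lt_trans zr r41.
  move: zr; rewrite le_eqVlt => /orP[/eqP ->|zr]; first by rewrite F0.
  by rewrite -F0; exact/ltW/lt/r41/zr/cmod_ge0.
move=> rho hr H.
(* rho may be 1 or more, so the counterexample uses a radius below 1. *)
have [r /andP[r4r rr] r1] : exists2 r, r4 < r <= rho & r < 1.
  exists (Num.min rho ((r4 + 1) / 2)); last by rewrite gt_min; apply/orP; right; lra.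
  by rewrite lt_min hr ge_min lexx/= andbT; lra.
have r01 : 0 < r < 1 by rewrite r1 (lt_trans r40).
have cr : cmod r%:C%C = r by rewrite cmodR gtr0_norm//; case/andP: r01.
have : bohr_fun alpha r <= 0.
  apply: bohr_ineq_ext => //; apply: H; rewrite ?cr//.
  - exact: classW0_ext.
  - move=> z z1; have := psum_coefs (tame_ext alpha_ge0) z1.
    by apply: cvgC_eq => N; rewrite add0r mul1r.
  - move=> z z1; have := psum_coefs (@tame_zeroc R) z1.
    by apply: cvgC_eq => N; rewrite mul0r !add0r.
by rewrite leNgt -F0 lt// ltW.
Qed.
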